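(* Let $\Omega\subset\mathbb{C}^n$ be open. Then each distribution $T\in\mathscr{O}(\Omega)$ is complex-analytic, i.e., $T$ is generated by a function $f$ on $\Omega$ such that for each $p\in\Omega$ there is a neighborhood $U$ of $p$ in which $f$ is represented by a Taylor series centered at $p$, $f(z)=\sum_{\alpha\in\mathbb{N}^n}c_\alpha(z-p)^\alpha$ for $z\in U$, with $c_\alpha\in\mathbb{C}$.
   Context: $\mathbb{N}$ includes $0$, and $(z-p)^\alpha=\prod_j(z_j-p_j)^{\alpha_j}$. $\mathscr{D}'(\Omega)$ is the space of distributions on $\Omega$ (with $\mathbb{C}^n\cong\mathbb{R}^{2n}$), and $\mathscr{O}(\Omega)=\{T\in\mathscr{D}'(\Omega):\partial T/\partial\overline{z_j}=0,\ 1\le j\le n\}$ is the space of holomorphic distributions. A locally integrable function $f$ generates the distribution $\phi\mapsto\int_\Omega f\phi\,dV$, where $dV$ is Lebesgue measure. *)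

(* Defs.v *)
From HB Require Import structures.
From mathcomp Require Import all_boot all_order all_algebra.
From mathcomp Require Import finmap complex.
From mathcomp Require Import all_classical all_reals all_analysis.
From mathcomp.analysis.showcase Require summability.
Set Implicit Arguments.
Unset Strict Implicit.
Unset Printing Implicit Defensive.
Import Order.TTheory GRing.Theory Num.Theory.
Import numFieldNormedType.Exports.

Local Open Scope classical_set_scope.
Local Open Scope ring_scope.
Local Open Scope complex_scope.

(* The library puts the norm topology on the regular module R[i]^o only.
   'rV[R[i]]_n then inherits the product topology. *)
HB.instance Definition _ (R : rcfType) := PseudoPointedMetric.copy R[i] R[i]^o.
HB.instance Definition _ (R : rcfType) := NormedModule.copy R[i] R[i]^o.

Section complex_space.
Context {R : realType} {n : nat}.
Local Notation C := R[i].
Local Notation Re := (@complex.Re R).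
Local Notation Im := (@complex.Im R).
Local Notation Cn := 'rV[R[i]]_n.
Implicit Types (phi f : Cn -> C) (z : Cn).

(* Real coordinate directions of C^n = R^{2n}: inl j is the x_j-axis and inr j
   the y_j-axis, where z_j = x_j + i y_j. *)
Definition real_dir (k : 'I_n + 'I_n) : Cn :=
  match k with
  | inl j => delta_mx 0 j
  | inr j => 'i *: delta_mx 0 j
  end.

Definition real_slice phi (k : 'I_n + 'I_n) z (t : R) : C :=
  phi (z + t%:C *: real_dir k).

Definition real_derivable phi (k : 'I_n + 'I_n) z : Prop :=
  derivable (Re \o real_slice phi k z) 0 1 /\
  derivable (Im \o real_slice phi k z) 0 1.

Definition partial (k : 'I_n + 'I_n) phi z : C :=
  derive1 (Re \o real_slice phi k z) 0 +i*
  derive1 (Im \o real_slice phi k z) 0.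

Definition partials (s : seq ('I_n + 'I_n)) phi : Cn -> C :=
  foldr partial phi s.

Definition smooth phi : Prop :=
  forall s, continuous (partials s phi) /\
    forall k z, real_derivable (partials s phi) k z.

Definition dbar (j : 'I_n) phi z : C :=
  (partial (inl j) phi z + 'i * partial (inr j) phi z) / 2.

Definition tsupport phi : set Cn := closure [set z | phi z != 0].

(* The elements of D(Omega), each extended by 0 to all of C^n. *)
Definition test_function (Omega : set Cn) phi : Prop :=
  [/\ smooth phi, compact (tsupport phi) & tsupport phi `<=` Omega].

(* sup of |D^s phi| over iterated real partials of order at most N; it is
   finite when phi is a test function. *)
Definition CN_norm (N : nat) phi : R :=
  sup [set r | exists s z, (size s <= N)%N /\ r = Normc.normc (partials s phi z)].

(* Continuity on D(Omega) is stated as a seminorm estimate on each compact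
   K <= Omega. Only the values of T on test functions are meaningful. *)
Definition distribution (Omega : set Cn) (T : (Cn -> C) -> C) : Prop :=
  (forall (a : C) phi psi, test_function Omega phi -> test_function Omega psi ->
     T (fun z => a * phi z + psi z) = a * T phi + T psi) /\
  (forall K : set Cn, compact K -> K `<=` Omega ->
     exists (N : nat) (M : R), forall phi, test_function Omega phi ->
       tsupport phi `<=` K -> Normc.normc (T phi) <= M * CN_norm N phi).

Definition dbar_distribution (j : 'I_n) (T : (Cn -> C) -> C) : (Cn -> C) -> C :=
  fun phi => - T (dbar j phi).

Definition holomorphic_distribution (Omega : set Cn) (T : (Cn -> C) -> C) :
    Prop :=
  distribution Omega T /\
  forall j phi, test_function Omega phi -> dbar_distribution j T phi = 0.

End complex_space.

Section sigma_finite_product.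
Local Open Scope ereal_scope.
Context d1 d2 (X : measurableType d1) (Y : measurableType d2) (R : realType).
Variable mu : {sigma_finite_measure set X -> \bar R}.
Variable nu : {sigma_finite_measure set Y -> \bar R}.

(* The library registers product_measure1 as sigma-finite only for
   subprobabilities; this copy carries the general instance. *)
Definition sf_product : set (X * Y) -> \bar R := mu \x nu.

HB.instance Definition _ := Measure.on sf_product.

Let sf_product_sigma_finite : sigma_finite setT sf_product.
Proof.
have /sigma_finiteP[F [TF ndF Foo]] := sigma_finiteT mu.
have /sigma_finiteP[G [TG ndG Goo]] := sigma_finiteT nu.
exists (fun k => F k `*` G k).
  rewrite -setXTT TF TG predeqE => -[x y]; split.
    move=> [/= [k _ Fkx] [l _ Gly]]; exists (maxn k l) => //; split.
    - by move: x Fkx; exact/subsetPset/ndF/leq_maxl.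
    - by move: y Gly; exact/subsetPset/ndG/leq_maxr.
  by move=> [k _ []/= ? ?]; split; exists k.
move=> k; have [? ?] := Foo k; have [? ?] := Goo k.
split; first exact: measurableX.
by rewrite /sf_product product_measure1E// lte_mul_pinfty// ge0_fin_numE.
Qed.

HB.instance Definition _ := Measure_isSigmaFinite.Build _ _ _ sf_product
  sf_product_sigma_finite.

End sigma_finite_product.

Section cons_measure.
Local Open Scope ereal_scope.
Context d (X : measurableType d) (R : realType).
Variables (mu : {sigma_finite_measure set X -> \bar R}) (n : nat).
Variable nu : {sigma_finite_measure set (n.-tuple X) -> \bar R}.

Let cons_pair (x : X * n.-tuple X) : n.+1.-tuple X :=
  [the n.+1.-tuple X of x.1 :: x.2].

Definition cons_measure : set (n.+1.-tuple X) -> \bar R :=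
  pushforward (sf_product mu nu) cons_pair.

Let measurable_cons_pair : measurable_fun setT cons_pair.
Proof. exact: measurable_cons. Qed.

Let measurable_cons_preimage A : measurable A -> measurable (cons_pair @^-1` A).
Proof.
by move=> mA; rewrite -[X in measurable X]setTI; exact: measurable_cons_pair.
Qed.

Let cons_measure0 : cons_measure set0 = 0.
Proof. by rewrite /cons_measure /pushforward preimage_set0 measure0. Qed.

Let cons_measure_ge0 A : 0 <= cons_measure A.
Proof. by apply: integral_ge0 => x _; exact: measure_ge0. Qed.

Let cons_measure_sigma_additive : semi_sigma_additive cons_measure.
Proof.
move=> F mF tF mUF; rewrite /cons_measure /pushforward preimage_bigcup.
apply: measure_semi_sigma_additive.
- by move=> k; exact: measurable_cons_preimage.
- apply/trivIsetP => /= i j _ _ ij; rewrite -preimage_setI.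
  by move/trivIsetP : tF => /(_ _ _ _ _ ij) ->//; rewrite preimage_set0.
- by rewrite -preimage_bigcup; exact: measurable_cons_preimage.
Qed.

HB.instance Definition _ := isMeasure.Build _ _ _ cons_measure
  cons_measure0 cons_measure_ge0 cons_measure_sigma_additive.

Let cons_measure_sigma_finite : sigma_finite setT cons_measure.
Proof.
have [F FT Foo] := sigma_finiteT (sf_product mu nu).
pose uncons (t : n.+1.-tuple X) := (thead t, [tuple of behead t]).
have unconsK x : uncons (cons_pair x) = x.
  by case: x => x t; rewrite /uncons /cons_pair /=; congr pair; exact: val_inj.
exists (fun k => uncons @^-1` F k).
  by rewrite -preimage_bigcup -FT preimage_setT.
move=> k; have [mF Fk] := Foo k; split.
  have muncons : measurable_fun setT uncons.
    apply: measurable_fun_pair; last exact: measurable_behead.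
    exact: measurable_tnth.
  by rewrite -[X in measurable X]setTI; exact: muncons.
rewrite /cons_measure /pushforward.
rewrite (_ : _ @^-1` _ = F k)//.
by apply/seteqP; split => x /=; rewrite unconsK.
Qed.

HB.instance Definition _ := Measure_isSigmaFinite.Build _ _ _ cons_measure
  cons_measure_sigma_finite.

End cons_measure.

(* The n-fold product mu x ... x mu. *)
Fixpoint tuple_measure d (X : measurableType d) (R : realType)
    (mu : {sigma_finite_measure set X -> \bar R}) (n : nat) :
    {sigma_finite_measure set (n.-tuple X) -> \bar R} :=
  match n with
  | 0 => [the {sigma_finite_measure set _ -> \bar R} of dirac [tuple]]
  | n'.+1 => [the {sigma_finite_measure set _ -> \bar R} of
                cons_measure mu (@tuple_measure _ _ _ mu n')]
  end.

Section lebesgue.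
Context {R : realType} {n : nat}.
Local Notation C := R[i].
Local Notation Re := (@complex.Re R).
Local Notation Im := (@complex.Im R).
Local Notation Cn := 'rV[R[i]]_n.
Local Notation plane := (measurableTypeR R * measurableTypeR R)%type.

(* Lebesgue measure dV on C^n = R^{2n}, carried by the n-tuples of pairs
   (x_j, y_j). *)
Definition volume : {sigma_finite_measure set (n.-tuple plane) -> \bar R} :=
  tuple_measure (sf_product lebesgue_measure lebesgue_measure) n.

Definition vec_of_pairs (t : n.-tuple plane) : Cn :=
  \row_j ((tnth t j).1 +i* (tnth t j).2).

Definition volume_integral (D : set Cn) (g : Cn -> C) : C :=
  Rintegral volume (vec_of_pairs @^-1` D)
    (fun t => Re (g (vec_of_pairs t))) +i*
  Rintegral volume (vec_of_pairs @^-1` D)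
    (fun t => Im (g (vec_of_pairs t))).

Definition loc_integrable (Omega : set Cn) (f : Cn -> C) : Prop :=
  [/\ measurable_fun (vec_of_pairs @^-1` Omega)
        (fun t => Re (f (vec_of_pairs t))),
      measurable_fun (vec_of_pairs @^-1` Omega)
        (fun t => Im (f (vec_of_pairs t))) &
      forall K : set Cn, compact K -> K `<=` Omega ->
        (\int[volume]_(t in vec_of_pairs @^-1` K)
           (Normc.normc (f (vec_of_pairs t)))%:E < +oo)%E].

Definition generated_by (Omega : set Cn) (T : (Cn -> C) -> C) (f : Cn -> C) :
    Prop :=
  loc_integrable Omega f /\
  forall phi, test_function Omega phi ->
    T phi = volume_integral Omega (fun z => f z * phi z).

Definition monomial (alpha : {ffun 'I_n -> nat}) (w : Cn) : C :=
  \prod_(j < n) w 0 j ^+ alpha j.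

(* The power series is summed unconditionally, i.e. along the filter of finite
   sets of multi-indices. *)
Definition complex_analytic_on (Omega : set Cn) (f : Cn -> C) : Prop :=
  forall p, Omega p -> exists (U : set Cn) (c : {ffun 'I_n -> nat} -> C),
    [/\ nbhs p U, U `<=` Omega &
      forall z, U z ->
        summability.partial_sum (fun alpha => c alpha * monomial alpha (z - p))
          @ summability.totally --> f z].

End lebesgue.

(* Main.v *)
Require Import Defs.
From mathcomp Require Import all_boot all_order all_algebra.
From mathcomp Require Import finmap complex.
From mathcomp Require Import all_classical all_reals all_analysis.
From mathcomp Require Import ring lra.
From mathcomp.analysis.showcase Require summability.
Set Implicit Arguments.
Unset Strict Implicit.
Unset Printing Implicit Defensive.
Import Order.TTheory GRing.Theory Num.Theory.
Import numFieldNormedType.Exports.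
Local Open Scope classical_set_scope.
Local Open Scope ring_scope.

(** Write w = z - p and s_j = |w_j|^2. A functional T that vanishes on the image of every dbar_j is
  determined near p by its values on smeared Cauchy kernels E_alpha, the products over j of D(s_j) /
  w_j^(alpha_j), where D is a bump in s_j that lives on an annulus around p_j.

  The reason is a reduction modulo the image of dbar. A monomial cut off near p is the product over
  j of w_j^a conj(w_j)^b X0(s_j), and in each variable such a factor is a constant times a kernel D
  / w_j^k plus the dbar derivative of an explicit function of compact support (power_factor_reduce);
  the constant is the one moment that obstructs solving the dbar equation with compact support. The
  reduction applies to T and also to integration against w^beta, since w^beta is holomorphic and
  integrals of derivatives vanish. Moreover the pairing of w^beta with E_alpha is 0 for beta <>
  alpha and a positive mass for beta = alpha (monomial_pairing_normal). With c_alpha = T(E_alpha) /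
  mass, it follows that T and integration against a partial sum of the series of the c_alpha w^alpha
  agree on any given cut off monomial in w and conj(w) as soon as the partial sum is long enough
  (mixed_monomial_partial_series).

  The series converges because E_alpha is a product of powers W_j^(alpha_j) and fixed functions,
  with |W_j| < 1 / (2 r). A C^N norm weighted so as to be submultiplicative and close to the sup
  norm gives |c_alpha| <= B (2 r)^(-|alpha|) from the continuity of T (normal_product_bound). On
  |w_j| <= r the terms are thus at most B 2^(-|alpha|), the sum g is continuous, and T is
  integration against g on all polynomials times the cutoff. Polynomials are dense in the C^N norm
  (smooth_poly_approx, by Bernstein approximation of the highest derivative and repeated
  integration), so T is integration against g on test functions supported near p
  (local_representation).

  A continuous function is determined by its integrals against bumps (continuous_eq0), so the local
  sums agree on overlaps and define one continuous function f. A test function is cut by bumps into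
  finitely many pieces, each of which is supported where T is known (represents_of_local). *)

(** * Smooth functions of one real variable *)

Section smooth1.
Context {R : realType}.
Implicit Types (f g h : R -> R).

(** A Variant keeps unification from unfolding smoothness. *)
Variant smooth1 h : Prop := Smooth1 of forall n x, derivable (derive1n n h) x 1.

Lemma is_derive_derive1 h (x d : R) : is_derive x 1 h d -> derive1 h x = d.
Proof. by move=> H; rewrite derive1E derive_val. Qed.

Lemma is_derive1_continuous h (x d : R) :
  is_derive x (1 : R) h d -> {for x, continuous h}.
Proof.
by move=> H; apply: differentiable_continuous; apply/derivable1_diffP; case: H.
Qed.

(** The closure of F under derivation replaces an induction on the order of derivation through the
  product and chain rules. *)
Lemma smooth1_class (F : set (R -> R)) :
  (forall f, F f -> exists2 g, F g & forall x : R, is_derive x 1 f (g x)) ->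
  forall f, F f -> smooth1 f.
Proof.
move=> HF f Ff; split=> n.
suff: F (derive1n n f) by move=> /HF[g _ Hg] x; case: (Hg x).
elim: n => [//|n /HF[g Fg Hg]].
rewrite derive1nS; suff -> : derive1 (derive1n n f) = g by [].
by apply/funext => x; exact: is_derive_derive1.
Qed.

Lemma smooth1_is_derive h (x : R) : smooth1 h -> is_derive x 1 h (derive1 h x).
Proof. by move=> [/(_ 0 x)]; rewrite derive1E => /derivableP. Qed.

Lemma smooth1_derive1 h : smooth1 h -> smooth1 (derive1 h).
Proof. by move=> [H]; split=> n x; rewrite -derive1Sn; exact: H. Qed.

Lemma smooth1_continuous h : smooth1 h -> continuous h.
Proof. by move=> H x; exact: is_derive1_continuous (smooth1_is_derive x H). Qed.

(** A class to which the criterion above applies: the derivative of each expression is an expression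
  again. *)
Inductive smooth1_alg : (R -> R) -> Prop :=
| s1a_smooth h of smooth1 h : smooth1_alg h
| s1a_cst c : smooth1_alg (fun=> c)
| s1a_id : smooth1_alg id
| s1a_add f g of smooth1_alg f & smooth1_alg g : smooth1_alg (fun x => f x + g x)
| s1a_mul f g of smooth1_alg f & smooth1_alg g : smooth1_alg (fun x => f x * g x)
| s1a_comp f g of smooth1 f & smooth1_alg g : smooth1_alg (fun x => f (g x)).

Lemma smooth1_algP f : smooth1_alg f -> smooth1 f.
Proof.
apply: smooth1_class => {}f; elim=> {f}.
- move=> h sh; exists (derive1 h) => [|x]; last exact: smooth1_is_derive.
  exact/s1a_smooth/smooth1_derive1.
- move=> c; exists (fun=> 0) => [|x]; first exact: s1a_cst.
  exact: is_derive_cst.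
- exists (fun=> 1) => [|x]; first exact: s1a_cst.
  exact: is_derive_id.
- move=> f g Ff [f' Ff' Hf] Fg [g' Fg' Hg].
  exists (fun x => f' x + g' x) => [|x]; first exact: s1a_add.
  exact: is_deriveD.
- move=> f g Ff [f' Ff' Hf] Fg [g' Fg' Hg].
  exists (fun x => f x * g' x + g x * f' x) => [|x].
    by apply: s1a_add; apply: s1a_mul.
  exact: is_deriveM.
- move=> f g sf Fg [g' Fg' Hg].
  exists (fun x => derive1 f (g x) * g' x) => [|x].
    apply: s1a_mul => //; apply: s1a_comp => //; exact: smooth1_derive1.
  apply: is_derive1_comp; exact: smooth1_is_derive.
Qed.

Lemma smooth1_cst c : smooth1 (fun=> c).
Proof. exact/smooth1_algP/s1a_cst. Qed.

Lemma smooth1_id : smooth1 id.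
Proof. exact/smooth1_algP/s1a_id. Qed.

Lemma smooth1D f g : smooth1 f -> smooth1 g -> smooth1 (fun x => f x + g x).
Proof. by move=> sf sg; apply: smooth1_algP; apply: s1a_add; apply: s1a_smooth. Qed.

Lemma smooth1M f g : smooth1 f -> smooth1 g -> smooth1 (fun x => f x * g x).
Proof. by move=> sf sg; apply: smooth1_algP; apply: s1a_mul; apply: s1a_smooth. Qed.

Lemma smooth1_comp f g : smooth1 f -> smooth1 g -> smooth1 (fun x => f (g x)).
Proof. by move=> sf sg; apply: smooth1_algP; apply: s1a_comp => //; apply: s1a_smooth. Qed.

Lemma smooth1X f m : smooth1 f -> smooth1 (fun x => f x ^+ m).
Proof.
move=> sf; elim: m => [|m IH]; first exact: smooth1_cst.
rewrite (_ : (fun _ => _) = fun x => f x * f x ^+ m); first exact: smooth1M.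
by apply/funext => x; rewrite exprS.
Qed.

Lemma near_is_derive f g (x d : R) : (\near x, f x = g x) ->
  is_derive x 1 g d -> is_derive x 1 f d.
Proof.
move=> fg [gd <-].
have gf : \near x, g x = f x by apply: filterS fg => y ->.
by split; [exact: (near_eq_derivable gf)|exact: near_eq_derive].
Qed.

End smooth1.

(** * The functions p(1/x) exp(-1/x) *)

Section bump.
Context {R : realType}.
Implicit Types (f g h : R -> R).

Lemma poly_le_expR (p : {poly R}) (a : R) : 0 < a ->
  exists C : R, forall y : R, 0 <= y -> `|p.[y]| <= C * expR (a * y).
Proof.
elim/poly_ind: p a => [|p c IH] a a0.
  by exists 0 => y _; rewrite horner0 normr0 mul0r.
have [C HC] := IH (a / 2) ltac:(by rewrite divr_gt0).
exists (C * (2 / a) + `|c|) => y y0.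
rewrite hornerMXaddC (le_trans (ler_normD _ _))// mulrDl lerD//; last first.
  by rewrite ler_peMr// -[X in X <= _]expR0 ler_expR mulr_ge0// ltW.
rewrite normrM (ger0_norm y0).
have -> : a * y = a / 2 * y + a / 2 * y by field.
rewrite expRD; set E := expR _.
have -> : C * (2 / a) * (E * E) = (C * E) * ((2 / a) * E) by ring.
apply: ler_pM => //; first exact: HC.
have := expR_ge1Dx (a / 2 * y); rewrite -/E => H.
rewrite -ler_pdivrMl ?divr_gt0// invf_div; lra.
Qed.

(** Polynomials p in 1/x are carried along because the derivative of exp(-1/x) is exp(-1/x)/x^2. *)
Definition expinv (p : {poly R}) (x : R) : R :=
  if 0 < x then p.[x^-1] * expR (- x^-1) else 0.

(** The quadratic bound makes the difference quotients at 0 tend to 0. *)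
Lemma expinv_bound p : exists C : R, forall x, `|expinv p x| <= C * x ^+ 2.
Proof.
have [C HC] := @poly_le_expR (p * 'X^2) 1 ltr01.
exists C => x; rewrite /expinv; case: ltP => x0; last first.
  have := HC 0 (lexx _); rewrite mulr0 expR0 mulr1 => C0.
  by rewrite normr0 mulr_ge0 ?sqr_ge0// (le_trans _ C0).
have x1 : 0 < x^-1 by rewrite invr_gt0.
have := HC _ (ltW x1); rewrite mul1r hornerM hornerXn normrM.
rewrite (ger0_norm (sqr_ge0 x^-1)) exprVn ler_pdivrMr ?exprn_gt0// => H.
by rewrite normrM (ger0_norm (expR_ge0 _)) expRN ler_pdivrMr ?expR_gt0// mulrAC.
Qed.

Lemma is_derive_expinv p (x : R) :
  is_derive x 1 (expinv p) (expinv ('X^2 * (p - p^`())) x).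
Proof.
have [x0|x0|<-] := ltgtP 0 x.
- apply: (near_is_derive (g := fun y => p.[y^-1] * expR (- y^-1))).
    near=> y; rewrite /expinv ifT//.
    by near: y; exact: lt_nbhsr.
  rewrite /expinv x0.
  have xn0 : x != 0 by rewrite gt_eqF.
  have Hv := @is_deriveV R id x 1 1 xn0 (is_derive_id _ _).
  have Hp : is_derive (x : R) 1 (horner p \o (fun y => y^-1)) (p^`().[x^-1] * (- x ^- 2 *: 1)).
    by apply: is_derive1_comp.
  have He : is_derive (x : R) 1 (expR \o (fun y => - y^-1)) (expR (- x^-1) * (- (- x ^- 2 *: 1))).
    by apply: is_derive1_comp; apply: is_deriveN.
  have H := is_deriveM Hp He.
  apply: (is_derive_eq H).
  rewrite /= !hornerE /GRing.scale /=; field; exact: xn0.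
- apply: (near_is_derive (g := fun=> 0)).
    near=> y; rewrite /expinv ifF//; apply/negbTE; rewrite -leNgt ltW//.
    by near: y; exact: lt_nbhsl.
  rewrite /expinv ifF; first exact: is_derive_cst.
  by apply/negbTE; rewrite -leNgt ltW.
- rewrite {2}/expinv ltxx.
  have [C HC] := expinv_bound p.
  suff H : h^-1 *: ((expinv p \o shift 0) (h *: 1) - expinv p 0) @[h --> 0^'] --> (0 : R).
    by split; [apply/cvg_ex; exists 0|exact/cvg_lim].
  apply/cvgrPdist_le => e e0.
  near=> h; rewrite sub0r normrN /= addr0 {2}/expinv ltxx subr0.
  rewrite /GRing.scale /= mulr1 normrM normfV.
  have h0 : 0 < `|h| by rewrite normr_gt0; near: h; exact: nbhs_dnbhs_neq.
  rewrite ler_pdivrMl// (le_trans (HC h))//.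
  rewrite -real_normK ?num_real// expr2 mulrA mulrC ler_wpM2l//.
  have : `|h| <= e / (`|C| + 1).
    rewrite -[h]subr0 distrC; near: h; apply: cvgr_dist_le; first exact: nbhs_dnbhs.
    by rewrite divr_gt0// ltr_wpDl.
  rewrite ler_pdivlMr ?ltr_wpDl// => H; apply: le_trans H.
  by rewrite mulrC ler_wpM2l// (le_trans (ler_norm C))// lerDl.
Unshelve. all: by end_near. Qed.

Lemma smooth1_expinv p : smooth1 (expinv p).
Proof.
apply: (@smooth1_class _ [set expinv q | q in setT]); last by exists p.
move=> _ [q _ <-]; exists (expinv ('X^2 * (q - q^`()))) => [|x].
  by exists ('X^2 * (q - q^`())).
exact: is_derive_expinv.
Qed.

End bump.

(** * Antiderivatives and cutoffs *)

Section antiderivative.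
Context {R : realType}.
Implicit Types (f g h : R -> R).

Lemma zero_derivative_cst_itv f (a b : R) : a <= b ->
  (forall x : R, exists d, is_derive x 1 f d) ->
  (forall x : R, a < x -> x < b -> is_derive x 1 f (0 : R)) -> f a = f b.
Proof.
move=> ab H H0; rewrite -[LHS]addr0; have [->|/negbTE anb] := eqVneq a b; first by rewrite addr0.
have altb : a < b by rewrite lt_neqAle anb.
have [||c _] := @MVT R f (fun=> 0) a b altb.
- by move=> x; rewrite in_itv /= => /andP[ax xb]; exact: H0.
- by apply: continuous_subspaceT => x; have [d] := H x; exact: is_derive1_continuous.
by rewrite mul0r addr0 => /eqP; rewrite subr_eq0 => /eqP ->.
Qed.

(** As g vanishes left of c, the integral from c - 1 is an antiderivative on the whole line. *)
Lemma antiderivative_left g (c : R) : continuous g -> (forall x, x <= c -> g x = 0) ->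
  exists G : R -> R, (forall x : R, is_derive x 1 G (g x)) /\ (forall x, x <= c -> G x = 0).
Proof.
move=> cg g0.
pose G x := (\int[lebesgue_measure]_(t in [set` Interval (BLeft (c - 1)) (BRight x)]) g t)%R.
have G0 x : x <= c -> G x = 0.
  move=> xc; rewrite /G (@eq_Rintegral _ _ _ _ _ (fun=> 0)); first by rewrite Rintegral_cst//= mul0r.
  by move=> y; rewrite inE /= in_itv /= => /andP[_ yx]; rewrite g0// (le_trans yx).
exists G; split => // x.
have [xc|xc] := ltP x c.
  apply: (near_is_derive (g := fun=> 0)).
    near=> y; apply: G0; apply: ltW; near: y; exact: lt_nbhsl.
  by rewrite g0 ?ltW//; exact: is_derive_cst.
have cx : c - 1 < x by rewrite (lt_le_trans _ xc)// gtrBl.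
have [dG <-] : derivable G x 1 /\ derive1 G x = g x.
  apply: (@continuous_FTC1 R g (BLeft (c - 1)) x (x + 1)).
  - by rewrite ltrDl.
  - apply: continuous_compact_integrable; first exact: segment_compact.
    exact: continuous_subspaceT.
  - by rewrite lte_fin.
  - exact: cg.
split; [exact: dG|exact: (esym (derive1E G x))].
Unshelve. all: by end_near. Qed.

Lemma antiderivative_right g (c : R) : continuous g -> (forall x, c <= x -> g x = 0) ->
  exists G : R -> R, (forall x : R, is_derive x 1 G (g x)) /\ (forall x, c <= x -> G x = 0).
Proof.
move=> cg g0.
have [||G [dG G0]] := @antiderivative_left (g \o -%R) (- c).
- by move=> x; apply: continuous_comp; [exact: opp_continuous|exact: cg].
- by move=> x xc; rewrite /= g0// lerNr.
exists (fun x => - G (- x)); split => x; last first.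
  by move=> cx; rewrite G0 ?oppr0// lerN2.
have H := @is_derive1_comp R G -%R x _ _ (dG (- x)) (is_deriveN (is_derive_id x 1)).
apply: (is_derive_eq (is_deriveN H)); rewrite /= opprK; ring.
Qed.

Lemma smooth1_antiderivative g G : smooth1 g ->
  (forall x : R, is_derive x 1 G (g x)) -> smooth1 G.
Proof.
move=> sg dG; apply: (@smooth1_class _ [set f | f = G \/ smooth1 f]); last by left.
move=> f [->|sf]; first by exists g => //; right.
exists (derive1 f) => [|x]; first by right; exact: smooth1_derive1.
exact: smooth1_is_derive.
Qed.

(** Away from 0 the quotient rule applies, and near 0 the quotient is 0. *)
Lemma smooth1_divX g (c : R) m : 0 < c -> smooth1 g -> (forall x, x <= c -> g x = 0) ->
  smooth1 (fun x => g x / x ^+ m).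
Proof.
move=> c0 sg g0.
pose F := [set f | exists (k : nat) (h : R -> R), [/\ smooth1 h, (forall x, x < c -> h x = 0) &
  f = fun x => h x / x ^+ k]].
apply: (@smooth1_class _ F); last by exists m, g; split => // x /ltW/g0.
move=> _ [k [h [sh h0 ->]]].
have h'0 x : x < c -> derive1 h x = 0.
  move=> xc; apply: is_derive_derive1; apply: (near_is_derive (g := fun=> 0)).
  near=> y; apply: h0; near: y; exact: lt_nbhsl.
exists (fun x => (derive1 h x * x - k%:R * h x) / x ^+ k.+1).
  exists k.+1, (fun x => derive1 h x * x + (- k%:R) * h x); split.
  - apply: smooth1D; apply: smooth1M => //; [exact: smooth1_derive1|exact: smooth1_id|exact: smooth1_cst].
  - by move=> x xc; rewrite h0// h'0// mul0r mulr0 addr0.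
  - by apply/funext => x; rewrite mulNr.
move=> x; have [xc|cx] := ltP x c.
  rewrite h0// h'0// !mul0r mulr0 subr0 mul0r.
  apply: (near_is_derive (g := fun=> 0)).
  near=> y; rewrite h0 ?mul0r//; near: y; exact: lt_nbhsl.
have xn0 : x != 0 by rewrite gt_eqF// (lt_le_trans c0).
have xkn0 : x ^+ k != 0 by rewrite expf_neq0.
have dX : is_derive x 1 (fun y : R => y ^+ k) (k%:R * x ^+ k.-1).
  have := is_deriveX k (is_derive_id x (1 : R)) => H.
  rewrite (_ : (fun y => _) = id ^+ k); last by apply/funext => y; rewrite fctE.
  by apply: (is_derive_eq H); rewrite /GRing.scale /= mulr1.
have dV := @is_deriveV R _ x _ _ xkn0 dX.
have := is_deriveM (smooth1_is_derive x sh) dV => H.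
apply: (is_derive_eq H); rewrite /GRing.scale /=.
case: k xkn0 {dX dV H} => [|k] xkn0.
  by rewrite expr0 expr1 expr1n invr1 !mul0r subr0 mulr0 mulr0 add0r mul1r mulfK.
rewrite /= !exprS; field; rewrite expf_neq0//.
Unshelve. all: by end_near. Qed.

(** The antiderivative of the bump exp(-1/(x-1)) exp(-1/(2-x)), normalized by its total mass. *)
Lemma exists_cutoff : exists st d : R -> R,
  [/\ [/\ smooth1 st, (forall x, x <= 1 -> st x = 1), (forall x, 2 <= x -> st x = 0) &
          (forall x, 0 <= st x <= 1)],
      smooth1 d, (forall x : R, is_derive x 1 st (- d x)) &
      [/\ (forall x, 0 <= d x), (forall x, x <= 1 -> d x = 0), (forall x, 2 <= x -> d x = 0) &
          (forall x, 1 < x -> x < 2 -> 0 < d x)]].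
Proof.
pose e := @expinv R 1.
have se : smooth1 e := smooth1_expinv 1.
have e0 x : x <= 0 -> e x = 0 by rewrite /e /expinv leNgt => /negbTE ->.
have epos x : 0 < x -> 0 < e x.
  by move=> x0; rewrite /e /expinv x0 hornerC mul1r expR_gt0.
have ege0 x : 0 <= e x by case: (leP x 0) => [/e0->//|/epos/ltW].
pose b x := e (x - 1) * e (2 - x).
have sb : smooth1 b.
  apply: smooth1M; apply: smooth1_comp => //.
    by apply: smooth1D; [exact: smooth1_id|exact: smooth1_cst].
  rewrite (_ : (fun x => _) = fun x => 2 + (-1) * x); last by apply/funext => x; ring.
  apply: smooth1D; [exact: smooth1_cst|]. 
  by apply: smooth1M; [exact: smooth1_cst|exact: smooth1_id].
have b1 x : x <= 1 -> b x = 0 by move=> x1; rewrite /b e0 ?mul0r// subr_le0.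
have b2 x : 2 <= x -> b x = 0 by move=> x1; rewrite /b [e (2 - x)]e0 ?mulr0// subr_le0.
have [B [dB B1]] := antiderivative_left (smooth1_continuous sb) b1.
have sB : smooth1 B := smooth1_antiderivative sb dB.
have B2 : 0 < B 2.
  have [||c] := @MVT R B b 1 2 _ (fun x _ => dB x); first by rewrite ltr1n.
    by apply: continuous_subspaceT => x; exact: is_derive1_continuous (dB x).
  rewrite in_itv /= => /andP[c1 c2]; rewrite (B1 1)// subr0 => ->.
  by rewrite mulr_gt0 ?subr_gt0 ?ltr1n// /b mulr_gt0// epos// subr_gt0.
have BE x : 2 <= x -> B x = B 2.
  move=> x2; apply/esym/zero_derivative_cst_itv => // [y|y y2 _]; first by exists (b y).
  by rewrite -(b2 y (ltW y2)).
pose st x := 1 + (- (B 2)^-1) * B x; pose d x := (B 2)^-1 * b x.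
have sst : smooth1 st.
  by apply: smooth1D; [exact: smooth1_cst|apply: smooth1M => //; exact: smooth1_cst].
have dst (x : R) : is_derive x 1 st (- d x).
  have H := is_deriveD (is_derive_cst (1 : R) x 1) (is_deriveM (is_derive_cst (- (B 2)^-1) x 1) (dB x)).
  by apply: (is_derive_eq H); rewrite /GRing.scale /= mulr0 addr0 add0r mulNr.
have st1 x : x <= 1 -> st x = 1 by move=> x1; rewrite /st (B1 x)// mulr0 addr0.
have st2 x : 2 <= x -> st x = 0.
  by move=> x2; rewrite /st (BE x)// mulNr mulVf ?subrr// gt_eqF.
have d0 x : 0 <= d x by rewrite /d mulr_ge0 ?invr_ge0 ?(ltW B2)// /b mulr_ge0.
exists st, d; split => //; [split => // x| |split => //].
- have cst (u v : R) : {within `[u, v], continuous st}.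
    by apply: continuous_subspaceT => y; exact: smooth1_continuous.
  have [x1|x1] := leP x 1; first by rewrite st1// ler01 lexx.
  have [x2|x2] := leP 2 x; first by rewrite st2// lexx ler01.
  have [u _ E1] := @MVT R st _ 1 x x1 (fun y _ => dst y) (cst 1 x).
  have [v _ E2] := @MVT R st _ x 2 x2 (fun y _ => dst y) (cst x 2).
  rewrite (st1 1)// in E1; rewrite (st2 2)// in E2.
  have H1 : 0 <= d u * (x - 1) by rewrite mulr_ge0// subr_ge0 ltW.
  have H2 : 0 <= d v * (2 - x) by rewrite mulr_ge0// subr_ge0 ltW.
  by apply/andP; split; lra.
- by apply: smooth1M => //; exact: smooth1_cst.
- by move=> x x1; rewrite /d b1// mulr0.
- by move=> x x2; rewrite /d b2// mulr0.
- by move=> x x1 x2; rewrite /d mulr_gt0 ?invr_gt0// /b mulr_gt0// epos// subr_gt0.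
Qed.

End antiderivative.

(** * Real coordinates and boxes in complex space *)

Section coordinates.
Context {R : realType} {n : nat}.
Local Notation C := R[i].
Local Notation Cn := 'rV[R[i]]_n.
Local Notation dir := ('I_n + 'I_n)%type.
Implicit Types (z p : Cn) (k l : dir) (t : R).

Definition xcoord k z : R :=
  match k with inl j => complex.Re (z 0 j) | inr j => complex.Im (z 0 j) end.

Definition step k t z : Cn := z + t%:C%C *: real_dir k.

Lemma xcoord_step k l z t : xcoord l (step k t z) = xcoord l z + (k == l)%:R * t.
Proof.
have E i m : (i == m :> 'I_n) = (m == i) by rewrite eq_sym.
have inlE i m : (inl i == inl m :> dir) = (m == i) by rewrite eq_sym.
have inrE i m : (inr i == inr m :> dir) = (m == i) by rewrite eq_sym.
case: k l => [j|j] [l|l]; rewrite /step /= !mxE ?eqxx ?inlE ?inrE /=; case: (z 0 l) => a b; case: (l == j) => /=; try ring.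
Qed.

Lemma xcoord_inj z z' : (forall k, xcoord k z = xcoord k z') -> z = z'.
Proof.
move=> H; apply/rowP => j; have := (H (inl j), H (inr j)); rewrite /=.
by case: (z 0 j) (z' 0 j) => [a b] [c d] /= [-> ->].
Qed.

Lemma step0 k z : step k 0 z = z.
Proof. by apply: xcoord_inj => l; rewrite xcoord_step mulr0 addr0. Qed.

Lemma stepD k s t z : step k s (step k t z) = step k (t + s) z.
Proof. by apply: xcoord_inj => l; rewrite [LHS]xcoord_step [X in X + _]xcoord_step [RHS]xcoord_step mulrDr addrA. Qed.

Lemma stepC k l s t z : step k s (step l t z) = step l t (step k s z).
Proof. by apply: xcoord_inj => m; rewrite [LHS]xcoord_step [X in X + _]xcoord_step [RHS]xcoord_step [X in _ = X + _]xcoord_step addrAC. Qed.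

Lemma normc_ge_abs (x : C) :
  `|complex.Re x| <= Normc.normc x /\ `|complex.Im x| <= Normc.normc x.
Proof.
case: x => a b /=; rewrite -!sqrtr_sqr !ler_sqrt ?addr_ge0 ?sqr_ge0//.
by rewrite lerDl lerDr !sqr_ge0.
Qed.

Lemma normc_le_abs (x : C) : Normc.normc x <= `|complex.Re x| + `|complex.Im x|.
Proof.
case: x => a b /=; rewrite -[leRHS]ger0_norm ?addr_ge0// -sqrtr_sqr ler_sqrt ?sqr_ge0//.
rewrite -(real_normK (num_real a)) -(real_normK (num_real b)).
have := mulr_ge0 (normr_ge0 a) (normr_ge0 b); lra.
Qed.

Lemma normrC (x : C) : `|x| = (Normc.normc x)%:C%C.
Proof. by []. Qed.

Lemma nbhs_complexP (x : C) (A : set C) : nbhs x A <->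
  exists2 e : R, 0 < e & forall y, `|complex.Re y - complex.Re x| < e ->
    `|complex.Im y - complex.Im x| < e -> A y.
Proof.
split.
  move=> /nbhs_ballP[e /= e0 eA].
  have [er er0] : exists2 er : R, 0 < er & e = er%:C%C.
    by move: e0; rewrite ltcE /= => /andP[/eqP ei er]; exists (complex.Re e) => //; case: e ei {eA er} => a b /= ->.
  move=> eE; exists (er / 2); first by rewrite divr_gt0.
  move=> y y1 y2; apply: eA; rewrite eE -ball_normE /= normrC ltcR.
  apply: le_lt_trans (normc_le_abs _) _; rewrite [ltRHS]splitr ltrD//.
    by case: x y {y2} y1 => [a b] [c d] /=; rewrite distrC.
  by case: x y {y1} y2 => [a b] [c d] /=; rewrite distrC.
move=> [e e0 eA]; apply/nbhs_ballP; exists e%:C%C; first by rewrite /= ltcR.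
move=> y; rewrite -ball_normE /= normrC ltcR => H; have [H1 H2] := normc_ge_abs (x - y).
apply: eA; apply: le_lt_trans H; rewrite distrC.
  by apply: le_trans H1; case: x y {H2} => [a b] [c d].
by apply: le_trans H2; case: x y {H1} => [a b] [c d].
Qed.

Lemma nbhs_xcoordP p (A : set Cn) : nbhs p A <->
  exists2 e : R, 0 < e & forall z, (forall k, `|xcoord k z - xcoord k p| < e) -> A z.
Proof.
split.
  move=> [P HP PA].
  have /choice[e He] : forall j, exists e : R, 0 < e /\ forall y, `|complex.Re y - complex.Re (p 0 j)| < e ->
    `|complex.Im y - complex.Im (p 0 j)| < e -> P 0 j y.
    by move=> j; have /nbhs_complexP[e e0 eP] := HP 0 j; exists e.
  exists (\big[Num.min/1]_j e j); first by apply/bigmin_gtP; split => // j _; have [] := He j.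
  move=> z Hz; apply: PA => i j; rewrite ord1; have [e0] := He j; apply.
    by apply: lt_le_trans (Hz (inl j)) _; exact: bigmin_le.
  by apply: lt_le_trans (Hz (inr j)) _; exact: bigmin_le.
move=> [e e0 eA].
exists (fun i j => [set y : C | `|complex.Re y - complex.Re (p i j)| < e /\
    `|complex.Im y - complex.Im (p i j)| < e]).
  by move=> i j; apply/nbhs_complexP; exists e.
by move=> z Hz; apply: eA => -[j|j] /=; have [] := Hz 0 j.
Qed.

#[export] Instance nbhs_Cn_filter p : ProperFilter (nbhs p).
Proof. exact: (@nbhs_pfilter (matrix_matrix__canonical__topology_structure_Topological 1 n R[i]) p). Qed.

Lemma xcoord_continuous k : continuous (xcoord k).
Proof.
move=> z.
apply/cvgrPdist_lt => e e0; apply/nbhs_xcoordP; exists e => // y Hy.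
by rewrite /= distrC.
Qed.

Lemma continuous_step k z : continuous (fun t : R => step k t z).
Proof.
move=> t A /nbhs_xcoordP[e e0 eA].
have H : \forall s \near t, `|t - s| < e by exact: nbhsx_ballx.
apply: filterS H => s Hs; apply: eA => l; rewrite !xcoord_step.
rewrite opprD addrACA subrr add0r -mulrBr normrM distrC.
by apply: le_lt_trans Hs; case: eqP => _ /=; rewrite ?normr1 ?mul1r// normr0 mul0r.
Qed.

Lemma complex_continuousP (T : topologicalType) (f : T -> C) (x : T) :
  {for x, continuous f} <->
  {for x, continuous (fun y => complex.Re (f y))} /\ {for x, continuous (fun y => complex.Im (f y))}.
Proof.
split.
  move=> cf; split; apply/cvgrPdist_lt => e e0.
    apply: (cf [set y | `|complex.Re (f x) - complex.Re y| < e]).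
    by apply/nbhs_complexP; exists e => // y; rewrite /= distrC.
  apply: (cf [set y | `|complex.Im (f x) - complex.Im y| < e]).
  by apply/nbhs_complexP; exists e => // y _; rewrite /= distrC.
move=> [/cvgrPdist_lt cR /cvgrPdist_lt cI] A /nbhs_complexP[e e0 eA].
have FF : Filter (nbhs x) := nbhs_filter x.
have H : \forall y \near x, A (f y).
  by near=> y; apply: eA; rewrite distrC; near: y; [exact: cR|exact: cI].
exact: H.
Unshelve. all: by end_near. Qed.

Definition cbox p (a : R) : set Cn := [set z | forall k, `|xcoord k z - xcoord k p| <= a].

Lemma cbox_le p (a b : R) : a <= b -> cbox p a `<=` cbox p b.
Proof. by move=> ab z Hz k; exact: le_trans (Hz k) ab. Qed.

Lemma compact_cbox p a : compact (cbox p a).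
Proof.
pose f (q : R * R) : C := (q.1 +i* q.2)%C.
have cf : continuous f.
  by move=> q; apply/complex_continuousP; split; [exact: cvg_fst|exact: cvg_snd].
pose B j := f @` (`[complex.Re (p 0 j) - a, complex.Re (p 0 j) + a]%classic `*`
  `[complex.Im (p 0 j) - a, complex.Im (p 0 j) + a]%classic).
have cB j : compact (B j).
  apply: continuous_compact; first by apply: continuous_subspaceT; exact: cf.
  by apply: compact_setX; exact: segment_compact.
have := rV_compact cB; congr compact.
apply/seteqP; split => z /= Hz.
  by move=> [j|j] /=; have [[u v] [/= Hu Hv] <-] := Hz j; move: Hu Hv; rewrite !in_itv /= !ler_distl.
move=> j; exists (complex.Re (z 0 j), complex.Im (z 0 j)); last by case: (z 0 j).
by split; rewrite /= in_itv /= -ler_distl; [exact: (Hz (inl j))|exact: (Hz (inr j))].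
Qed.

Lemma compact_subset_cbox (K : set Cn) p : compact K -> exists2 a, 0 < a & K `<=` cbox p a.
Proof.
move=> cK.
have H k : exists a, forall z, K z -> `|xcoord k z - xcoord k p| <= a.
  have [->|/set0P K0] := eqVneq K set0; first by exists 0.
  have [|c Kc Hc] := @compact_EVT_max _ R (fun z => `|xcoord k z - xcoord k p|) K K0 cK.
    apply: continuous_subspaceT => z; apply: cvg_norm; apply: cvgB; last exact: cvg_cst.
    exact: xcoord_continuous.
  by exists `|xcoord k c - xcoord k p| => z Kz; apply: Hc; rewrite inE.
have {H} /choice[a Ha] := H.
exists (\big[Num.max/1]_k a k); first by apply: lt_le_trans (bigmax_ge_id _ _ _ _).
by move=> z Kz k; apply: le_trans (Ha k z Kz) _; exact: le_bigmax.
Qed.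

Lemma closed_cbox p a : closed (cbox p a).
Proof.
have -> : cbox p a = \bigcap_k (xcoord k @^-1` [set x | `|x - xcoord k p| <= a]).
  by apply/seteqP; split => z Hz k; [move=> _|]; exact: Hz.
apply: closed_bigI => k _; apply: preimage_closed; first by move=> z _; exact: xcoord_continuous.
apply: (@closed_comp _ _ (fun x : R => `|x - xcoord k p|) [set x | x <= a]); last exact: closed_le.
by move=> x _; apply: cvg_norm; apply: cvgB; [exact: cvg_id|exact: cvg_cst].
Qed.

End coordinates.

(** * Smooth functions of several real variables *)

Section real_smooth.
Context {R : realType} {n : nat}.
Local Notation Cn := 'rV[R[i]]_n.
Local Notation dir := ('I_n + 'I_n)%type.
Implicit Types (f g : Cn -> R) (z p : Cn) (k l : dir) (t : R) (s : seq dir).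

Definition is_partial k f z (d : R) := is_derive (0 : R) (1 : R) (fun t => f (step k t z)) d.

Definition rpartial k f z : R := derive1 (fun t => f (step k t z)) 0.

Definition rpartials s f : Cn -> R := foldr rpartial f s.

Variant rsmooth f : Prop := RSmooth of
  forall s, continuous (rpartials s f) /\
    forall k z, derivable (fun t => rpartials s f (step k t z)) (0 : R) 1.

Lemma is_partial_rpartial k f z d : is_partial k f z d -> rpartial k f z = d.
Proof. exact: is_derive_derive1. Qed.

(** As in one variable, closure under the partial derivatives suffices. *)
Lemma rsmooth_class (F : set (Cn -> R)) :
  (forall f, F f -> continuous f /\ forall k, exists2 g, F g & forall z, is_partial k f z (g z)) ->
  forall f, F f -> rsmooth f.
Proof.
move=> HF f Ff; split=> s.
suff /HF[cs Hs] : F (rpartials s f).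
  by split => // k z; have [g _ /(_ z)[]] := Hs k.
elim: s => [//|k s /HF[_ /(_ k)[g Fg Hg]]] /=.
by suff -> : rpartial k (rpartials s f) = g by []; apply/funext => z; exact: is_partial_rpartial.
Qed.

Lemma rsmooth_continuous f : rsmooth f -> continuous f.
Proof. by move=> [/(_ [::])[]]. Qed.

Lemma rsmooth_is_partial f k z : rsmooth f -> is_partial k f z (rpartial k f z).
Proof. by move=> [/(_ [::])[_ /(_ k z)]] /= df; rewrite /rpartial derive1E; exact: derivableP. Qed.

Lemma rpartials_cons k s f : rpartials (k :: s) f = rpartial k (rpartials s f).
Proof. by []. Qed.

#[local] Opaque rpartial.

Lemma rpartials_cat s s' f : rpartials (s ++ s') f = rpartials s (rpartials s' f).
Proof. by rewrite /rpartials foldr_cat. Qed.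

Lemma rsmooth_rpartials s f : rsmooth f -> rsmooth (rpartials s f).
Proof. by move=> [H]; split=> s'; rewrite -rpartials_cat; exact: H. Qed.

Lemma rsmooth_rpartial k f : rsmooth f -> rsmooth (rpartial k f).
Proof. exact: (@rsmooth_rpartials [:: k]). Qed.

Lemma is_partial_step k f z t d : is_partial k f (step k t z) d ->
  is_derive t 1 (fun u => f (step k u z)) d.
Proof.
move=> H.
have Hs : is_derive t (1 : R) (fun u => u - t) (1 : R).
  have Hd := is_deriveB (is_derive_id t (1 : R)) (is_derive_cst t t (1 : R)).
  by apply: (is_derive_eq Hd); rewrite subr0.
have H' : is_derive (t - t) 1 (fun u => f (step k u (step k t z))) d by rewrite subrr.
have Hc := @is_derive1_comp R _ (fun u => u - t) t d 1 H' Hs.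
rewrite mulr1 in Hc; move: Hc; congr (is_derive _ _ _ _).
by apply/funext => u /=; rewrite stepD addrC subrK.
Qed.

Lemma rsmooth_is_derive f k z t : rsmooth f ->
  is_derive t 1 (fun u => f (step k u z)) (rpartial k f (step k t z)).
Proof. by move=> sf; apply: is_partial_step; exact: rsmooth_is_partial. Qed.

Inductive rsmooth_alg : (Cn -> R) -> Prop :=
| rsa_smooth f of rsmooth f : rsmooth_alg f
| rsa_cst c : rsmooth_alg (fun=> c)
| rsa_xcoord k : rsmooth_alg (xcoord k)
| rsa_add f g of rsmooth_alg f & rsmooth_alg g : rsmooth_alg (fun x => f x + g x)
| rsa_mul f g of rsmooth_alg f & rsmooth_alg g : rsmooth_alg (fun x => f x * g x)
| rsa_comp h g of smooth1 h & rsmooth_alg g : rsmooth_alg (fun x => h (g x)).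

Lemma is_partial_cst k (c : R) z : is_partial k (fun=> c) z 0.
Proof. exact: is_derive_cst. Qed.

Lemma is_partial_xcoord k l z : is_partial k (xcoord l) z (k == l)%:R.
Proof.
rewrite /is_partial (_ : (fun t => _) = fun t => xcoord l z + (k == l)%:R * t); last first.
  by apply/funext => t; rewrite xcoord_step.
have H := is_deriveD (is_derive_cst (xcoord l z) (0 : R) 1)
  (is_deriveM (is_derive_cst ((k == l)%:R : R) (0 : R) 1) (is_derive_id (0 : R) 1)).
by apply: (is_derive_eq H); rewrite /GRing.scale /= add0r mulr1 mulr0 addr0.
Qed.

Lemma is_partialD k f g z a b : is_partial k f z a -> is_partial k g z b ->
  is_partial k (fun x => f x + g x) z (a + b).
Proof. exact: is_deriveD. Qed.

Lemma is_partialM k f g z a b : is_partial k f z a -> is_partial k g z b ->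
  is_partial k (fun x => f x * g x) z (f z * b + g z * a).
Proof.
move=> Ha Hb; have H := is_deriveM Ha Hb.
by apply: (is_derive_eq H); rewrite /GRing.scale /= step0.
Qed.

Lemma is_partial_comp k (h : R -> R) g z a : smooth1 h -> is_partial k g z a ->
  is_partial k (fun x => h (g x)) z (derive1 h (g z) * a).
Proof.
move=> sh Ha; apply: is_derive1_comp; last exact: Ha.
by rewrite step0; exact: smooth1_is_derive.
Qed.

Lemma rsmooth_algP f : rsmooth_alg f -> rsmooth f.
Proof.
apply: rsmooth_class => {}f; elim=> {f}.
- move=> f sf; split=> [|k]; first exact: rsmooth_continuous.
  exists (rpartial k f) => [|z]; last exact: rsmooth_is_partial.
  exact/rsa_smooth/rsmooth_rpartial.
- move=> c; split=> [z|k]; first exact: cvg_cst.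
  exists (fun=> 0) => [|z]; [exact: rsa_cst|exact: is_partial_cst].
- move=> l; split=> [|k]; first exact: xcoord_continuous.
  exists (fun=> (k == l)%:R) => [|z]; [exact: rsa_cst|exact: is_partial_xcoord].
- move=> f g Ff [cf df] Fg [cg dg]; split=> [z|k].
    by apply: cvgD; [exact: cf|exact: cg].
  have [f' Ff' Hf] := df k; have [g' Fg' Hg] := dg k.
  exists (fun x => f' x + g' x) => [|z]; [exact: rsa_add|exact: is_partialD].
- move=> f g Ff [cf df] Fg [cg dg]; split=> [z|k].
    by apply: cvgM; [exact: cf|exact: cg].
  have [f' Ff' Hf] := df k; have [g' Fg' Hg] := dg k.
  exists (fun x => f x * g' x + g x * f' x) => [|z]; last exact: is_partialM.
  by apply: rsa_add; apply: rsa_mul.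
- move=> h g sh Fg [cg dg]; split=> [z|k].
    by apply: (continuous_comp (cg z)); exact: smooth1_continuous.
  have [g' Fg' Hg] := dg k.
  exists (fun x => derive1 h (g x) * g' x) => [|z]; last exact: is_partial_comp.
  by apply: rsa_mul => //; apply: rsa_comp => //; exact: smooth1_derive1.
Qed.

Lemma rsmooth_cst c : rsmooth (fun=> c).
Proof. exact/rsmooth_algP/rsa_cst. Qed.

Lemma rsmooth_xcoord k : rsmooth (xcoord k).
Proof. exact/rsmooth_algP/rsa_xcoord. Qed.

Lemma rsmoothD f g : rsmooth f -> rsmooth g -> rsmooth (fun x => f x + g x).
Proof. by move=> sf sg; apply: rsmooth_algP; apply: rsa_add; exact: rsa_smooth. Qed.

Lemma rsmoothM f g : rsmooth f -> rsmooth g -> rsmooth (fun x => f x * g x).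
Proof. by move=> sf sg; apply: rsmooth_algP; apply: rsa_mul; exact: rsa_smooth. Qed.

Lemma rsmoothN f : rsmooth f -> rsmooth (fun x => - f x).
Proof.
move=> sf; rewrite (_ : (fun x => _) = fun x => (-1) * f x); last by apply/funext => x; rewrite mulN1r.
by apply: rsmoothM => //; exact: rsmooth_cst.
Qed.

Lemma rsmoothB f g : rsmooth f -> rsmooth g -> rsmooth (fun x => f x - g x).
Proof. by move=> sf sg; apply: rsmoothD => //; exact: rsmoothN. Qed.

Lemma rsmooth_comp h g : smooth1 h -> rsmooth g -> rsmooth (fun x => h (g x)).
Proof. by move=> sf sg; apply: rsmooth_algP; apply: rsa_comp => //; exact: rsa_smooth. Qed.

Lemma rpartialD k f g z : rsmooth f -> rsmooth g ->
  rpartial k (fun x => f x + g x) z = rpartial k f z + rpartial k g z.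
Proof.
by move=> sf sg; apply: is_partial_rpartial; apply: is_partialD; exact: rsmooth_is_partial.
Qed.

Lemma rpartialM k f g z : rsmooth f -> rsmooth g ->
  rpartial k (fun x => f x * g x) z = f z * rpartial k g z + g z * rpartial k f z.
Proof.
by move=> sf sg; apply: is_partial_rpartial; apply: is_partialM; exact: rsmooth_is_partial.
Qed.

Lemma rpartialN k f z : rsmooth f -> rpartial k (fun x => - f x) z = - rpartial k f z.
Proof.
by move=> sf; apply: is_partial_rpartial; apply: is_deriveN; exact: rsmooth_is_partial.
Qed.

Lemma rpartialB k f g z : rsmooth f -> rsmooth g ->
  rpartial k (fun x => f x - g x) z = rpartial k f z - rpartial k g z.
Proof. by move=> sf sg; rewrite rpartialD ?rpartialN//; exact: rsmoothN. Qed.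

Lemma rpartial_cst k (c : R) z : rpartial k (fun=> c) z = 0.
Proof. exact/is_partial_rpartial/is_partial_cst. Qed.

Lemma rpartial_xcoord k l z : rpartial k (xcoord l) z = (k == l)%:R.
Proof. exact/is_partial_rpartial/is_partial_xcoord. Qed.

Lemma rpartial_comp k h g z : smooth1 h -> rsmooth g ->
  rpartial k (fun x => h (g x)) z = derive1 h (g z) * rpartial k g z.
Proof.
move=> sh sg; apply: is_partial_rpartial; apply: (is_partial_comp sh).
exact: rsmooth_is_partial.
Qed.

Lemma rsmooth_MVT f k z (a b : R) : rsmooth f -> a < b ->
  exists2 c, a < c < b & f (step k b z) - f (step k a z) = rpartial k f (step k c z) * (b - a).
Proof.
move=> sf ab.
have [|c cab ->] := @MVT R (fun u => f (step k u z)) _ a b ab (fun x _ => rsmooth_is_derive k z x sf).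
  apply: continuous_subspaceT => x.
  exact: is_derive1_continuous (rsmooth_is_derive k z x sf).
by exists c.
Qed.

(** The second difference is symmetric in k and l, and two mean value theorems turn it into a value
  of one mixed derivative near z; comparing both orders gives the symmetry of mixed derivatives. *)
Lemma rsmooth_second_difference f k l z (h : R) : rsmooth f -> 0 < h ->
  exists a b, [/\ 0 < a < h, 0 < b < h &
    f (step k h (step l h z)) - f (step k h z) - (f (step l h z) - f z) =
    rpartial l (rpartial k f) (step l b (step k a z)) * h ^+ 2].
Proof.
move=> sf h0.
have dF (t : R) : is_derive t (1 : R) (fun u => f (step k u (step l h z)) - f (step k u z))
    (rpartial k f (step k t (step l h z)) - rpartial k f (step k t z)).
  by apply: is_deriveB; exact: rsmooth_is_derive.
have [|a] := @MVT R _ _ 0 h h0 (fun x _ => dF x).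
  by apply: continuous_subspaceT => x; exact: is_derive1_continuous (dF x).
rewrite !step0 in_itv /= => a0h ->.
have [b b0h] := rsmooth_MVT l (step k a z) (rsmooth_rpartial k sf) h0.
rewrite step0 stepC => ->; exists a, b; split => //; rewrite subr0; ring.
Qed.

Lemma step_step_close i j z (u v h d : R) : 0 < u -> u < h -> 0 < v -> v < h -> h * 3 <= d ->
  forall m, `|xcoord m (step i u (step j v z)) - xcoord m z| < d.
Proof.
move=> u0 uh v0 vh hd m; rewrite !xcoord_step.
have -> : xcoord m z + (j == m)%:R * v + (i == m)%:R * u - xcoord m z =
    (j == m)%:R * v + (i == m)%:R * u by ring.
rewrite ger0_norm ?addr_ge0 ?mulr_ge0 ?ler0n// ?(ltW u0)// ?(ltW v0)//.
by case: (j == m); case: (i == m); rewrite ?mul1r ?mul0r; lra.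
Qed.

Lemma rpartialC f k l z : rsmooth f -> rpartial l (rpartial k f) z = rpartial k (rpartial l f) z.
Proof.
move=> sf; apply/eqP; rewrite -subr_eq0 -normr_eq0 eq_le normr_ge0 andbT.
apply/ler_addgt0Pr => e e0; rewrite add0r.
have e20 : 0 < e / 2 by rewrite divr_gt0.
have near_z i j : exists2 d : R, 0 < d & forall y, (forall m, `|xcoord m y - xcoord m z| < d) ->
    `|rpartial i (rpartial j f) z - rpartial i (rpartial j f) y| < e / 2.
  have /rsmooth_continuous/(_ z)/cvgrPdist_lt/(_ _ e20) := rsmooth_rpartials [:: i; j] sf.
  by move=> /nbhs_xcoordP.
have [d1 d10 Hd1] := near_z l k; have [d2 d20 Hd2] := near_z k l.
pose h := Num.min d1 d2 / 3.
have h0 : 0 < h by rewrite divr_gt0// lt_min d10.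
have [h1 h2] : h * 3 <= d1 /\ h * 3 <= d2 by rewrite /h divfK// !ge_min !lexx orbT.
have [a [b [/andP[a0 ah] /andP[b0 bh] E1]]] := rsmooth_second_difference k l z sf h0.
have [a' [b' [/andP[a'0 a'h] /andP[b'0 b'h] E2]]] := rsmooth_second_difference l k z sf h0.
have E : rpartial l (rpartial k f) (step l b (step k a z)) =
    rpartial k (rpartial l f) (step k b' (step l a' z)).
  have hn0 : h ^+ 2 != 0 by rewrite expf_neq0// gt_eqF.
  apply: (mulIf hn0); apply: (etrans (esym E1)); apply: etrans E2; rewrite (stepC k l).
  move: (f (step l h (step k h z))) (f (step k h z)) (f (step l h z)) (f z) => A B D E.
  clear; ring.
have H1 := Hd1 _ (step_step_close l k z b0 bh a0 ah h1).
have H2 := Hd2 _ (step_step_close k l z b'0 b'h a'0 a'h h2).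
rewrite -E in H2; rewrite [leRHS]splitr.
apply: le_trans (ler_distD (rpartial l (rpartial k f) (step l b (step k a z))) _ _) _.
apply: lerD; first exact: ltW H1.
rewrite distrC; exact: ltW H2.
Qed.

Lemma rpartials_perm s s' f : rsmooth f -> perm_eq s s' -> rpartials s f = rpartials s' f.
Proof.
have move1 k r g : rsmooth g -> rpartials (k :: r) g = rpartials (rcons r k) g.
  elim: r => [//|l r IH] sg; rewrite rcons_cons [RHS]rpartials_cons -(IH sg) !rpartials_cons.
  by apply/funext => z; apply: rpartialC; exact: rsmooth_rpartials.
move=> sf; elim: s s' => [|k s IH] s' ss'.
  by have := perm_size ss'; case: s' {ss'}.
have ks' : k \in s' by rewrite -(perm_mem ss') mem_head.
case/splitPr: ks' ss' => s1 s2; rewrite -[k :: s2]cat1s perm_sym perm_catCA /= perm_cons perm_sym => ss'.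
rewrite -cat_rcons rpartials_cat -(move1 _ _ _ (rsmooth_rpartials s2 sf)).
by rewrite !rpartials_cons -rpartials_cat -(IH _ ss').
Qed.

End real_smooth.

(** * Bernstein polynomials and iterated antiderivatives *)

Section bernstein.
Context {R : realType}.
Implicit Types (t c : R) (phi : nat -> R).

(** De Casteljau's recursion instead of the binomial formula: mean and variance then follow by
  induction on the degree. *)
Fixpoint bernstein (m i : nat) : {poly R} :=
  match m with
  | 0 => (i == 0)%:R
  | m'.+1 => 'X * (if i is i'.+1 then bernstein m' i' else 0) + (1 - 'X) * bernstein m' i
  end.

Lemma bernstein_out m i : (m < i)%N -> bernstein m i = 0.
Proof.
elim: m i => [|m IH] [|i]//= mi.
by rewrite !IH ?mulr0 ?addr0// ltnW.
Qed.

Lemma bernstein_ge0 m i t : 0 <= t <= 1 -> 0 <= (bernstein m i).[t].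
Proof.
move=> /andP[t0 t1]; elim: m i => [|m IH] i /=.
  by case: eqP => _; rewrite ?hornerC// horner0.
rewrite !hornerE addr_ge0// mulr_ge0// ?subr_ge0//.
by case: i => [|i]; rewrite ?horner0.
Qed.

Definition bernstein_mean m phi t : R := \sum_(i < m.+1) phi i * (bernstein m i).[t].

Lemma bernstein_meanS m phi t : bernstein_mean m.+1 phi t =
  t * bernstein_mean m (phi \o S) t + (1 - t) * bernstein_mean m phi t.
Proof.
rewrite /bernstein_mean.
under eq_bigr do rewrite /= hornerD !hornerM hornerX hornerD hornerN hornerX hornerC mulrDr.
rewrite big_split /= big_ord_recl horner0 mulr0 mulr0 add0r; congr (_ + _).
  by rewrite mulr_sumr; apply: eq_bigr => i _; rewrite mulrCA.
rewrite big_ord_recr /= bernstein_out// horner0 !mulr0 addr0.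
by rewrite mulr_sumr; apply: eq_bigr => i _; rewrite mulrCA.
Qed.

Lemma bernstein_mean_cst m c t : bernstein_mean m (fun=> c) t = c.
Proof.
elim: m => [|m IH]; first by rewrite /bernstein_mean big_ord1 /= hornerC mulr1.
by rewrite bernstein_meanS /= [X in t * X]IH IH; ring.
Qed.

Lemma bernstein_mean_variance m c t :
  bernstein_mean m (fun i => (i%:R - c) ^+ 2) t = m%:R * t * (1 - t) + (m%:R * t - c) ^+ 2.
Proof.
elim: m c => [|m IH] c.
  by rewrite /bernstein_mean big_ord1 /= hornerC mulr1; ring.
rewrite bernstein_meanS IH.
have -> : bernstein_mean m ((fun i => (i%:R - c) ^+ 2) \o S) t =
    bernstein_mean m (fun i => (i%:R - (c - 1)) ^+ 2) t.
  by apply: eq_bigr => i _ /=; rewrite -natr1; congr (_ ^+ 2 * _); ring.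
by rewrite IH -natr1; ring.
Qed.

Lemma bernstein_mean_le m phi psi t : 0 <= t <= 1 -> (forall i, (i <= m)%N -> phi i <= psi i) ->
  bernstein_mean m phi t <= bernstein_mean m psi t.
Proof.
move=> t01 H; apply: ler_sum => i _; apply: ler_wpM2r; first exact: bernstein_ge0.
by apply: H; rewrite -ltnS.
Qed.

Lemma bernstein_mean_abs m phi t : 0 <= t <= 1 ->
  `|bernstein_mean m phi t| <= bernstein_mean m (fun i => `|phi i|) t.
Proof.
move=> t01; apply: le_trans (ler_norm_sum _ _ _) _; apply: ler_sum => i _.
by rewrite normrM (ger0_norm (bernstein_ge0 _ _ t01)).
Qed.

Lemma bernstein_meanD m phi psi t : bernstein_mean m (fun i => phi i + psi i) t =
  bernstein_mean m phi t + bernstein_mean m psi t.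
Proof. by rewrite /bernstein_mean -big_split; apply: eq_bigr => i _; rewrite mulrDl. Qed.

Lemma bernstein_meanZ m phi c t : bernstein_mean m (fun i => c * phi i) t =
  c * bernstein_mean m phi t.
Proof. by rewrite /bernstein_mean mulr_sumr; apply: eq_bigr => i _; rewrite mulrA. Qed.

(** The inequality |u| <= d + u^2 / d turns the variance into a bound on the mean deviation. *)
Lemma bernstein_lipschitz m phi M t d y : (0 < m)%N -> 0 <= t <= 1 -> 0 <= M -> 0 < d ->
  (forall i, (i <= m)%N -> `|phi i - y| <= M * `|i%:R / m%:R - t|) ->
  `|bernstein_mean m phi t - y| <= M * (d + (m%:R * d)^-1).
Proof.
move=> m0 t01 M0 d0 H.
have m0' : 0 < m%:R :> R by rewrite ltr0n.
have mn0 : m%:R != 0 :> R by rewrite gt_eqF.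
rewrite -{1}(bernstein_mean_cst m y t) -mulN1r -bernstein_meanZ -bernstein_meanD.
apply: le_trans (bernstein_mean_abs _ _ t01) _.
apply: (@le_trans _ _ (bernstein_mean m (fun i => M * d + (M / d / m%:R ^+ 2) * (i%:R - m%:R * t) ^+ 2) t)).
  apply: bernstein_mean_le => // i im; rewrite mulN1r; apply: le_trans (H i im) _.
  have -> : M * d + M / d / m%:R ^+ 2 * (i%:R - m%:R * t) ^+ 2 = M * (d + (i%:R / m%:R - t) ^+ 2 / d).
    by field; rewrite mn0 gt_eqF.
  apply: ler_wpM2l => //; set u := i%:R / m%:R - t.
  have [ud|du] := leP `|u| d; first by rewrite (le_trans ud)// lerDl divr_ge0// ?sqr_ge0// ltW.
  rewrite -(real_normK (num_real u)) (@le_trans _ _ (`|u| ^+ 2 / d))// ?lerDr ?(ltW d0)//.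
  by rewrite expr2 -mulrA ler_peMr// ler_pdivlMr// mul1r ltW.
rewrite bernstein_meanD bernstein_mean_cst bernstein_meanZ bernstein_mean_variance subrr.
rewrite expr0n /= addr0 [leRHS]mulrDr lerD2l.
have -> : M / d / m%:R ^+ 2 * (m%:R * t * (1 - t)) = M * (m%:R * d)^-1 * (t * (1 - t)).
  by field; rewrite mn0 gt_eqF.
case/andP: t01 => t0 t1; rewrite ler_piMr ?mulr_ge0 ?invr_ge0 ?mulr_ge0 ?ler0n ?(ltW d0)//; nra.
Qed.

Definition poly_int (q : {poly R}) : {poly R} := \poly_(i < (size q).+1) (q`_i.-1 / i%:R).

Lemma deriv_poly_int q : (poly_int q)^`() = q.
Proof.
apply/polyP => i; rewrite coef_deriv coef_poly ltnS /=.
case: ltnP => iq; last by rewrite mul0rn nth_default.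
by rewrite -[LHS]mulr_natr divfK// pnatr_eq0.
Qed.

Definition poly_prim (a : R) (q : {poly R}) : {poly R} := poly_int q - (poly_int q).[a]%:P.

Lemma deriv_poly_prim a q : (poly_prim a q)^`() = q.
Proof. by rewrite derivB derivC subr0 deriv_poly_int. Qed.

Lemma horner_poly_prim a q : (poly_prim a q).[a] = 0.
Proof. by rewrite !hornerE subrr. Qed.

Lemma derivn_iter_prim a q i N : (i <= N)%N ->
  (iter N (poly_prim a) q)^`(i) = iter (N - i) (poly_prim a) q.
Proof.
elim: i N => [|i IH] N iN; first by rewrite subn0.
by case: N iN => // N iN; rewrite derivSn /= deriv_poly_prim IH.
Qed.

Lemma smooth1_horner (q : {poly R}) : smooth1 (horner q).
Proof.
apply: (@smooth1_class _ [set horner q' | q' in setT]); last by exists q.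
by move=> _ [q' _ <-]; exists (horner q'^`()); [exists q'^`()|move=> x; exact: is_derive_poly].
Qed.

End bernstein.

(** * Uniform approximation of Lipschitz functions by polynomials *)

Section polynomial_density.
Context {R : realType} {n : nat}.
Local Notation Cn := 'rV[R[i]]_n.
Local Notation dir := ('I_n + 'I_n)%type.
Implicit Types (f g : Cn -> R) (z p : Cn) (k l : dir) (s : seq dir).
Implicit Types (q : dir -> {poly R}) (L : seq (R * (dir -> {poly R}))).

Definition prod_poly p q z : R := \prod_k (q k).[xcoord k z - xcoord k p].

Definition sum_prod_poly p L z : R := \sum_(cq <- L) cq.1 * prod_poly p cq.2 z.

Lemma rsmooth_prod (I : Type) (r : seq I) (P : pred I) (F : I -> Cn -> R) :
  (forall i, rsmooth (F i)) -> rsmooth (fun z => \prod_(i <- r | P i) F i z).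
Proof.
move=> sF; elim: r => [|i r IH].
  by rewrite (_ : (fun z => _) = fun=> 1); [exact: rsmooth_cst|apply/funext => z; rewrite big_nil].
rewrite (_ : (fun z => _) = fun z => (if P i then F i z else 1) * \prod_(j <- r | P j) F j z).
  by apply: rsmoothM => //; case: (P i) => //; exact: rsmooth_cst.
by apply/funext => z; rewrite big_cons; case: (P i) => //; rewrite mul1r.
Qed.

Lemma rsmooth_sum (I : Type) (r : seq I) (F : I -> Cn -> R) :
  (forall i, rsmooth (F i)) -> rsmooth (fun z => \sum_(i <- r) F i z).
Proof.
move=> sF; elim: r => [|i r IH].
  by rewrite (_ : (fun z => _) = fun=> 0); [exact: rsmooth_cst|apply/funext => z; rewrite big_nil].
rewrite (_ : (fun z => _) = fun z => F i z + \sum_(j <- r) F j z); first exact: rsmoothD.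
by apply/funext => z; rewrite big_cons.
Qed.

Lemma rsmooth_prod_poly p q : rsmooth (prod_poly p q).
Proof.
apply: rsmooth_prod => k; apply: rsmooth_comp; first exact: smooth1_horner.
by apply: rsmoothB; [exact: rsmooth_xcoord|exact: rsmooth_cst].
Qed.

Definition deriv_at l q : dir -> {poly R} := fun k => if l == k then (q k)^`() else q k.

Lemma rpartial_prod_poly l p q : rpartial l (prod_poly p q) = prod_poly p (deriv_at l q).
Proof.
apply/funext => z; apply: is_partial_rpartial; rewrite /is_partial.
pose c := \prod_(k | k != l) (q k).[xcoord k z - xcoord k p].
have H := is_derive1_comp (is_derive_poly (q l) (xcoord l z - xcoord l p + 0))
  (is_deriveD (is_derive_cst (xcoord l z - xcoord l p) (0 : R) 1) (is_derive_id (0 : R) 1)).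
have H1 := is_deriveM (is_derive_cst c (0 : R) 1) H.
rewrite (_ : (fun t => _) = cst c * (horner (q l) \o (cst (xcoord l z - xcoord l p) + id))); last first.
  apply/funext => t; rewrite /prod_poly (bigD1 l)//= mulrC; congr (_ * _).
    by apply: eq_bigr => k kl; rewrite xcoord_step eq_sym (negbTE kl) mul0r addr0.
  by rewrite xcoord_step eqxx mul1r fctE addrAC.
apply: (is_derive_eq H1); rewrite /prod_poly (bigD1 l)//= /deriv_at eqxx.
rewrite /GRing.scale /= add0r mulr1 mulr0 !addr0 mulrC; congr (_ * _).
by apply: eq_bigr => k kl; rewrite eq_sym (negbTE kl).
Qed.

Lemma rpartials_prod_poly s p q :
  rpartials s (prod_poly p q) = prod_poly p (fun k => (q k)^`(count_mem k s)).
Proof.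
elim: s => [|l s IH] //; rewrite rpartials_cons IH rpartial_prod_poly; congr prod_poly.
apply/funext => k; rewrite /deriv_at /=.
by case: eqP => _; rewrite ?add0n// add1n derivnS.
Qed.

Lemma rpartials_sum (I : Type) (r : seq I) s (F : I -> Cn -> R) : (forall i, rsmooth (F i)) ->
  rpartials s (fun z => \sum_(i <- r) F i z) = fun z => \sum_(i <- r) rpartials s (F i) z.
Proof.
move=> sF; elim: s => [//|k s IH]; rewrite rpartials_cons IH.
have sF' i : rsmooth (rpartials s (F i)) by exact: rsmooth_rpartials.
elim: r {IH} => [|i r IH]; apply/funext => z.
  rewrite big_nil (_ : (fun z => _) = fun=> 0); first by rewrite rpartial_cst.
  by apply/funext => y; rewrite big_nil.
rewrite big_cons -[X in _ + X](congr1 (fun h => h z) IH)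
  (_ : (fun z => _) = fun z => rpartials s (F i) z + \sum_(j <- r) rpartials s (F j) z).
  by rewrite rpartialD//; exact: rsmooth_sum.
by apply/funext => y; rewrite big_cons.
Qed.

Lemma rpartialsB s f g : rsmooth f -> rsmooth g ->
  rpartials s (fun z => f z - g z) = fun z => rpartials s f z - rpartials s g z.
Proof.
move=> sf sg; elim: s => [//|k s IH]; rewrite !rpartials_cons IH.
by apply/funext => z; apply: rpartialB; exact: rsmooth_rpartials.
Qed.

Definition set_coord k (v : R) z : Cn := step k (v - xcoord k z) z.

Lemma xcoord_set k l v z : xcoord l (set_coord k v z) = if k == l then v else xcoord l z.
Proof.
rewrite /set_coord xcoord_step; case: eqP => [->|_]; first by rewrite mul1r addrC subrK.
by rewrite mul0r addr0.
Qed.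

Definition lipschitz_box p (A M : R) g := forall k z t, cbox p A z -> cbox p A (step k t z) ->
  `|g (step k t z) - g z| <= M * `|t|.

Lemma cbox_set_coord p A k v z : cbox p A z -> `|v - xcoord k p| <= A -> cbox p A (set_coord k v z).
Proof. by move=> Hz Hv l; rewrite xcoord_set; case: eqP => [<-|_]. Qed.

Lemma lipschitz_set_coord p A M g k v : lipschitz_box p A M g -> 0 <= M -> `|v - xcoord k p| <= A ->
  lipschitz_box p A M (g \o set_coord k v).
Proof.
move=> lg M0 Hv l z t Hz Hzt /=.
have Hs := cbox_set_coord Hz Hv; have Hst := cbox_set_coord Hzt Hv.
have [kl|kl] := eqVneq k l.
  have -> : set_coord k v (step l t z) = set_coord k v z.
    by apply: xcoord_inj => m; rewrite !xcoord_set xcoord_step kl; case: eqP => // _; rewrite mul0r addr0.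
  by rewrite subrr normr0 mulr_ge0.
have E : set_coord k v (step l t z) = step l t (set_coord k v z).
  apply: xcoord_inj => m; rewrite xcoord_step !xcoord_set xcoord_step.
  by case: eqP => // <-; rewrite eq_sym (negbTE kl) mul0r addr0.
by rewrite E; apply: lg => //; rewrite -E.
Qed.

Definition depends_on (r : seq dir) g := forall z z',
  (forall k, k \in r -> xcoord k z = xcoord k z') -> g z = g z'.

Definition mul_at k (b : {poly R}) q : dir -> {poly R} := fun l => if k == l then q l * b else q l.

Lemma prod_poly_mul_at p k b q z :
  prod_poly p (mul_at k b q) z = prod_poly p q z * b.[xcoord k z - xcoord k p].
Proof.
rewrite /prod_poly (bigD1 k)//= [in RHS](bigD1 k)//= /mul_at eqxx hornerM mulrAC.
by congr (_ * _ * _); apply: eq_bigr => l lk; rewrite eq_sym (negbTE lk).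
Qed.

(** Induction on the coordinates on which g depends: take Bernstein means in one coordinate, and
  approximate the slices at the nodes, which depend on fewer coordinates. *)
Lemma approx_lipschitz (p : Cn) (A M : R) : 0 < A -> 0 <= M ->
  forall (r : seq dir) g (eps : R), lipschitz_box p A M g -> depends_on r g -> 0 < eps ->
  exists L, forall z, cbox p A z -> `|g z - sum_prod_poly p L z| <= eps.
Proof.
move=> A0 M0; elim=> [|k r IH] g eps lg dg eps0.
  exists [:: (g p, fun=> 1)] => z _; rewrite /sum_prod_poly big_seq1 /=.
  rewrite /prod_poly big1 ?mulr1 => [|l _]; last by rewrite hornerC.
  by rewrite (dg z p)// subrr normr0 ltW.
have eps20 : 0 < eps / 2 by rewrite divr_gt0.
(* The two error terms d and 1 / (m d) of the Bernstein estimate are balanced: m is chosen with 1 /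
  (m d) <= d. *)
pose d := eps / 2 / (2 * (M * (2 * A) + 1)).
have D0 : 0 < M * (2 * A) + 1 by rewrite ltr_wpDl// mulr_ge0// mulr_ge0// ltW.
have d0 : 0 < d by apply: divr_gt0 => //; apply: mulr_gt0.
have [m m0 md] : exists2 m, (0 < m)%N & (m%:R * d)^-1 <= d.
  exists (Num.truncn (d ^- 2)).+1 => //.
  rewrite -[leRHS]invrK lef_pV2 ?posrE ?invr_gt0//; last by apply: mulr_gt0; rewrite ?ltr0n.
  rewrite -ler_pdivrMr// -invfM -expr2 ltW//.
  exact: truncnS_gt.
have m0' : 0 < m%:R :> R by rewrite ltr0n.
pose c i : R := xcoord k p - A + 2 * A * (i%:R / m%:R).
have cA i : (i <= m)%N -> `|c i - xcoord k p| <= A.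
  move=> im; have H0 : 0 <= i%:R / m%:R :> R by rewrite divr_ge0.
  have H1 : i%:R / m%:R <= 1 :> R by rewrite ler_pdivrMr// mul1r ler_nat.
  by rewrite /c ler_norml; apply/andP; split; nra.
have /choice[L HL] : forall i, exists L, (i <= m)%N -> forall z, cbox p A z ->
    `|g (set_coord k (c i) z) - sum_prod_poly p L z| <= eps / 2.
  move=> i; have [im|_] := boolP (i <= m)%N; last by exists [::].
  have [||//|L HL] := IH (g \o set_coord k (c i)) (eps / 2).
  - by apply: lipschitz_set_coord => //; exact: cA.
  - move=> z z' zz'; apply: dg => l; rewrite inE !xcoord_set [l == k]eq_sym.
    by case: eqP => //= _; exact: zz'.
  by exists L.
pose b i := bernstein m i \Po ((2 * A)^-1 *: ('X + A%:P)).
exists (flatten [seq [seq (cq.1, mul_at k (b i) cq.2) | cq <- L i] | i <- iota 0 m.+1]) => z Hz.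
pose t := (xcoord k z - xcoord k p + A) / (2 * A).
have A20 : 2 * A != 0 by rewrite mulf_neq0// gt_eqF.
have t01 : 0 <= t <= 1.
  have := Hz k; rewrite ler_norml => /andP[H1 H2]; apply/andP; split.
    by rewrite divr_ge0 ?mulr_ge0 ?(ltW A0)//; lra.
  by rewrite ler_pdivrMr ?mulr_gt0// mul1r; lra.
have -> : sum_prod_poly p (flatten [seq [seq (cq.1, mul_at k (b i) cq.2) | cq <- L i] | i <- iota 0 m.+1]) z =
    bernstein_mean m (fun i => sum_prod_poly p (L i) z) t.
  rewrite /sum_prod_poly big_flatten big_map -[iota 0 m.+1]/(index_iota 0 m.+1) big_mkord.
  apply: eq_bigr => i _; rewrite big_map mulr_suml; apply: eq_bigr => cq _ /=.
  rewrite prod_poly_mul_at mulrA; congr (_ * _).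
  rewrite /b horner_comp; congr (_.[_]); rewrite !hornerE /t mulrC; congr (_ * _); ring.
have -> : g z - bernstein_mean m (fun i => sum_prod_poly p (L i) z) t =
    bernstein_mean m (fun i => g (set_coord k (c i) z) - sum_prod_poly p (L i) z) t -
    (bernstein_mean m (fun i => g (set_coord k (c i) z)) t - g z).
  have -> : bernstein_mean m (fun i => g (set_coord k (c i) z) - sum_prod_poly p (L i) z) t =
      bernstein_mean m (fun i => g (set_coord k (c i) z)) t - bernstein_mean m (fun i => sum_prod_poly p (L i) z) t.
    by rewrite -mulN1r -bernstein_meanZ -bernstein_meanD; apply: eq_bigr => i _; rewrite mulN1r.
  by ring.
apply: le_trans (ler_normB _ _) _; rewrite [leRHS]splitr; apply: lerD.
  apply: le_trans (bernstein_mean_abs _ _ t01) _.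
  rewrite -[leRHS](bernstein_mean_cst m _ t); apply: bernstein_mean_le => // i im.
  exact: HL.
apply: (@le_trans _ _ (M * (2 * A) * (d + (m%:R * d)^-1))).
  apply: bernstein_lipschitz => //; first by rewrite mulr_ge0// mulr_ge0// ltW.
  move=> i im; have Hs := cbox_set_coord Hz (cA i im).
  apply: le_trans (lg k z _ Hz Hs) _; rewrite -mulrA; apply: ler_wpM2l => //.
  have -> : c i - xcoord k z = 2 * A * (i%:R / m%:R - t).
    by rewrite /c /t mulrBr [_ * (_ / (2 * A))]mulrC divfK//; ring.
  by rewrite normrM (gtr0_norm (_ : 0 < 2 * A))// mulr_gt0.
have MA0 : 0 <= M * (2 * A) by apply: mulr_ge0 => //; apply: mulr_ge0 => //; exact: ltW.
have i0 : 0 <= (m%:R * d)^-1 by rewrite invr_ge0; apply: mulr_ge0; exact: ltW.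
apply: (@le_trans _ _ ((M * (2 * A) + 1) * (d + d))).
  apply: ler_pM => //; first by apply: addr_ge0 => //; exact: ltW.
    by rewrite lerDl.
  by rewrite lerD2l.
rewrite /d; move: D0; clear; set D := M * (2 * A) + 1 => D0.
by rewrite le_eqVlt; apply/orP; left; apply/eqP; field; rewrite gt_eqF.
Qed.

End polynomial_density.

(** * Polynomial approximation together with derivatives *)

Section smooth_density.
Context {R : realType} {n : nat}.
Local Notation Cn := 'rV[R[i]]_n.
Local Notation dir := ('I_n + 'I_n)%type.
Implicit Types (f g : Cn -> R) (z p : Cn) (k l : dir) (s : seq dir).

Lemma rpartials_vanish s f p (a : R) : (forall z, ~ cbox p a z -> f z = 0) ->
  forall z, ~ cbox p a z -> rpartials s f z = 0.
Proof.
move=> f0; elim: s => [|k s IH] z Hz; first exact: f0.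
rewrite rpartials_cons; apply: is_partial_rpartial; rewrite /is_partial.
apply: (near_is_derive (g := fun=> 0)).
have op : open (~` cbox p a) by apply: closed_openC; exact: closed_cbox.
have H : nbhs (step k 0 z) (~` cbox p a) by rewrite step0; exact: open_nbhs_nbhs.
have H2 : \forall t \near (0 : R), (~` cbox p a) (step k t z) := continuous_step H.
by apply: filterS H2 => t; exact: IH.
Qed.

Lemma continuous_bounded_cbox f p (A : R) : continuous f -> exists2 M, 0 <= M &
  forall z, cbox p A z -> `|f z| <= M.
Proof.
move=> cf.
have [E|/set0P A0] := eqVneq (cbox p A) set0.
  by exists 0 => // z; rewrite E.
have [|c _ Hc] := @compact_EVT_max _ R (fun z => `|f z|) _ A0 (@compact_cbox R n p A).
  by apply: continuous_subspaceT => z; apply: cvg_norm; exact: cf.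
by exists `|f c| => // z Hz; apply: Hc; rewrite inE.
Qed.

Lemma rsmooth_bounded_cbox f p (A : R) : rsmooth f -> exists2 M, 0 <= M &
  forall z, cbox p A z -> `|f z| <= M.
Proof. by move=> sf; apply: continuous_bounded_cbox; exact: rsmooth_continuous. Qed.

Lemma rsmooth_lipschitz_box f p (A : R) : rsmooth f -> exists2 M, 0 <= M & lipschitz_box p A M f.
Proof.
move=> sf.
have /choice[M HM] : forall k, exists M, 0 <= M /\ forall z, cbox p A z -> `|rpartial k f z| <= M.
  by move=> k; have [M M0 HM] := rsmooth_bounded_cbox p A (rsmooth_rpartial k sf); exists M.
exists (\big[Num.max/0]_k M k); first exact: bigmax_ge_id.
move=> k z t Hz Hzt.
have inbox c : (0 <= c <= t) || (t <= c <= 0) -> cbox p A (step k c z).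
  move=> Hc l; have := Hz l; have := Hzt l; rewrite !xcoord_step.
  case: (k == l); rewrite ?mul1r ?mul0r ?addr0// !ler_norml => /andP[H1 H2] /andP[H3 H4].
  by case/orP: Hc => /andP[H5 H6]; apply/andP; split; lra.
suff [c Hc E] : exists2 c, (0 <= c <= t) || (t <= c <= 0) &
    f (step k t z) - f z = rpartial k f (step k c z) * t.
  rewrite E normrM ler_wpM2r//; apply: le_trans (le_bigmax _ _ k).
  by have [_] := HM k; apply; exact: inbox.
have [t0|t0|<-] := ltgtP 0 t.
- have [c /andP[c0 ct] E] := rsmooth_MVT k z sf t0; exists c; first by rewrite (ltW c0) (ltW ct).
  by rewrite step0 subr0 in E.
- have [c /andP[c0 ct] E] := rsmooth_MVT k z sf t0; exists c; first by rewrite (ltW c0) (ltW ct) orbT.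
  rewrite step0 sub0r in E; rewrite -opprB E; ring.
- by exists 0; rewrite ?lexx// step0 subrr mulr0.
Qed.

Definition all_dirs (N : nat) : seq dir := flatten (nseq N (enum {: dir})).

Lemma count_all_dirs N k : count_mem k (all_dirs N) = N.
Proof.
elim: N => [//|N IH]; rewrite /all_dirs /= count_cat [X in (_ + X)%N]IH count_uniq_mem ?enum_uniq//.
by rewrite mem_enum.
Qed.

Lemma sum_count_mem s : (\sum_k count_mem k s)%N = size s.
Proof.
elim: s => [|l s IH] /=; first by rewrite big1.
rewrite big_split /= IH (bigD1 l)//= eqxx big1 ?addn0 ?add1n// => k kl.
by rewrite eq_sym (negbTE kl).
Qed.

Lemma count_le_all_dirs N s : (forall k, (count_mem k s <= N)%N) ->
  (size s <= size (all_dirs N) ?= iff perm_eq s (all_dirs N))%N.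
Proof.
move=> Hs; rewrite -!sum_count_mem.
have H : forall k : dir, true -> (count_mem k s <= count_mem k (all_dirs N) ?=
    iff (count_mem k s == count_mem k (all_dirs N)))%N.
  by move=> k _; split => //; rewrite count_all_dirs.
have [H1 H2] := leqif_sum H; split => //; rewrite H2.
apply/forallP/idP => [E|/permP E k]; last by rewrite (E (pred1 k)) eqxx.
by apply/allP => k _ /=; exact: E.
Qed.

(** Approximate uniformly the derivative of order N in every direction and take N-fold
  antiderivatives from the lower faces of the box. On these faces f vanishes as well, so the mean
  value theorem brings the error back from the full derivative to all lower ones. *)
Lemma smooth_poly_approx f p (a A : R) (N : nat) (eps : R) : rsmooth f -> 0 < A -> a < A ->
  (forall z, ~ cbox p a z -> f z = 0) -> 0 < eps ->
  exists L, forall s, (size s <= N)%N -> forall z, cbox p A z ->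
    `|rpartials s (fun y => f y - sum_prod_poly p L y) z| <= eps.
Proof.
move=> sf A0 aA f0 eps0.
pose full := all_dirs N.
(* Each integration over the width 2 A of the box multiplies the error by at most B. *)
pose B := Num.max 1 (2 * A).
have B1 : 1 <= B by rewrite le_max lexx.
have B2 : 2 * A <= B by rewrite le_max lexx orbT.
have B0 : 0 < B by rewrite (lt_le_trans ltr01).
have Bn0 m : 0 < B ^+ m by rewrite exprn_gt0.
pose e0 := eps / B ^+ size full.
have e00 : 0 < e0 by apply: divr_gt0.
have [M M0 HM] := rsmooth_lipschitz_box p A (rsmooth_rpartials full sf).
have [|L0 HL0] := approx_lipschitz A0 M0 HM (r := enum {: dir}) _ e00.
  by move=> z z' zz'; congr (rpartials full f); apply: xcoord_inj => k; apply: zz'; rewrite mem_enum.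
pose L := [seq (cq.1, fun k => iter N (poly_prim (- A)) (cq.2 k)) | cq <- L0].
exists L.
pose u y := f y - sum_prod_poly p L y.
have sP cq : rsmooth (fun z : Cn => cq.1 * prod_poly p cq.2 z).
  by apply: rsmoothM; [exact: rsmooth_cst|exact: rsmooth_prod_poly].
have sL : rsmooth (sum_prod_poly p L) by exact: rsmooth_sum.
have su : rsmooth u by exact: rsmoothB.
have dP s cq z : rpartials s (fun z : Cn => cq.1 * prod_poly p cq.2 z) z =
    cq.1 * prod_poly p (fun k => (cq.2 k)^`(count_mem k s)) z.
  rewrite -rpartials_prod_poly; elim: s z => [//|k s IH] z.
  rewrite !rpartials_cons (_ : rpartials s _ = fun y => cq.1 * rpartials s (prod_poly p cq.2) y); last first.
    exact/funext.
  rewrite rpartialM; [|exact: rsmooth_cst|exact/rsmooth_rpartials/rsmooth_prod_poly].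
  by rewrite rpartial_cst mulr0 addr0.
have duE s z : (forall k, (count_mem k s <= N)%N) -> rpartials s u z = rpartials s f z -
    \sum_(cq <- L0) cq.1 * prod_poly p (fun k => iter (N - count_mem k s) (poly_prim (- A)) (cq.2 k)) z.
  move=> Hs; rewrite rpartialsB// /sum_prod_poly rpartials_sum// big_map; congr (_ - _).
  apply: eq_bigr => cq _; rewrite dP /=; congr (_ * prod_poly _ _ _).
  by apply/funext => k; exact: derivn_iter_prim.
(* j counts the derivatives that s lacks. *)
have main j s : (forall k, (count_mem k s <= N)%N) -> (size full = size s + j)%N ->
    forall z, cbox p A z -> `|rpartials s u z| <= B ^+ j * e0.
  elim: j s => [|j IH] s Hs Ej z Hz.
    rewrite expr0 mul1r duE//.
    have pf : perm_eq s full by have [_ <-] := count_le_all_dirs Hs; rewrite -/full Ej addn0.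
    rewrite (rpartials_perm sf pf); apply: le_trans (HL0 z Hz); rewrite /sum_prod_poly.
    rewrite le_eqVlt; apply/orP; left; apply/eqP; congr (`|_ - _|); apply: eq_bigr => cq _.
    congr (_ * prod_poly _ _ _); apply/funext => k.
    by rewrite (permP pf) count_all_dirs subnn.
  have [k kN] : exists k, (count_mem k s < N)%N.
    apply: contrapT => nk; have /eqP := Ej.
    have pf : perm_eq s full.
      apply/allP => k _ /=; rewrite count_all_dirs eqn_leq Hs /= leqNgt; apply/negP => kN.
      by apply: nk; exists k.
    by rewrite (perm_size pf) -[X in X == _]addn0 eqn_add2l.
  have Hks m : (count_mem m (k :: s) <= N)%N by rewrite /=; case: eqP => [<-|_]; rewrite ?add1n ?add0n.
  have {}IH y : cbox p A y -> `|rpartial k (rpartials s u) y| <= B ^+ j * e0.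
    by move=> Hy; apply: (IH (k :: s)) => //; rewrite Ej addnS.
  pose z0 := set_coord k (xcoord k p - A) z.
  have face y : cbox p A y -> xcoord k y = xcoord k p - A -> rpartials s u y = 0.
    move=> Hy yk; rewrite duE// (rpartials_vanish s f0); last first.
      by move=> /(_ k); rewrite yk addrAC subrr sub0r normrN gtr0_norm// leNgt aA.
    rewrite big1 ?subr0// => cq _; rewrite /prod_poly (bigD1 k)//= yk addrAC subrr sub0r.
    by rewrite -(prednK (_ : 0 < N - count_mem k s)%N) ?subn_gt0//= horner_poly_prim mul0r mulr0.
  have Hz0 : cbox p A z0 by apply: cbox_set_coord => //; rewrite addrAC subrr sub0r normrN gtr0_norm.
  have z0k : xcoord k z0 = xcoord k p - A by rewrite xcoord_set eqxx.
  have R0 : 0 <= B ^+ j.+1 * e0 by rewrite mulr_ge0// ltW.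
  pose t := xcoord k z - xcoord k p + A.
  have zE : z = step k t z0.
    apply: xcoord_inj => m; rewrite xcoord_step xcoord_set /t.
    by case: eqP => [<-|_]; rewrite ?mul0r ?addr0// mul1r; ring.
  have := Hz k; rewrite ler_norml => /andP[zk1 zk2].
  have t0 : 0 <= t by rewrite /t; lra.
  have t2A : t <= 2 * A by rewrite /t; lra.
  move: t0; rewrite le_eqVlt => /orP[/eqP t0|t0].
    by rewrite zE -t0 step0 face// normr0.
  have [c /andP[c0 ct] E] := rsmooth_MVT k z0 (rsmooth_rpartials s su) t0.
  rewrite step0 (face z0)// !subr0 -zE in E.
  rewrite E normrM (gtr0_norm t0) exprSr -mulrA [B * _]mulrC mulrA; apply: ler_pM => //; first exact: ltW.
    apply: IH => m; rewrite xcoord_step; have := Hz0 m; case: eqP => [<-|_]; last by rewrite mul0r addr0.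
    move=> _; rewrite z0k mul1r ler_norml; apply/andP; split; lra.
  exact: le_trans B2.
move=> s sN z Hz; have Hs k : (count_mem k s <= N)%N by apply: leq_trans sN; exact: count_size.
have [sf' _] := count_le_all_dirs Hs.
have E : (size full = size s + (size full - size s))%N by rewrite subnKC.
apply: le_trans (main _ _ Hs E z Hz) _.
rewrite /e0 mulrCA ler_piMr ?(ltW eps0)// ler_pdivrMr// mul1r.
by apply: ler_weXn2l => //; exact: leq_subr.
Qed.

End smooth_density.

(** * Complex-valued smooth functions and the operators dbar and d *)

Section complex_smooth.
Context {R : realType} {n : nat}.
Local Notation C := R[i].
Local Notation Re := (@complex.Re R).
Local Notation Im := (@complex.Im R).
Local Notation Cn := 'rV[R[i]]_n.
Local Notation dir := ('I_n + 'I_n)%type.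
Local Open Scope complex_scope.
Implicit Types (phi psi f : Cn -> C) (z p : Cn) (k l : dir) (s : seq dir).

Lemma Re_D (x y : C) : Re (x + y) = Re x + Re y. Proof. by case: x y => [a b] [c d]. Qed.
Lemma Im_D (x y : C) : Im (x + y) = Im x + Im y. Proof. by case: x y => [a b] [c d]. Qed.
Lemma Re_N (x : C) : Re (- x) = - Re x. Proof. by case: x. Qed.
Lemma Im_N (x : C) : Im (- x) = - Im x. Proof. by case: x. Qed.
Lemma Re_M (x y : C) : Re (x * y) = Re x * Re y - Im x * Im y.
Proof. by case: x y => [a b] [c d]. Qed.
Lemma Im_M (x y : C) : Im (x * y) = Re x * Im y + Re y * Im x.
Proof. by case: x y => [a b] [c d] /=; rewrite [b * c]mulrC. Qed.

Lemma complex_eqP (x y : C) : Re x = Re y -> Im x = Im y -> x = y.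
Proof. by case: x y => [a b] [c d] /= -> ->. Qed.

#[local] Opaque rpartial.

Lemma partialE k phi z :
  partial k phi z = rpartial k (Re \o phi) z +i* rpartial k (Im \o phi) z.
Proof. by []. Qed.

Lemma partialsE s phi z :
  partials s phi z = rpartials s (Re \o phi) z +i* rpartials s (Im \o phi) z.
Proof.
have [H1 H2] : (Re \o partials s phi = rpartials s (Re \o phi)) /\
    (Im \o partials s phi = rpartials s (Im \o phi)).
  elim: s => [//|k s [IH1 IH2]]; rewrite !rpartials_cons -IH1 -IH2; split; exact/funext.
by apply: complex_eqP => /=; rewrite -?H1 -?H2.
Qed.

Lemma partials_rcons k s phi : partials (rcons s k) phi = partials s (partial k phi).
Proof. by rewrite /partials foldr_rcons. Qed.

Definition csmooth phi := rsmooth (Re \o phi) /\ rsmooth (Im \o phi).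

Lemma csmoothP phi : csmooth phi <-> smooth phi.
Proof.
have E s (P : C -> R) (H : P = Re \/ P = Im) : P \o partials s phi = rpartials s (P \o phi).
  by apply/funext => z; rewrite /= partialsE; case: H => ->.
split.
  move=> [[sR] [sI]] s; split.
    move=> z; apply/complex_continuousP.
    have [cR _] := sR s; have [cI _] := sI s.
    split; [rewrite -[X in {for z, continuous X}]/(Re \o partials s phi)|
            rewrite -[X in {for z, continuous X}]/(Im \o partials s phi)]; rewrite E; auto; [exact: cR|exact: cI].
  move=> k z; have [_ /(_ k z) dR] := sR s; have [_ /(_ k z) dI] := sI s.
  by split; [move: dR; rewrite -(E s Re); auto|move: dI; rewrite -(E s Im); auto].
move=> H; split; split=> s; have [cs ds] := H s.
  split => [z|k z].
    rewrite -(E s Re); auto; by have /complex_continuousP[] := cs z.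
  by have [dR _] := ds k z; rewrite -(E s Re); auto.
split => [z|k z].
  rewrite -(E s Im); auto; by have /complex_continuousP[] := cs z.
by have [_ dI] := ds k z; rewrite -(E s Im); auto.
Qed.

Lemma csmooth_continuous phi : csmooth phi -> continuous phi.
Proof. by move=> [sR sI] z; apply/complex_continuousP; split; [exact: rsmooth_continuous sR z|exact: rsmooth_continuous sI z]. Qed.

Lemma csmooth_partial k phi : csmooth phi -> csmooth (partial k phi).
Proof. by move=> [sR sI]; split; [exact: rsmooth_rpartial sR|exact: rsmooth_rpartial sI]. Qed.

Lemma csmooth_real (f : Cn -> R) : rsmooth f -> csmooth (fun z => (f z)%:C).
Proof. by move=> sf; split => //; exact: rsmooth_cst. Qed.

Lemma csmooth_cst (c : C) : csmooth (fun=> c).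
Proof. by split; exact: rsmooth_cst. Qed.

Lemma csmoothD phi psi : csmooth phi -> csmooth psi -> csmooth (fun z => phi z + psi z).
Proof.
move=> [s1 s2] [t1 t2]; split.
  by rewrite (_ : _ \o _ = fun z => Re (phi z) + Re (psi z)); [exact: rsmoothD|apply/funext => z /=; rewrite Re_D].
by rewrite (_ : _ \o _ = fun z => Im (phi z) + Im (psi z)); [exact: rsmoothD|apply/funext => z /=; rewrite Im_D].
Qed.

Lemma csmoothM phi psi : csmooth phi -> csmooth psi -> csmooth (fun z => phi z * psi z).
Proof.
move=> [s1 s2] [t1 t2]; split.
  rewrite (_ : _ \o _ = fun z => Re (phi z) * Re (psi z) - Im (phi z) * Im (psi z)); last first.
    by apply/funext => z /=; rewrite Re_M.
  by apply: rsmoothB; exact: rsmoothM.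
rewrite (_ : _ \o _ = fun z => Re (phi z) * Im (psi z) + Re (psi z) * Im (phi z)); last first.
  by apply/funext => z /=; rewrite Im_M.
by apply: rsmoothD; exact: rsmoothM.
Qed.

Lemma csmoothZ (c : C) phi : csmooth phi -> csmooth (fun z => c * phi z).
Proof. by move=> sp; apply: csmoothM => //; exact: csmooth_cst. Qed.

Lemma csmoothN phi : csmooth phi -> csmooth (fun z => - phi z).
Proof.
by move=> sp; rewrite (_ : (fun z => _) = fun z => -1 * phi z); [exact: csmoothZ|apply/funext => z; rewrite mulN1r].
Qed.

Lemma csmoothB phi psi : csmooth phi -> csmooth psi -> csmooth (fun z => phi z - psi z).
Proof. by move=> sp sq; apply: csmoothD => //; exact: csmoothN. Qed.

Lemma csmoothX phi m : csmooth phi -> csmooth (fun z => phi z ^+ m).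
Proof.
move=> sp; elim: m => [|m IH]; first exact: csmooth_cst.
by rewrite (_ : (fun z => _) = fun z => phi z * phi z ^+ m); [exact: csmoothM|apply/funext => z; rewrite exprS].
Qed.

Lemma csmooth_prod (I : Type) (r : seq I) (P : pred I) (F : I -> Cn -> C) :
  (forall i, csmooth (F i)) -> csmooth (fun z => \prod_(i <- r | P i) F i z).
Proof.
move=> sF; elim: r => [|i r IH].
  by rewrite (_ : (fun z => _) = fun=> 1); [exact: csmooth_cst|apply/funext => z; rewrite big_nil].
rewrite (_ : (fun z => _) = fun z => (if P i then F i z else 1) * \prod_(j <- r | P j) F j z).
  by apply: csmoothM => //; case: (P i) => //; exact: csmooth_cst.
by apply/funext => z; rewrite big_cons; case: (P i) => //; rewrite mul1r.
Qed.

Lemma csmooth_sum (I : Type) (r : seq I) (F : I -> Cn -> C) :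
  (forall i, csmooth (F i)) -> csmooth (fun z => \sum_(i <- r) F i z).
Proof.
move=> sF; elim: r => [|i r IH].
  by rewrite (_ : (fun z => _) = fun=> 0); [exact: csmooth_cst|apply/funext => z; rewrite big_nil].
rewrite (_ : (fun z => _) = fun z => F i z + \sum_(j <- r) F j z); first exact: csmoothD.
by apply/funext => z; rewrite big_cons.
Qed.

Lemma partialD k phi psi z : csmooth phi -> csmooth psi ->
  partial k (fun y => phi y + psi y) z = partial k phi z + partial k psi z.
Proof.
move=> [s1 s2] [t1 t2]; rewrite !partialE; apply: complex_eqP => /=; rewrite -rpartialD//.
  by apply: (congr1 (fun g => rpartial k g z)); apply/funext => y /=; rewrite Re_D.
by apply: (congr1 (fun g => rpartial k g z)); apply/funext => y /=; rewrite Im_D.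
Qed.

Lemma partialM k phi psi z : csmooth phi -> csmooth psi ->
  partial k (fun y => phi y * psi y) z = phi z * partial k psi z + psi z * partial k phi z.
Proof.
move=> [s1 s2] [t1 t2]; rewrite !partialE; apply: complex_eqP.
  rewrite Re_D !Re_M /= (_ : _ \o _ = fun z => Re (phi z) * Re (psi z) - Im (phi z) * Im (psi z)); last first.
    by apply/funext => y /=; rewrite Re_M.
  rewrite rpartialB ?rpartialM//=; try exact: rsmoothM.
  by ring.
rewrite Im_D !Im_M /= (_ : _ \o _ = fun z => Re (phi z) * Im (psi z) + Re (psi z) * Im (phi z)); last first.
  by apply/funext => y /=; rewrite Im_M.
rewrite rpartialD ?rpartialM//=; try exact: rsmoothM.
by ring.
Qed.

Lemma partial_cst k (c : C) z : partial k (fun=> c) z = 0.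
Proof. by rewrite partialE; apply: complex_eqP; rewrite /= rpartial_cst. Qed.

Lemma partial_real k (f : Cn -> R) z : partial k (fun y => (f y)%:C) z = (rpartial k f z)%:C.
Proof. by rewrite partialE; apply: complex_eqP => //=; rewrite rpartial_cst. Qed.

#[local] Opaque partial.

(** The derivative in conj(z_j) for e = 1 and in z_j for e = -1, so that both share their product
  rule *)
Definition wirtinger (e : C) (j : 'I_n) phi z : C :=
  (partial (inl j) phi z + e * 'i * partial (inr j) phi z) / 2.

Lemma dbarE j phi : dbar j phi = wirtinger 1 j phi.
Proof. by apply/funext => z; rewrite /dbar /wirtinger mul1r. Qed.

Lemma wirtingerM e j phi psi z : csmooth phi -> csmooth psi ->
  wirtinger e j (fun y => phi y * psi y) z = phi z * wirtinger e j psi z + psi z * wirtinger e j phi z.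
Proof.
move=> sp sq; rewrite /wirtinger !partialM//.
move: (e * 'i) (partial _ psi z) (partial _ phi z) (partial _ psi z) (partial _ phi z) (phi z) (psi z).
by move=> a b c d f g h; ring.
Qed.

Lemma wirtinger_cst e j (c : C) z : wirtinger e j (fun=> c) z = 0.
Proof. by rewrite /wirtinger !partial_cst mulr0 addr0 mul0r. Qed.

Lemma wirtingerX e j phi m z : csmooth phi ->
  wirtinger e j (fun y => phi y ^+ m.+1) z = m.+1%:R * phi z ^+ m * wirtinger e j phi z.
Proof.
move=> sp; elim: m => [|m IH]; first by rewrite expr0 !mul1r.
rewrite (_ : (fun y => _) = fun y => phi y * phi y ^+ m.+1); last by apply/funext => y; rewrite exprS.
rewrite wirtingerM//; last exact: csmoothX.
by rewrite IH -[m.+2%:R]natr1 !exprS; ring.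
Qed.

Lemma csmooth_wirtinger e j phi : csmooth phi -> csmooth (wirtinger e j phi).
Proof.
move=> sp; rewrite /wirtinger.
rewrite (_ : (fun z => _) = fun z => 2^-1 * (partial (inl j) phi z + e * 'i * partial (inr j) phi z)); last first.
  by apply/funext => z; rewrite mulrC.
apply: csmoothZ; apply: csmoothD; first exact: csmooth_partial.
by apply: csmoothZ; exact: csmooth_partial.
Qed.

Lemma wirtinger_prod e j (I : eqType) (r : seq I) (F : I -> Cn -> C) z :
  (forall i, csmooth (F i)) -> (forall i, wirtinger e j (F i) z = 0) ->
  wirtinger e j (fun y => \prod_(i <- r) F i y) z = 0.
Proof.
move=> sF F0; elim: r => [|i r IH].
  rewrite (_ : (fun y => _) = fun=> 1); first exact: wirtinger_cst.
  by apply/funext => y; rewrite big_nil.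
rewrite (_ : (fun y => _) = fun y => F i y * \prod_(j <- r) F j y); last first.
  by apply/funext => y; rewrite big_cons.
by rewrite wirtingerM//; [rewrite IH F0 !mulr0 addr0|exact: csmooth_prod].
Qed.

(** * Functions of one complex coordinate *)

Definition wcoord (p : Cn) (j : 'I_n) z : C := z 0 j - p 0 j.
Definition wconj (p : Cn) (j : 'I_n) z : C := (wcoord p j z)^*%C.
Definition sqdist (p : Cn) (j : 'I_n) z : R :=
  (xcoord (inl j) z - xcoord (inl j) p) ^+ 2 + (xcoord (inr j) z - xcoord (inr j) p) ^+ 2.
Definition radial (p : Cn) (h : R -> R) (j : 'I_n) z : C := (h (sqdist p j z))%:C.

Lemma wcoordE p j z : wcoord p j z =
  (xcoord (inl j) z - xcoord (inl j) p) +i* (xcoord (inr j) z - xcoord (inr j) p).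
Proof. by rewrite /wcoord /=; case: (z 0 j) (p 0 j) => [a b] [c d]. Qed.

Lemma wconjE p j z : wconj p j z =
  (xcoord (inl j) z - xcoord (inl j) p) -i* (xcoord (inr j) z - xcoord (inr j) p).
Proof. by rewrite /wconj wcoordE. Qed.

Lemma wcoord_wconj p j z : wcoord p j z * wconj p j z = (sqdist p j z)%:C.
Proof. by rewrite wcoordE wconjE /sqdist; apply: complex_eqP; rewrite /=; ring. Qed.

Lemma rsmooth_shift k (c : R) : rsmooth (fun z : Cn => xcoord k z - c).
Proof. by apply: rsmoothB; [exact: rsmooth_xcoord|exact: rsmooth_cst]. Qed.

Lemma csmooth_wcoord p j : csmooth (wcoord p j).
Proof.
rewrite (_ : wcoord p j = fun z => (xcoord (inl j) z - xcoord (inl j) p)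
   +i* (xcoord (inr j) z - xcoord (inr j) p)); last by apply/funext => z; rewrite wcoordE.
by split; exact: rsmooth_shift.
Qed.

Lemma csmooth_wconj p j : csmooth (wconj p j).
Proof.
rewrite (_ : wconj p j = fun z => (xcoord (inl j) z - xcoord (inl j) p)
   +i* - (xcoord (inr j) z - xcoord (inr j) p)); last by apply/funext => z; rewrite wconjE.
by split; [exact: rsmooth_shift|apply: rsmoothN; exact: rsmooth_shift].
Qed.

Lemma rsmooth_sqdist p j : rsmooth (sqdist p j).
Proof.
by apply: rsmoothD; apply: (rsmoothM (rsmooth_shift _ _) (rsmooth_shift _ _)).
Qed.

Lemma csmooth_radial p h j : smooth1 h -> csmooth (radial p h j).
Proof. by move=> sh; apply: csmooth_real; apply: rsmooth_comp => //; exact: rsmooth_sqdist. Qed.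

Lemma rpartial_shift k l (c : R) z : rpartial k (fun y : Cn => xcoord l y - c) z = (k == l)%:R.
Proof.
by rewrite rpartialB ?rpartial_cst ?rpartial_xcoord ?subr0//; [exact: rsmooth_xcoord|exact: rsmooth_cst].
Qed.

Lemma partial_wcoord k p j z : partial k (wcoord p j) z = (k == inl j)%:R +i* (k == inr j)%:R.
Proof.
rewrite (_ : wcoord p j = fun z => (xcoord (inl j) z - xcoord (inl j) p)
   +i* (xcoord (inr j) z - xcoord (inr j) p)); last by apply/funext => y; rewrite wcoordE.
by rewrite partialE; apply: complex_eqP; exact: rpartial_shift.
Qed.

Lemma partial_wconj k p j z : partial k (wconj p j) z = (k == inl j)%:R -i* (k == inr j)%:R.
Proof.
rewrite (_ : wconj p j = fun z => (xcoord (inl j) z - xcoord (inl j) p)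
   +i* - (xcoord (inr j) z - xcoord (inr j) p)); last by apply/funext => y; rewrite wconjE.
rewrite partialE; apply: complex_eqP; first exact: rpartial_shift.
rewrite -[LHS]/(rpartial k (fun y => - (xcoord (inr j) y - xcoord (inr j) p)) z).
by rewrite rpartialN ?rpartial_shift//; exact: rsmooth_shift.
Qed.

Lemma partial_radial k p h j z : smooth1 h -> partial k (radial p h j) z =
  (derive1 h (sqdist p j z) * (2 * ((k == inl j)%:R * (xcoord (inl j) z - xcoord (inl j) p) +
     (k == inr j)%:R * (xcoord (inr j) z - xcoord (inr j) p))))%:C.
Proof.
move=> sh; rewrite partial_real rpartial_comp//; last exact: rsmooth_sqdist.
congr ((_ * _)%:C); rewrite /sqdist.
rewrite (_ : (fun y => _) = fun y =>
   (xcoord (inl j) y - xcoord (inl j) p) * (xcoord (inl j) y - xcoord (inl j) p) +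
   (xcoord (inr j) y - xcoord (inr j) p) * (xcoord (inr j) y - xcoord (inr j) p))//.
rewrite rpartialD ?rpartialM ?rpartial_shift; try exact: rsmooth_shift; try (apply: rsmoothM; exact: rsmooth_shift).
by ring.
Qed.

Lemma inl_eqE (i j : 'I_n) : (inl i == inl j :> dir) = (i == j). Proof. by []. Qed.
Lemma inr_eqE (i j : 'I_n) : (inr i == inr j :> dir) = (i == j). Proof. by []. Qed.

Lemma dbar_wcoord i p j z : wirtinger 1 i (wcoord p j) z = 0.
Proof.
rewrite /wirtinger !partial_wcoord !inl_eqE !inr_eqE /= mul1r.
by case: (i == j); apply: complex_eqP; rewrite ?Re_M ?Im_M /=; ring.
Qed.

Lemma dbar_wconj i p j z : wirtinger 1 i (wconj p j) z = (i == j)%:R.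
Proof.
rewrite /wirtinger !partial_wconj !inl_eqE !inr_eqE /= mul1r.
case: (i == j); last by apply: complex_eqP; rewrite ?Re_M ?Im_M /=; ring.
rewrite (_ : _ + _ = 2); first by rewrite divff// pnatr_eq0.
by apply: complex_eqP; rewrite ?Re_D ?Im_D ?Re_M ?Im_M /=; ring.
Qed.

Lemma d_wconj i p j z : wirtinger (-1) i (wconj p j) z = 0.
Proof.
rewrite /wirtinger !partial_wconj !inl_eqE !inr_eqE /=.
by case: (i == j); apply: complex_eqP; rewrite ?Re_M ?Im_M /=; ring.
Qed.

Lemma divc2 (x y : C) : x = 2 * y -> x / 2 = y.
Proof. by move=> ->; rewrite mulrAC mulfV ?mul1r// pnatr_eq0. Qed.

Lemma dbar_radial i p h j z : smooth1 h ->
  wirtinger 1 i (radial p h j) z = (i == j)%:R * (wcoord p j z * radial p (derive1 h) j z).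
Proof.
move=> sh; rewrite /wirtinger !partial_radial// !inl_eqE !inr_eqE /= mul1r wcoordE /radial.
set a := _ - _; set b := xcoord (inr j) z - _; set c := derive1 _ _.
by apply: divc2; case: (i == j); apply: complex_eqP; rewrite ?Re_D ?Im_D ?Re_M ?Im_M /=; ring.
Qed.

Lemma d_radial i p h j z : smooth1 h ->
  wirtinger (-1) i (radial p h j) z = (i == j)%:R * (wconj p j z * radial p (derive1 h) j z).
Proof.
move=> sh; rewrite /wirtinger !partial_radial// !inl_eqE !inr_eqE /= mulN1r wconjE /radial.
set a := _ - _; set b := xcoord (inr j) z - _; set c := derive1 _ _.
by apply: divc2; case: (i == j); apply: complex_eqP; rewrite ?Re_D ?Im_D ?Re_M ?Im_M /=; ring.
Qed.

End complex_smooth.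

(** * Weighted C^N norms *)

Section seminorms.
Context {R : realType} {n : nat}.
Local Notation C := R[i].
Local Notation normc := (@Normc.normc R).
Local Notation Cn := 'rV[R[i]]_n.
Local Notation dir := ('I_n + 'I_n)%type.
Local Open Scope complex_scope.
Implicit Types (phi psi f : Cn -> C) (z p : Cn) (k l : dir) (s : seq dir) (D : set Cn).

#[local] Opaque partial rpartial.

Lemma normc_ge0 (x : C) : 0 <= normc x.
Proof. by case: x => a b; exact: sqrtr_ge0. Qed.

Lemma normc_prod (I : Type) (r : seq I) (F : I -> C) :
  normc (\prod_(i <- r) F i) = \prod_(i <- r) normc (F i).
Proof.
elim: r => [|i r IH]; first by rewrite !big_nil Normc.normc1.
by rewrite !big_cons Normc.normcM IH.
Qed.

Lemma normcX (x : C) m : normc (x ^+ m) = normc x ^+ m.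
Proof. by elim: m => [|m IH]; [rewrite Normc.normc1|rewrite !exprS Normc.normcM IH]. Qed.

Lemma normc_real (x : R) : normc x%:C = `|x|.
Proof. by rewrite /= expr0n addr0 sqrtr_sqr. Qed.

(** A C^N norm with weight lam on each derivative. The recursion, rather than a supremum over words,
  makes it submultiplicative with constant 1, which is what allows high powers. *)
Fixpoint bounded_derivs (lam : R) D (N : nat) phi (B : R) : Prop :=
  match N with
  | 0 => 0 <= B /\ forall z, D z -> normc (phi z) <= B
  | N'.+1 => exists b0 (b : dir -> R), [/\ bounded_derivs lam D N' phi b0,
      forall k, bounded_derivs lam D N' (partial k phi) (b k) & b0 + lam * \sum_k b k <= B]
  end.

Lemma bounded_derivs_ge0 lam D N phi B : 0 <= lam -> bounded_derivs lam D N phi B -> 0 <= B.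
Proof.
move=> lam0; elim: N phi B => [|N IH] phi B /=; first by case.
move=> [b0 [b [H0 Hb]]]; apply: le_trans; apply: addr_ge0; first exact: IH H0.
by apply: mulr_ge0 => //; apply: sumr_ge0 => k _; exact: IH (Hb k).
Qed.

Lemma partial_eqD k phi psi : csmooth phi -> csmooth psi ->
  partial k (fun y => phi y + psi y) = fun z => partial k phi z + partial k psi z.
Proof. by move=> sp sq; apply/funext => z; rewrite partialD. Qed.

Lemma partial_eqM k phi psi : csmooth phi -> csmooth psi ->
  partial k (fun y => phi y * psi y) = fun z => phi z * partial k psi z + psi z * partial k phi z.
Proof. by move=> sp sq; apply/funext => z; rewrite partialM. Qed.

Lemma bounded_derivsD lam D N phi psi a b : csmooth phi -> csmooth psi ->
  bounded_derivs lam D N phi a -> bounded_derivs lam D N psi b ->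
  bounded_derivs lam D N (fun z => phi z + psi z) (a + b).
Proof.
elim: N phi psi a b => [|N IH] phi psi a b sp sq /=.
  move=> [a0 Ha] [b0 Hb]; split=> [|z Dz]; first exact: addr_ge0.
  by apply: le_trans (le_normcD _ _) _; apply: lerD; [exact: Ha|exact: Hb].
move=> [a0 [a' [Ha0 Ha' Ha]]] [b0 [b' [Hb0 Hb' Hb]]].
exists (a0 + b0), (fun k => a' k + b' k); split; first exact: IH.
  move=> k; rewrite partial_eqD//; apply: IH => //; exact: csmooth_partial.
by rewrite big_split mulrDr addrACA lerD.
Qed.

Lemma bounded_derivsM lam D N phi psi a b : 0 <= lam -> csmooth phi -> csmooth psi ->
  bounded_derivs lam D N phi a -> bounded_derivs lam D N psi b ->
  bounded_derivs lam D N (fun z => phi z * psi z) (a * b).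
Proof.
move=> lam0; elim: N phi psi a b => [|N IH] phi psi a b sp sq /=.
  move=> [a0 Ha] [b0 Hb]; split=> [|z Dz]; first exact: mulr_ge0.
  by rewrite Normc.normcM; apply: ler_pM; rewrite ?normc_ge0//; [exact: Ha|exact: Hb].
move=> [a0 [a' [Ha0 Ha' Ha]]] [b0 [b' [Hb0 Hb' Hb]]].
exists (a0 * b0), (fun k => a0 * b' k + b0 * a' k); split; first exact: IH.
  move=> k; rewrite partial_eqM//.
  apply: bounded_derivsD; try (apply: csmoothM => //; exact: csmooth_partial).
    by apply: IH => //; exact: csmooth_partial.
  by apply: IH => //; exact: csmooth_partial.
have a00 := bounded_derivs_ge0 lam0 Ha0; have b00 := bounded_derivs_ge0 lam0 Hb0.
have sa0 : 0 <= lam * \sum_k a' k.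
  by apply: mulr_ge0 => //; apply: sumr_ge0 => k _; exact: bounded_derivs_ge0 (Ha' k).
have sb0 : 0 <= lam * \sum_k b' k.
  by apply: mulr_ge0 => //; apply: sumr_ge0 => k _; exact: bounded_derivs_ge0 (Hb' k).
apply: (@le_trans _ _ ((a0 + lam * \sum_k a' k) * (b0 + lam * \sum_k b' k))); last first.
  by apply: ler_pM => //; exact: addr_ge0.
rewrite big_split -!mulr_sumr /=.
move: (\sum_k a' k) (\sum_k b' k) sa0 sb0 => u v sa0 sb0.
have H := mulr_ge0 sa0 sb0; rewrite -subr_ge0.
by rewrite (_ : _ - _ = lam * u * (lam * v))//; ring.
Qed.

Lemma bounded_derivs_cst lam D N (c : C) : bounded_derivs lam D N (fun=> c) (normc c).
Proof.
elim: N c => [|N IH] c /=; first by split=> //; exact: normc_ge0.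
exists (normc c), (fun=> 0); split => //.
  move=> k; rewrite (_ : partial k _ = fun=> 0); last by apply/funext => z; rewrite partial_cst.
  by rewrite -(Normc.normc0 R).
by rewrite big1 ?mulr0 ?addr0.
Qed.

Lemma bounded_derivs1 lam D N : bounded_derivs lam D N (fun=> 1) 1.
Proof. by have := bounded_derivs_cst lam D N 1; rewrite Normc.normc1. Qed.

Lemma bounded_derivsX lam D N phi a m : 0 <= lam -> csmooth phi ->
  bounded_derivs lam D N phi a ->
  bounded_derivs lam D N (fun z => phi z ^+ m) (a ^+ m).
Proof.
move=> lam0 sp H; elim: m => [|m IH]; first exact: bounded_derivs1.
rewrite (_ : (fun z => _) = fun z => phi z * phi z ^+ m); last by apply/funext => z; rewrite exprS.
by rewrite exprS; apply: bounded_derivsM => //; exact: csmoothX.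
Qed.

Lemma bounded_derivs_prod lam D N (I : Type) (r : seq I) (F : I -> Cn -> C) (a : I -> R) : 0 <= lam ->
  (forall i, csmooth (F i)) -> (forall i, bounded_derivs lam D N (F i) (a i)) ->
  bounded_derivs lam D N (fun z => \prod_(i <- r) F i z) (\prod_(i <- r) a i).
Proof.
move=> lam0 sF HF; elim: r => [|i r IH].
  rewrite big_nil (_ : (fun z => _) = fun=> 1); last by apply/funext => z; rewrite big_nil.
  exact: bounded_derivs1.
rewrite big_cons (_ : (fun z => _) = fun z => F i z * \prod_(j <- r) F j z); last first.
  by apply/funext => z; rewrite big_cons.
by apply: bounded_derivsM => //; exact: csmooth_prod.
Qed.

Lemma bounded_derivs_partials lam D N phi B s z : 0 < lam -> lam <= 1 ->
  bounded_derivs lam D N phi B -> (size s <= N)%N -> D z ->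
  lam ^+ N * normc (partials s phi z) <= B.
Proof.
move=> lam0 lam1; elim: N phi B s => [|N IH] phi B s /=.
  by move=> [B0 H]; rewrite leqn0 size_eq0 => /eqP -> Dz; rewrite expr0 mul1r; exact: H.
move=> [b0 [b [H0 Hb HB]]]; case/lastP: s => [|s k] Hs Dz.
  have b00 := bounded_derivs_ge0 (ltW lam0) H0.
  have /= H := IH _ _ [::] H0 isT Dz.
  rewrite exprS -mulrA (@le_trans _ _ (1 * b0))//.
    by apply: ler_pM => //; rewrite ?(ltW lam0)// mulr_ge0 ?exprn_ge0 ?normc_ge0// ltW.
  rewrite mul1r; apply: le_trans HB; rewrite lerDl; apply: mulr_ge0; first exact: ltW.
  by apply: sumr_ge0 => k _; exact: bounded_derivs_ge0 (ltW lam0) (Hb k).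
rewrite size_rcons ltnS in Hs; have H := IH _ _ s (Hb k) Hs Dz.
rewrite partials_rcons exprS -mulrA; apply: le_trans HB.
have bk m := bounded_derivs_ge0 (ltW lam0) (Hb m).
apply: (@le_trans _ _ (lam * b k)); first by rewrite ler_pM2l.
rewrite -[leLHS]add0r; apply: lerD; first exact: bounded_derivs_ge0 (ltW lam0) H0.
by rewrite ler_pM2l// (bigD1 k)//= lerDl; exact: sumr_ge0.
Qed.

(** Each level of the recursion adds one bound for each direction. *)
Lemma bounded_derivs_of_partials D N phi (e : R) :
  (forall s, (size s <= N)%N -> forall z, D z -> normc (partials s phi z) <= e) -> 0 <= e ->
  bounded_derivs 1 D N phi ((1 + #|{: dir}|%:R) ^+ N * e).
Proof.
elim: N phi => [|N IH] phi H e0 /=.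
  by rewrite expr0 mul1r; split => // z Dz; exact: (H [::]).
exists ((1 + #|{: dir}|%:R) ^+ N * e), (fun=> (1 + #|{: dir}|%:R) ^+ N * e); split.
- by apply: IH => // s sN; apply: H; exact: leqW.
- move=> k; apply: IH => // s sN z Dz; rewrite -partials_rcons; apply: H => //.
  by rewrite size_rcons.
- rewrite (_ : \sum_k _ = #|{: dir}|%:R * ((1 + #|{: dir}|%:R) ^+ N * e)); last first.
    by rewrite sumr_const mulr_natl.
  by rewrite mul1r exprS -mulrA [leRHS]mulrDl mul1r.
Qed.

Lemma csmooth_bounded p (A : R) phi : csmooth phi ->
  exists2 B, 0 <= B & forall z, cbox p A z -> normc (phi z) <= B.
Proof.
move=> [sR sI].
have [B1 B10 H1] := rsmooth_bounded_cbox p A sR; have [B2 B20 H2] := rsmooth_bounded_cbox p A sI.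
exists (B1 + B2); first exact: addr_ge0.
move=> z Hz; apply: le_trans (normc_le_abs _) _; apply: lerD; [exact: H1|exact: H2].
Qed.

(** The weighted norm tends to the sup norm as lam tends to 0; hence powers of phi grow in C^N at a
  rate arbitrarily close to their rate in the sup norm. *)
Lemma bounded_derivs_small p (A : R) N phi (c c' : R) : csmooth phi -> 0 <= c -> c < c' ->
  (forall z, cbox p A z -> normc (phi z) <= c) ->
  exists2 lam0, 0 < lam0 & forall lam, 0 < lam -> lam <= lam0 ->
    bounded_derivs lam (cbox p A) N phi c'.
Proof.
elim: N phi c c' => [|N IH] phi c c' sp c0 cc' H.
  by exists 1 => // lam _ _; split=> [|z Hz]; [exact: ltW (le_lt_trans c0 cc')|exact: le_trans (H z Hz) (ltW cc')].
have cm : c < (c + c') / 2 by lra.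
have [l0 l00 Hl0] := IH phi c _ sp c0 cm H.
have /choice[b Hb] : forall k, exists b, 0 <= b /\ exists2 lam0, 0 < lam0 &
    forall lam, 0 < lam -> lam <= lam0 -> bounded_derivs lam (cbox p A) N (partial k phi) b.
  move=> k; have [B B0 HB] := csmooth_bounded p A (csmooth_partial k sp).
  have B1 : B < B + 1 by rewrite ltrDl.
  exists (B + 1); split; first by rewrite addr_ge0.
  exact: IH (csmooth_partial k sp) B0 B1 HB.
have /choice[l Hl] : forall k, exists lam0, 0 < lam0 /\
    forall lam, 0 < lam -> lam <= lam0 -> bounded_derivs lam (cbox p A) N (partial k phi) (b k).
  by move=> k; have [_ [lam0 ? ?]] := Hb k; exists lam0.
pose S := \sum_k b k.
have S0 : 0 <= S by apply: sumr_ge0 => k _; have [] := Hb k.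
have S1 : 0 < S + 1 by rewrite ltr_wpDl.
have e0 : 0 < (c' - c) / 2 / (S + 1) by apply: divr_gt0 => //; lra.
exists (Num.min l0 (Num.min ((c' - c) / 2 / (S + 1)) (\big[Num.min/1]_k l k))).
  rewrite !lt_min l00 e0 /=; apply/bigmin_gtP; split => // k _; by have [] := Hl k.
move=> lam lam0; rewrite !le_min => /and3P[H1 H2 H3].
exists ((c + c') / 2), b; split; first exact: Hl0.
  move=> k; have [_] := Hl k; apply => //; apply: le_trans H3 _; exact: bigmin_le.
rewrite -/S; move: H2; rewrite ler_pdivlMr// mulrDr mulr1 => H2; lra.
Qed.

Lemma bounded_derivs_exists lam p (A : R) N phi : csmooth phi ->
  exists B, bounded_derivs lam (cbox p A) N phi B.
Proof.
elim: N phi => [|N IH] phi sp; first by have [B B0 HB] := csmooth_bounded p A sp; exists B.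
have [b0 H0] := IH phi sp.
have /choice[b Hb] : forall k, exists b, bounded_derivs lam (cbox p A) N (partial k phi) b.
  by move=> k; apply: IH; exact: csmooth_partial.
by exists (b0 + lam * \sum_k b k), b0, b.
Qed.

Lemma CN_norm_le N phi (B : R) :
  (forall s z, (size s <= N)%N -> normc (partials s phi z) <= B) -> CN_norm N phi <= B.
Proof.
move=> H; apply: ge_sup.
  by exists (normc (partials [::] phi 0)), [::], 0.
by move=> _ [s [z [sN ->]]]; exact: H.
Qed.

Lemma partials_vanish p (A : R) phi : (forall z, ~ cbox p A z -> phi z = 0) ->
  forall s z, ~ cbox p A z -> partials s phi z = 0.
Proof.
move=> H s z Hz; rewrite partialsE.
by apply: complex_eqP; apply: (rpartials_vanish s _ Hz) => y /H /= ->.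
Qed.

Lemma CN_norm_bounded_derivs lam p (A : R) N phi B : 0 < lam -> lam <= 1 ->
  (forall z, ~ cbox p A z -> phi z = 0) -> bounded_derivs lam (cbox p A) N phi B ->
  CN_norm N phi <= B / lam ^+ N.
Proof.
move=> lam0 lam1 phi0 HB; apply: CN_norm_le => s z sN.
rewrite ler_pdivlMr ?exprn_gt0// mulrC.
have [Hz|Hz] := pselect (cbox p A z); first exact: bounded_derivs_partials HB sN Hz.
rewrite (partials_vanish phi0)// Normc.normc0 mulr0.
exact: bounded_derivs_ge0 (ltW lam0) HB.
Qed.

(** * Test functions supported in boxes *)

Lemma test_function_cbox (Omega : set Cn) p (A : R) phi : csmooth phi ->
  (forall z, ~ cbox p A z -> phi z = 0) -> cbox p A `<=` Omega ->
  test_function Omega phi /\ tsupport phi `<=` cbox p A.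
Proof.
move=> sp H AO.
have sub : tsupport phi `<=` cbox p A.
  rewrite [X in _ `<=` X](_ : _ = closure (cbox p A)); last exact/closure_id/closed_cbox.
  apply: closure_subset => z /=; apply: contraPP => /H ->; by rewrite eqxx.
split => //; split; [exact/csmoothP| |exact: subset_trans AO].
by apply: (subclosed_compact _ _ sub); [exact: closed_closure|exact: compact_cbox].
Qed.

Lemma test_functionM (Omega : set Cn) phi psi : test_function Omega phi -> csmooth psi ->
  test_function Omega (fun z => phi z * psi z).
Proof.
move=> [/csmoothP sp cp pO] sq.
have sub : tsupport (fun z => phi z * psi z) `<=` tsupport phi.
  apply: closure_subset => z /=; apply: contraNN => /eqP ->; by rewrite mul0r.
split; [by apply/csmoothP; exact: csmoothM| |exact: subset_trans pO].
by apply: (subclosed_compact _ cp sub); exact: closed_closure.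
Qed.

Lemma test_function0 (Omega : set Cn) : test_function Omega (fun=> 0).
Proof.
have E : tsupport (fun=> 0 : C) = set0 :> set Cn.
  rewrite /tsupport (_ : [set z | _] = set0) ?closure0//.
  by apply/seteqP; split => // z /=; rewrite eqxx.
split; [apply/csmoothP; exact: csmooth_cst|rewrite E; exact: compact0|by rewrite E].
Qed.

End seminorms.

(** * Volume of boxes and integration along coordinate lines *)

Section tuple_boxes.
Context {R : realType}.
Local Notation plane := (measurableTypeR R * measurableTypeR R)%type.
Local Notation lambda := (@lebesgue_measure R).
Local Notation lambda2 := (sf_product lambda lambda).
Local Notation vol n := (@volume R n).

Definition rect (q : plane) (A : R) : set plane :=
  `[q.1 - A, q.1 + A]%classic `*` `[q.2 - A, q.2 + A]%classic.

Lemma measurable_rect q A : measurable (rect q A).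
Proof. by apply: measurableX; exact: measurable_itv. Qed.

Lemma rect_area q A : 0 < A -> lambda2 (rect q A) = ((2 * A) * (2 * A))%:E.
Proof.
move=> A0; rewrite /sf_product product_measure1E; [|exact: measurable_itv..].
have E (a : R) : lambda `[a - A, a + A]%classic = (2 * A)%:E.
  rewrite lebesgue_measure_itv /= lte_fin ltrBlDr -addrA ltrDl addr_gt0//.
  by rewrite -EFinB; congr EFin; ring.
by rewrite [X in (X * _)%E](E q.1) [X in (_ * X)%E](E q.2) EFinM.
Qed.

Definition tbox n (q : n.-tuple plane) (A : R) : set (n.-tuple plane) :=
  [set t | forall j, rect (tnth q j) A (tnth t j)].

Lemma measurable_tbox n q A : measurable (@tbox n q A).
Proof.
have -> : tbox q A = \bigcap_(j in [set: 'I_n]) ((@tnth n plane)^~ j @^-1` rect (tnth q j) A).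
  by apply/seteqP; split => [t Ht j _|t Ht j]; [exact: Ht|exact: (Ht j)].
apply: fin_bigcap_measurable => // j _; rewrite -[X in measurable X]setTI.
exact: (@measurable_tnth _ plane n j measurableT _ (measurable_rect _ _)).
Qed.

Lemma tnth_cons0 n T (x : T) (t : n.-tuple T) : tnth [the n.+1.-tuple T of x :: t] ord0 = x.
Proof. by []. Qed.

Lemma tnth_consS n T (x : T) (t : n.-tuple T) j :
  tnth [the n.+1.-tuple T of x :: t] (lift ord0 j) = tnth t j.
Proof. by rewrite !(tnth_nth x). Qed.

Lemma tbox_consP n (q0 : plane) (q : n.-tuple plane) A (x : plane) (t : n.-tuple plane) :
  tbox [the n.+1.-tuple plane of q0 :: q] A [the n.+1.-tuple plane of x :: t] <->
  rect q0 A x /\ tbox q A t.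
Proof.
split=> [H|[H0 H] j].
  by split=> [|j]; [exact: (H ord0)|have := H (lift ord0 j); rewrite !tnth_consS].
by case: (unliftP ord0 j) => [k ->|->]; [rewrite !tnth_consS|rewrite !tnth_cons0].
Qed.

Lemma tbox_volume n (q : n.-tuple plane) A : 0 < A ->
  vol n (tbox q A) = (((2 * A) * (2 * A)) ^+ n)%:E.
Proof.
move=> A0; elim: n q => [|n IH] q.
  rewrite /volume /= /dirac indicE mem_set//=.
  by move=> [].
rewrite (tuple_eta q) -[LHS]/(sf_product lambda2 (vol n)
  ((fun x : plane * n.-tuple plane => [the n.+1.-tuple plane of x.1 :: x.2]) @^-1` _)).
rewrite (_ : _ @^-1` _ = rect (thead q) A `*` tbox [tuple of behead q] A); last first.
  apply/seteqP; split => -[x t] H; first exact: (tbox_consP (thead q) (behead_tuple q) A x t).1 H.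
  exact: (tbox_consP (thead q) (behead_tuple q) A x t).2 H.
rewrite [LHS]/sf_product product_measure1E; [|exact: measurable_rect|exact: measurable_tbox].
apply: etrans (congr2 mule (rect_area (thead q) A0) (IH [tuple of behead q])) _.
by rewrite -EFinM exprS.
Qed.

Definition bounded_supp d (T : measurableType d) (S : set T) (g : T -> R) : Prop :=
  [/\ measurable_fun setT g, exists M, forall t, `|g t| <= M & forall t, ~ S t -> g t = 0].

Lemma integrable_bounded_supp d (T : measurableType d) (mu : {measure set T -> \bar R}) (S : set T) g :
  measurable S -> (mu S < +oo)%E -> bounded_supp S g -> mu.-integrable setT (EFin \o g).
Proof.
move=> mS fS [mg [M HM] g0].
have -> : EFin \o g = (EFin \o g) \_ S.
  apply/funext => t; rewrite patchE; case: ifPn => // /negP; rewrite inE => /g0 /=.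
  by move=> ->.
apply/(integrable_mkcond _ mS); apply: measurable_bounded_integrable => //.
  exact: measurable_funTS.
exists M; split; first exact: num_real.
by move=> x Mx t _ /=; exact: le_trans (HM t) (ltW Mx).
Qed.

Lemma bounded_supp_cons_slice n (q0 : plane) (q : n.-tuple plane) A g (x : plane) :
  bounded_supp (tbox [the n.+1.-tuple plane of q0 :: q] A) g ->
  bounded_supp (tbox q A) (fun t => g [the n.+1.-tuple plane of x :: t]).
Proof.
move=> [mg [M HM] g0]; split; last 2 first.
- by exists M => t; exact: HM.
- by move=> t Ht; apply: g0 => /tbox_consP[].
apply: measurableT_comp => //; apply: measurable_cons; first exact: measurable_cst.
exact: measurable_id.
Qed.

Lemma bounded_supp_cons_slice_l n (q0 : plane) (q : n.-tuple plane) A g (t : n.-tuple plane) :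
  bounded_supp (tbox [the n.+1.-tuple plane of q0 :: q] A) g ->
  bounded_supp (rect q0 A) (fun x => g [the n.+1.-tuple plane of x :: t]).
Proof.
move=> [mg [M HM] g0]; split; last 2 first.
- by exists M => x; exact: HM.
- by move=> x Hx; apply: g0 => /tbox_consP[].
apply: measurableT_comp => //; apply: measurable_cons; first exact: measurable_id.
exact: measurable_cst.
Qed.

Definition set_pair (b : bool) (v : R) (x : plane) : plane := if b then (v, x.2) else (x.1, v).

Definition set_tuple n (b : bool) (j : 'I_n) (v : R) (t : n.-tuple plane) : n.-tuple plane :=
  [tuple if i == j then set_pair b v (tnth t i) else tnth t i | i < n].

Lemma set_tuple_cons0 n b v (x : plane) (t : n.-tuple plane) :
  set_tuple b ord0 v [the n.+1.-tuple plane of x :: t] = [the n.+1.-tuple plane of set_pair b v x :: t].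
Proof.
apply: eq_from_tnth => i; rewrite tnth_mktuple; case: (unliftP ord0 i) => [k ->|->].
  by rewrite !tnth_consS.
by rewrite eqxx !tnth_cons0.
Qed.

Lemma set_tuple_consS n b j v (x : plane) (t : n.-tuple plane) :
  set_tuple b (lift ord0 j) v [the n.+1.-tuple plane of x :: t] =
  [the n.+1.-tuple plane of x :: set_tuple b j v t].
Proof.
apply: eq_from_tnth => i; rewrite tnth_mktuple; case: (unliftP ord0 i) => [k ->|->].
  by rewrite !tnth_consS tnth_mktuple (inj_eq lift_inj).
by rewrite !tnth_cons0.
Qed.

Lemma integral_plane_lines0 b q A (h : plane -> R) : 0 < A -> bounded_supp (rect q A) h ->
  (forall x, (\int[lambda]_v (h (set_pair b v x))%:E = 0)%E) ->
  (\int[lambda2]_x (h x)%:E = 0)%E.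
Proof.
move=> A0 bh lines.
have ih : (lambda \x lambda)%E.-integrable setT (EFin \o h).
  apply: (@integrable_bounded_supp _ _ lambda2 (rect q A) h (measurable_rect _ _) _ bh).
  by rewrite [X in (X < _)%E](rect_area q A0) ltry.
rewrite -[LHS]/(\int[(lambda \x lambda)%E]_x (EFin \o h) x)%E.
case: b lines => lines.
  rewrite -integral21_prod_meas1//; apply: integral0_eq => y _; exact: (lines (0, y)).
rewrite -integral12_prod_meas1//; apply: integral0_eq => x _; exact: (lines (x, 0)).
Qed.

(** By Fubini, one may integrate along the lines of the given direction before the other
  coordinates; the induction peels off the pairs in front of the j-th one. *)
Lemma integral_volume_lines0 n b (j : 'I_n) (q : n.-tuple plane) A (g : n.-tuple plane -> R) :
  0 < A -> bounded_supp (tbox q A) g ->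
  (forall t, (\int[lambda]_v (g (set_tuple b j v t))%:E = 0)%E) ->
  (\int[vol n]_t (g t)%:E = 0)%E.
Proof.
move=> A0; elim: n j q g => [[]//|n IH] j q g.
have -> : q = [the n.+1.-tuple plane of thead q :: (behead_tuple q : n.-tuple plane)].
  by rewrite {1}(tuple_eta q); exact: val_inj.
move: (thead q) (behead_tuple q : n.-tuple plane) => q0 {}q bg lines.
pose c (x : plane * n.-tuple plane) := [the n.+1.-tuple plane of x.1 :: x.2].
have mc : measurable_fun setT c by exact: measurable_cons.
have mS := @measurable_tbox n.+1 [the n.+1.-tuple plane of q0 :: q] A.
have bgc : bounded_supp (c @^-1` tbox [the n.+1.-tuple plane of q0 :: q] A) (g \o c).
  have [mg [M HM] g0] := bg; split; first exact: measurableT_comp.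
    by exists M => x; exact: HM.
  by move=> x Hx; exact: g0.
have ig : (lambda2 \x vol n)%E.-integrable setT (EFin \o (g \o c)).
  apply: (@integrable_bounded_supp _ _ (sf_product lambda2 (vol n)) _ _ _ _ bgc).
    by rewrite -[X in measurable X]setTI; exact: mc.
  by rewrite -[X in (X < _)%E]/(vol n.+1 (tbox [the n.+1.-tuple plane of q0 :: q] A)) tbox_volume// ltry.
have -> : (\int[vol n.+1]_t (g t)%:E = \int[(lambda2 \x vol n)%E]_x (EFin \o (g \o c)) x)%E.
  have [mg _ _] := bg.
  rewrite -[LHS]/(\int[pushforward (sf_product lambda2 (vol n)) c]_t (g t)%:E)%E.
  exact: (@integral_pushforward _ _ _ _ R c mc (sf_product lambda2 (vol n)) setT (EFin \o g)
    ((measurable_realfun.measurable_EFinP _ _).2 mg) ig measurableT).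
case: (unliftP ord0 j) => [k jk|j0].
  rewrite -integral12_prod_meas1//; apply: integral0_eq => x _.
  apply: (IH k q (fun t => g (c (x, t)))); first exact: bounded_supp_cons_slice bg.
  by move=> t; have := lines (c (x, t)); rewrite jk; under eq_integral do rewrite set_tuple_consS.
rewrite -integral21_prod_meas1//; apply: integral0_eq => t _.
apply: (@integral_plane_lines0 b q0 A (fun x => g (c (x, t)))) => //.
  exact: bounded_supp_cons_slice_l bg.
by move=> x; have := lines (c (x, t)); rewrite j0; under eq_integral do rewrite set_tuple_cons0.
Qed.

End tuple_boxes.

(** * Integration of compactly supported functions *)

Section volume_on_Cn.
Context {R : realType} {n : nat}.
Local Notation Re := (@complex.Re R).
Local Notation Im := (@complex.Im R).
Local Notation Cn := 'rV[R[i]]_n.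
Local Notation dir := ('I_n + 'I_n)%type.
Local Notation plane := (measurableTypeR R * measurableTypeR R)%type.
Local Notation vol := (@volume R n).
Local Notation vec := (@vec_of_pairs R n).
Local Open Scope complex_scope.
Implicit Types (g : Cn -> R) (z p : Cn) (k l : dir) (t : n.-tuple plane).

#[local] Opaque rpartial partial.

Definition pairs_of z : n.-tuple plane := [tuple (Re (z 0 j), Im (z 0 j)) | j < n].

Definition dir_of (b : bool) (j : 'I_n) : dir := if b then inl j else inr j.

Lemma xcoord_vec b j t : xcoord (dir_of b j) (vec t) = if b then (tnth t j).1 else (tnth t j).2.
Proof. by case: b; rewrite /= mxE. Qed.

Lemma dirP k : exists b j, k = dir_of b j.
Proof. by case: k => j; [exists true, j|exists false, j]. Qed.

Lemma vec_cbox p A : vec @^-1` cbox p A = tbox (pairs_of p) A.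
Proof.
apply/seteqP; split => t H.
  move=> j; rewrite /rect tnth_mktuple /=.
  have := H (dir_of true j); have := H (dir_of false j); rewrite !xcoord_vec /= => H1 H2.
  by split; rewrite /= in_itv /= -ler_distl.
move=> k; have [b [j ->]] := dirP k; rewrite xcoord_vec.
have [/=] := H j; rewrite tnth_mktuple /= !in_itv /= -!ler_distl => H1 H2.
by case: b.
Qed.

Lemma vec_set_tuple b j v t : vec (set_tuple b j v t) = set_coord (dir_of b j) v (vec t).
Proof.
apply: xcoord_inj => k; have [b' [j' ->]] := dirP k; rewrite xcoord_set !xcoord_vec tnth_mktuple.
case: b b' => [] [] /=; rewrite ?inl_eqE ?inr_eqE ?[j == j']eq_sym; case: (j' == j) => //=.
Qed.

(** An open set is a countable union of boxes with rational data, and boxes are measurable in the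
  product of the planes. *)
Lemma measurable_vec_open (U : set Cn) : open U -> measurable (vec @^-1` U).
Proof.
move=> oU.
pose B (c : {ffun dir -> rat}) (r : rat) : set Cn :=
  [set z | forall k, `|xcoord k z - ratr (c k)| < ratr r].
pose I := ({ffun dir -> rat} * rat)%type.
pose F (i : I) : set (n.-tuple plane) := if `[< B i.1 i.2 `<=` U >] then vec @^-1` B i.1 i.2 else set0.
have -> : vec @^-1` U = \bigcup_(i in [set: I]) F i.
  apply/seteqP; split => t; last first.
    by move=> [i _]; rewrite /F; case: ifPn => // /asboolP H; exact: H.
  move=> Ut; have /nbhs_xcoordP[e e0 He] : nbhs (vec t) U by exact: open_nbhs_nbhs.
  have [r] := @rat_in_itvoo R (e / 4) (e / 2) ltac:(lra).
  rewrite in_itv /= => /andP[r1 r2].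
  have /choice[c Hc] : forall k, exists c : rat, `|xcoord k (vec t) - ratr c| < ratr r.
    move=> k; have [c] := @rat_in_itvoo R (xcoord k (vec t) - e / 4) (xcoord k (vec t) + e / 4) ltac:(lra).
    rewrite in_itv /= => /andP[c1 c2]; exists c; rewrite ltr_distlC; apply/andP; split; lra.
  exists ([ffun k => c k], r) => //; rewrite /F ifT; first by move=> k; rewrite /= ffunE.
  apply/asboolP => z Hz; apply: He => k.
  have := Hz k; rewrite /= ffunE => H1.
  rewrite (le_lt_trans (ler_distD (ratr (c k)) _ _))//.
  have := Hc k; rewrite [ `|_ - xcoord _ _| ]distrC => H2.
  apply: lt_le_trans (ltrD H1 H2) _; lra.
apply: (@countable_bigcupT_measurable _ _ I F); first exact: countableP.
move=> i; rewrite /F; case: ifP => // _.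
have -> : vec @^-1` B i.1 i.2 = \bigcap_(k in [set: dir])
    ((fun t => xcoord k (vec t)) @^-1` [set x | `|x - ratr (i.1 k)| < ratr i.2]).
  by apply/seteqP; split => [t H k _|t H k]; [exact: H|exact: (H k)].
apply: fin_bigcap_measurable => // k _; have [b [j ->]] := dirP k.
rewrite -[X in measurable X]setTI.
rewrite (_ : [set x | _] = `]ratr (i.1 (dir_of b j)) - ratr i.2, ratr (i.1 (dir_of b j)) + ratr i.2[%classic); last first.
  by apply/seteqP; split => x; rewrite /= in_itv /= ltr_distl.
have mk : measurable_fun setT (fun t => xcoord (dir_of b j) (vec t)).
  case: b => /=.
    rewrite (_ : (fun t => _) = fst \o (@tnth n plane)^~ j); last by apply/funext => t; rewrite mxE.
    by apply: measurableT_comp; [exact: measurable_fst|exact: measurable_tnth].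
  rewrite (_ : (fun t => _) = snd \o (@tnth n plane)^~ j); last by apply/funext => t; rewrite mxE.
  by apply: measurableT_comp; [exact: measurable_snd|exact: measurable_tnth].
exact: (mk measurableT _ (measurable_itv _)).
Qed.

Lemma measurable_vec_continuous (U : set Cn) g : open U -> (forall z, U z -> {for z, continuous g}) ->
  measurable_fun (vec @^-1` U) (g \o vec).
Proof.
move=> oU cg; apply: (measurability _ (measurable_realfun.RGenOInfty.measurableE R)).
move=> /= _ [_ [a ->]] <-.
have -> : vec @^-1` U `&` (g \o vec) @^-1` `]a, +oo[%classic = vec @^-1` (U `&` [set z | a < g z]).
  by apply/seteqP; split => t [H1 H2]; split => //; move: H2; rewrite /= in_itv /= andbT.
apply: measurable_vec_open; rewrite openE => z [Uz az].
have oz : nbhs z U by exact: open_nbhs_nbhs.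
have ga : nbhs z [set y | a < g y] by apply: (cg z Uz [set x | a < x]); exact: lt_nbhsr.
exact: filterI.
Qed.

Definition csupp p A g := continuous g /\ forall z, ~ cbox p A z -> g z = 0.

Lemma csupp_bounded_supp p A g : csupp p A g -> bounded_supp (tbox (pairs_of p) A) (g \o vec).
Proof.
move=> [cg g0]; split.
- have := @measurable_vec_continuous setT g openT (fun z _ => cg z).
  by rewrite preimage_setT.
- have [M M0 HM] := continuous_bounded_cbox p A cg; exists M => t /=.
  have [Ht|Ht] := pselect (cbox p A (vec t)); first exact: HM.
  by rewrite g0// normr0.
- by move=> t; rewrite -vec_cbox => Ht; exact: g0.
Qed.

Lemma vol_tbox_fin q A : 0 < A -> (vol (tbox q A) < +oo)%E.
Proof. by move=> A0; rewrite tbox_volume// ltry. Qed.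

Lemma csupp_integrable p A g : 0 < A -> csupp p A g -> vol.-integrable setT (EFin \o (g \o vec)).
Proof.
move=> A0 cg; apply: (@integrable_bounded_supp _ _ _ vol (tbox (pairs_of p) A)).
- exact: measurable_tbox.
- exact: vol_tbox_fin.
- exact: csupp_bounded_supp.
Qed.

Definition rint g : R := Rintegral vol setT (g \o vec).

Lemma rintD p A g h : 0 < A -> csupp p A g -> csupp p A h -> rint (fun z => g z + h z) = rint g + rint h.
Proof. by move=> A0 cg ch; apply: RintegralD => //; [exact: (csupp_integrable A0 cg)|exact: (csupp_integrable A0 ch)]. Qed.

Lemma rintZ p A (r : R) g : 0 < A -> csupp p A g -> rint (fun z => r * g z) = r * rint g.
Proof. by move=> A0 cg; apply: RintegralZl => //; exact: (csupp_integrable A0 cg). Qed.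

Definition box_volume (A : R) : R := ((2 * A) * (2 * A)) ^+ n.

Lemma box_volume_gt0 A : 0 < A -> 0 < box_volume A.
Proof. by move=> A0; rewrite exprn_gt0// !mulr_gt0. Qed.

Lemma Rintegral_box q A (c : R) : 0 < A -> \int[vol]_(t in tbox q A) c = c * box_volume A.
Proof.
move=> A0; rewrite Rintegral_cst; last exact: measurable_tbox.
by rewrite [X in fine X](tbox_volume q A0).
Qed.

Lemma rint_box p A g : csupp p A g -> rint g = \int[vol]_(t in tbox (pairs_of p) A) g (vec t).
Proof.
move=> [_ g0]; rewrite Rintegral_mkcond; apply: eq_Rintegral => t _.
rewrite patchE; case: ifPn => // /negP; rewrite inE -vec_cbox => /g0 /=.
by move=> ->.
Qed.

Lemma box_integrable q A (c : R) : 0 < A -> vol.-integrable (tbox q A) (EFin \o (fun=> c)).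
Proof.
move=> A0; apply: measurable_bounded_integrable => //; [exact: measurable_tbox|exact: vol_tbox_fin|].
by exists `|c|; split; [exact: num_real|move=> x cx t _ /=; exact: ltW].
Qed.

Lemma csupp_integrable_box p A g q B : 0 < A -> csupp p A g ->
  vol.-integrable (tbox q B) (EFin \o (g \o vec)).
Proof.
move=> A0 cg; apply: (@integrableS _ _ _ _ setT) => //; first exact: measurable_tbox.
exact: csupp_integrable cg.
Qed.

Lemma rint_abs_le p A g M : 0 < A -> csupp p A g -> (forall z, `|g z| <= M) ->
  `|rint g| <= M * box_volume A.
Proof.
move=> A0 cg HM; rewrite (rint_box cg) -(Rintegral_box (pairs_of p) M A0).
have mS := @measurable_tbox _ _ (pairs_of p) A.
have ig := csupp_integrable_box (pairs_of p) A A0 cg.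
apply: le_trans (le_normr_Rintegral mS ig) _.
have cabs : csupp p A (fun z => `|g z|).
  case: cg => cg g0; split=> [z|z /g0 ->]; last by rewrite normr0.
  by apply: cvg_norm; exact: cg.
apply: le_Rintegral => //; first exact: (csupp_integrable_box (pairs_of p) A A0 cabs).
  exact: (box_integrable (pairs_of p) M A0).
by move=> t _; exact: HM.
Qed.

Lemma rint_gt0 p A g z0 : 0 < A -> csupp p A g -> (forall z, 0 <= g z) -> 0 < g z0 -> 0 < rint g.
Proof.
move=> A0 cg g0 gz0.
have e0 : 0 < g z0 / 2 by rewrite divr_gt0.
have [e ee0 He] : exists2 e : R, 0 < e & forall z, cbox z0 e z -> g z0 / 2 <= g z.
  have H : nbhs z0 [set z | g z0 / 2 < g z].
    by apply: (cg.1 z0 [set x | g z0 / 2 < x]); apply: lt_nbhsr; rewrite ltr_pdivrMr// ltr_pMr// ltr1n.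
  have /nbhs_xcoordP[e e1 He] := H.
  exists (e / 2); first by rewrite divr_gt0.
  move=> z Hz; apply: ltW; apply: He => k; apply: le_lt_trans (Hz k) _.
  by rewrite ltr_pdivrMr// ltr_pMr// ltr1n.
apply: (@lt_le_trans _ _ (g z0 / 2 * box_volume e)); first by rewrite mulr_gt0// box_volume_gt0.
rewrite -(Rintegral_box (pairs_of z0) _ ee0) Rintegral_mkcond.
apply: le_Rintegral => //.
- have mS := @measurable_tbox _ _ (pairs_of z0) e.
  have := (integrable_mkcond _ mS).1 (box_integrable (pairs_of z0) (g z0 / 2) ee0).
  by rewrite restrict_EFin.
- exact: csupp_integrable cg.
- move=> t _; rewrite patchE; case: ifPn => [|_]; last exact: g0.
  by rewrite inE -vec_cbox => /He.
Qed.

Lemma integral_line_partial0 k (psi : Cn -> R) p A z : 0 < A -> rsmooth psi ->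
  (forall y, ~ cbox p A y -> psi y = 0) ->
  (\int[@lebesgue_measure R]_v (rpartial k psi (set_coord k v z))%:E = 0)%E.
Proof.
move=> A0 sp p0.
pose F v := psi (set_coord k v z); pose f v := rpartial k psi (set_coord k v z).
have dF (v : R) : is_derive v (1 : R) F (f v).
  have E : F = (fun u => psi (step k u z)) \o (fun u => u - xcoord k z) by [].
  rewrite E -[f v]mulr1; apply: is_derive1_comp; first exact: rsmooth_is_derive.
  have H := is_deriveB (is_derive_id v (1 : R)) (is_derive_cst (xcoord k z) v (1 : R)).
  by apply: (is_derive_eq H); rewrite subr0.
pose a := xcoord k p - (A + 1); pose b := xcoord k p + (A + 1).
have out v : ~ (a < v < b) -> ~ cbox p A (set_coord k v z).
  move=> Hv /(_ k); rewrite xcoord_set eqxx ler_distl => /andP[H1 H2]; apply: Hv.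
  by rewrite /a /b; apply/andP; split; lra.
have cf : continuous f.
  move=> v; apply: (@continuous_comp _ _ _ (fun u => set_coord k u z) (rpartial k psi)).
    apply: (@continuous_comp _ _ _ (fun u => u - xcoord k z) (fun u => step k u z)); last exact: continuous_step.
    by apply: cvgB; [exact: cvg_id|exact: cvg_cst].
  exact: (rsmooth_continuous (rsmooth_rpartial k sp)).
have ab : a < b by rewrite /a /b; lra.
transitivity (\int[@lebesgue_measure R]_(v in `[a, b]) (f v)%:E)%E.
  rewrite [RHS]integral_mkcond; apply: eq_integral => v _; rewrite patchE; case: ifPn => // /negP.
  rewrite inE /= in_itv /= => Hv; congr EFin; apply: (rpartials_vanish [:: k] p0); apply: out.
  by move=> /andP[H1 H2]; apply: Hv; rewrite !ltW.
have cF : continuous F by move=> v; exact: is_derive1_continuous (dF v).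
rewrite (@continuous_FTC2 R f F a b ab).
- have F0 v : ~ (a < v < b) -> F v = 0 by move=> /out; exact: p0.
  by rewrite !F0 ?subee// ltxx ?andbF.
- exact: continuous_subspaceT.
- split; [by move=> x _; have [] := dF x|exact/cvg_at_right_filter/cF|exact/cvg_at_left_filter/cF].
- by move=> x _; exact: is_derive_derive1.
Qed.

(** The fundamental theorem of calculus makes all integrals along the k-th direction vanish. *)
Lemma rint_rpartial k (psi : Cn -> R) p A : 0 < A -> rsmooth psi ->
  (forall y, ~ cbox p A y -> psi y = 0) -> rint (rpartial k psi) = 0.
Proof.
move=> A0 sp p0.
have cs : csupp p A (rpartial k psi).
  split; first exact: rsmooth_continuous (rsmooth_rpartial k sp).
  exact: (rpartials_vanish [:: k] p0).
have [b [j kE]] := dirP k.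
rewrite /rint /Rintegral (@integral_volume_lines0 R n b j (pairs_of p) A (rpartial k psi \o vec) A0)//.
  exact: csupp_bounded_supp.
move=> t; rewrite -(integral_line_partial0 k (vec t) A0 sp p0).
by apply: eq_integral => v _ /=; rewrite vec_set_tuple -kE.
Qed.

End volume_on_Cn.

(** * Complex-valued integrals *)

Section complex_integral.
Context {R : realType} {n : nat}.
Local Notation C := R[i].
Local Notation Re := (@complex.Re R).
Local Notation Im := (@complex.Im R).
Local Notation normc := (@Normc.normc R).
Local Notation Cn := 'rV[R[i]]_n.
Local Notation dir := ('I_n + 'I_n)%type.
Local Open Scope complex_scope.
Implicit Types (phi psi g : Cn -> C) (z p : Cn) (k l : dir).

#[local] Opaque rpartial partial.

Definition cint phi : C := rint (Re \o phi) +i* rint (Im \o phi).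

Definition ccsupp p (A : R) phi := continuous phi /\ forall z, ~ cbox p A z -> phi z = 0.

Lemma ccsuppP p A phi : ccsupp p A phi -> csupp p A (Re \o phi) /\ csupp p A (Im \o phi).
Proof.
move=> [cp p0]; split; split=> [z|z /p0 /= ->] //.
  by have /complex_continuousP[] := cp z.
by have /complex_continuousP[] := cp z.
Qed.

Lemma ccsupp_smooth p A phi : csmooth phi -> (forall z, ~ cbox p A z -> phi z = 0) -> ccsupp p A phi.
Proof. by move=> sp p0; split => //; exact: csmooth_continuous. Qed.

Lemma continuous_cD phi psi : continuous phi -> continuous psi -> continuous (fun z => phi z + psi z).
Proof.
move=> cp cq z; apply/complex_continuousP.
have /complex_continuousP[p1 p2] := cp z; have /complex_continuousP[q1 q2] := cq z; split.
  rewrite (_ : (fun y => _) = fun y => Re (phi y) + Re (psi y)); last by apply/funext => y; rewrite Re_D.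
  exact: cvgD.
rewrite (_ : (fun y => _) = fun y => Im (phi y) + Im (psi y)); last by apply/funext => y; rewrite Im_D.
exact: cvgD.
Qed.

Lemma continuous_cM_at phi psi z : {for z, continuous phi} -> {for z, continuous psi} ->
  {for z, continuous (fun z => phi z * psi z)}.
Proof.
move=> /complex_continuousP[p1 p2] /complex_continuousP[q1 q2]; apply/complex_continuousP; split.
  rewrite (_ : (fun y => _) = fun y => Re (phi y) * Re (psi y) - Im (phi y) * Im (psi y)); last first.
    by apply/funext => y; rewrite Re_M.
  by apply: cvgB; exact: cvgM.
rewrite (_ : (fun y => _) = fun y => Re (phi y) * Im (psi y) + Re (psi y) * Im (phi y)); last first.
  by apply/funext => y; rewrite Im_M.
by apply: cvgD; exact: cvgM.
Qed.

Lemma continuous_cM phi psi : continuous phi -> continuous psi -> continuous (fun z => phi z * psi z).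
Proof. by move=> cp cq z; apply: continuous_cM_at; [exact: cp|exact: cq]. Qed.

Lemma ccsuppD p A phi psi : ccsupp p A phi -> ccsupp p A psi -> ccsupp p A (fun z => phi z + psi z).
Proof.
by move=> [cp p0] [cq q0]; split=> [|z Hz]; [exact: continuous_cD|rewrite p0// q0// addr0].
Qed.

Lemma ccsuppM p A phi psi : ccsupp p A phi -> continuous psi -> ccsupp p A (fun z => phi z * psi z).
Proof.
by move=> [cp p0] cq; split=> [|z Hz]; [exact: continuous_cM|rewrite p0// mul0r].
Qed.

Lemma ccsuppZ p A (c : C) phi : ccsupp p A phi -> ccsupp p A (fun z => c * phi z).
Proof.
move=> cp; rewrite (_ : (fun z => _) = fun z => phi z * c); last by apply/funext => z; rewrite mulrC.
by apply: ccsuppM => // z; exact: cvg_cst.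
Qed.

Lemma cintD p A phi psi : 0 < A -> ccsupp p A phi -> ccsupp p A psi ->
  cint (fun z => phi z + psi z) = cint phi + cint psi.
Proof.
move=> A0 /ccsuppP[p1 p2] /ccsuppP[q1 q2]; apply: complex_eqP; rewrite ?Re_D ?Im_D /= -(rintD (p := p) (A := A))//;
  congr rint; apply/funext => z /=; by rewrite ?Re_D ?Im_D.
Qed.

Lemma rint_lin2 p A (a b : R) (f h : Cn -> R) : 0 < A -> csupp p A f -> csupp p A h ->
  rint (fun z => a * f z + b * h z) = a * rint f + b * rint h.
Proof.
move=> A0 cf ch.
have cZ (c : R) u : csupp p A u -> csupp p A (fun z => c * u z).
  move=> [cu u0]; split=> [z|z /u0 ->]; last by rewrite mulr0.
  by apply: cvgM; [exact: cvg_cst|exact: cu].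
by rewrite (rintD A0 (cZ a _ cf) (cZ b _ ch)) (rintZ _ A0 cf) (rintZ _ A0 ch).
Qed.

Lemma cintZ p A (c : C) phi : 0 < A -> ccsupp p A phi -> cint (fun z => c * phi z) = c * cint phi.
Proof.
move=> A0 /ccsuppP[p1 p2]; apply: complex_eqP; rewrite ?Re_M ?Im_M /=.
  rewrite -mulNr -(rint_lin2 _ _ A0 p1 p2); congr rint; apply/funext => z /=.
  by rewrite Re_M mulNr.
rewrite [rint _ * Im c]mulrC -(rint_lin2 _ _ A0 p2 p1); congr rint; apply/funext => z /=.
by rewrite Im_M [Re (phi z) * _]mulrC.
Qed.

Lemma cint_lin p A (a : C) phi psi : 0 < A -> ccsupp p A phi -> ccsupp p A psi ->
  cint (fun z => a * phi z + psi z) = a * cint phi + cint psi.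
Proof. by move=> A0 cp cq; rewrite (cintD A0 (ccsuppZ a cp) cq) (cintZ _ A0 cp). Qed.

Lemma cint_norm_le p A phi M : 0 < A -> ccsupp p A phi -> (forall z, normc (phi z) <= M) ->
  normc (cint phi) <= 2 * (M * @box_volume R n A).
Proof.
move=> A0 /ccsuppP[p1 p2] HM; apply: le_trans (normc_le_abs _) _.
rewrite mulrDl mul1r; apply: lerD.
  by apply: rint_abs_le A0 p1 _ => z; apply: le_trans (HM z); have [] := normc_ge_abs (phi z).
by apply: rint_abs_le A0 p2 _ => z; apply: le_trans (HM z); have [] := normc_ge_abs (phi z).
Qed.

Lemma cint_wirtinger e j p A psi : 0 < A -> csmooth psi -> (forall z, ~ cbox p A z -> psi z = 0) ->
  cint (wirtinger e j psi) = 0.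
Proof.
move=> A0 sp p0.
have cint_partial k : cint (partial k psi) = 0.
  have [sR sI] := sp.
  apply: complex_eqP => /=.
    by apply: (rint_rpartial k A0 sR) => y /p0 /= ->.
  by apply: (rint_rpartial k A0 sI) => y /p0 /= ->.
have cs k : ccsupp p A (partial k psi).
  by apply: ccsupp_smooth; [exact: csmooth_partial|exact: (partials_vanish p0 [:: k])].
have comb (a b : C) : cint (fun z => a * partial (inl j) psi z + b * partial (inr j) psi z) = 0.
  apply: etrans (cint_lin a A0 (cs (inl j)) (ccsuppZ b (cs (inr j)))) _.
  apply: etrans (congr2 +%R (congr1 ( *%R a) (cint_partial (inl j))) (cintZ b A0 (cs (inr j)))) _.
  by rewrite (cint_partial (inr j)) !mulr0 addr0.
rewrite -[RHS](comb 2^-1 (2^-1 * (e * 'i))); congr cint; apply/funext => z.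
by rewrite /wirtinger mulrC mulrDr !mulrA.
Qed.

Lemma volume_integralE (Omega : set Cn) phi : (forall z, ~ Omega z -> phi z = 0) ->
  volume_integral Omega phi = cint phi.
Proof.
move=> p0.
have H (P : C -> R) : P 0 = 0 -> Rintegral (@volume R n) (@vec_of_pairs R n @^-1` Omega)
    (fun t => P (phi (vec_of_pairs t))) = rint (P \o phi).
  move=> P0; rewrite Rintegral_mkcond; apply: eq_Rintegral => t _.
  by rewrite patchE; case: ifPn => // /negP; rewrite inE => /p0 /= ->.
by apply: complex_eqP; exact: H.
Qed.

End complex_integral.

(** * Dominated series over multi-indices *)

Section multi_series.
Context {R : realType} {n : nat}.
Local Notation C := R[i].
Local Notation Re := (@complex.Re R).
Local Notation Im := (@complex.Im R).
Local Notation normc := (@Normc.normc R).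
Local Notation K := {ffun 'I_n -> nat}.
Implicit Types (s t : seq K) (alpha : K) (m M : nat).

Definition multi_index m (b : {ffun 'I_n -> 'I_m}) : K := [ffun j => val (b j)].

Definition index_box m : seq K := [seq multi_index b | b <- enum {: {ffun 'I_n -> 'I_m}}].

Lemma index_boxP m alpha : reflect (forall j, (alpha j < m)%N) (alpha \in index_box m).
Proof.
apply: (iffP mapP) => [[b _ ->] j|H]; first by rewrite ffunE; exact: ltn_ord.
exists [ffun j => Ordinal (H j)]; first by rewrite mem_enum.
by apply/ffunP => j; rewrite !ffunE.
Qed.

Lemma uniq_index_box m : uniq (index_box m).
Proof.
rewrite map_inj_uniq ?enum_uniq// => b b' /ffunP H.
by apply/ffunP => j; apply: val_inj; have := H j; rewrite !ffunE.
Qed.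

Lemma index_box_exhaust s : exists m0, forall m, (m0 <= m)%N -> {subset s <= index_box m}.
Proof.
exists (\max_(alpha <- s) \max_(j < n) (alpha j).+1)%N => m mm alpha sa.
apply/index_boxP => j; apply: leq_trans mm; rewrite -[X in (X <= _)%N]/((alpha j).+1).
apply: leq_trans (leq_bigmax_seq _ sa isT).
exact: (leq_bigmax_cond (P := predT)).
Qed.

Lemma sub_index_box m M : (m <= M)%N -> {subset index_box m <= index_box M}.
Proof. by move=> mM alpha /index_boxP H; apply/index_boxP => j; exact: leq_trans mM. Qed.

Definition weight alpha : R := \prod_j (2^-1) ^+ alpha j.

Lemma weight_ge0 alpha : 0 <= weight alpha.
Proof. by apply: prodr_ge0 => j _; rewrite exprn_ge0// invr_ge0. Qed.

Definition box_weight m : R := (\sum_(i < m) (2^-1) ^+ i) ^+ n.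

Lemma sum_weight_index_box m : \sum_(alpha <- index_box m) weight alpha = box_weight m.
Proof.
rewrite /index_box big_map big_enum /= /box_weight.
transitivity (\sum_(b : {ffun 'I_n -> 'I_m}) \prod_j ((2^-1 : R) ^+ b j)).
  by apply: eq_bigr => b _; apply: eq_bigr => j _; rewrite ffunE.
by rewrite -(bigA_distr_bigA (fun _ (i : 'I_m) => (2^-1 : R) ^+ i)) prodr_const card_ord.
Qed.

Lemma geometric_half m : \sum_(i < m) (2^-1 : R) ^+ i = 2 - 2 * (2^-1) ^+ m.
Proof.
elim: m => [|m IH]; first by rewrite big_ord0 expr0 mulr1 subrr.
by rewrite big_ord_recr /= IH exprS; field.
Qed.

(** The mass, out of 2^n, of the weights outside the index box *)
Definition tail_weight m : R := 2 ^+ n - box_weight m.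

Lemma box_weight_le m : box_weight m <= 2 ^+ n.
Proof.
rewrite /box_weight geometric_half lerXn2r ?nnegrE//.
  by rewrite -geometric_half sumr_ge0// => i _; rewrite exprn_ge0// invr_ge0.
by rewrite lerBlDr lerDl mulr_ge0// exprn_ge0// invr_ge0.
Qed.

Lemma tail_weight_ge0 m : 0 <= tail_weight m.
Proof. by rewrite subr_ge0 box_weight_le. Qed.

Lemma tail_weight_small (e : R) : 0 < e -> exists m0, forall m, (m0 <= m)%N -> tail_weight m <= e.
Proof.
move=> e0.
have H : tail_weight @ \oo --> (0 : R).
  rewrite /tail_weight /box_weight -[X in _ --> X](subrr (2 ^+ n)).
  apply: cvgB; first exact: cvg_cst.
  rewrite (_ : (fun m => _) = (fun x : R => x ^+ n) \o (fun m => 2 - 2 * (2^-1) ^+ m)); last first.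
    by apply/funext => m /=; rewrite geometric_half.
  apply: continuous_cvg; first exact: exprn_continuous.
  rewrite -[X in _ --> X](subr0 2); apply: cvgB; first exact: cvg_cst.
  rewrite -[X in _ --> X](mulr0 2); apply: cvgM; first exact: cvg_cst.
  by apply: cvg_expr; rewrite ger0_norm ?invr_ge0// invf_lt1// ltr1n.
have /cvgrPdist_le/(_ _ e0)[m0 _ Hm] := H.
by exists m0 => m mm; have := Hm m mm; rewrite /= sub0r normrN ger0_norm// tail_weight_ge0.
Qed.

Lemma sum_split_sub (V : zmodType) (F : K -> V) s t : uniq s -> uniq t -> {subset s <= t} ->
  \sum_(i <- t) F i = \sum_(i <- s) F i + \sum_(i <- t | i \notin s) F i.
Proof.
move=> us ut st; rewrite (bigID (fun i => i \in s)) /=; congr (_ + _).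
rewrite -big_filter; apply: perm_big; apply: uniq_perm => //; first exact: filter_uniq.
by move=> i; rewrite mem_filter; case: (boolP (i \in s)) => //= /st ->.
Qed.

Lemma sum_diff_le (a : K -> R) (B : R) s t : uniq s -> uniq t -> {subset s <= t} ->
  (forall i, `|a i| <= B * weight i) ->
  `|\sum_(i <- t) a i - \sum_(i <- s) a i| <=
  B * (\sum_(i <- t) weight i - \sum_(i <- s) weight i).
Proof.
move=> us ut st Ha; rewrite !(sum_split_sub _ us ut st) addrAC subrr add0r addrAC subrr add0r.
by rewrite mulr_sumr; apply: le_trans (ler_norm_sum _ _ _) _; exact: ler_sum.
Qed.

Lemma sum_weight_le s : uniq s -> \sum_(i <- s) weight i <= 2 ^+ n.
Proof.
move=> us; have [m0 /(_ m0 (leqnn _)) H] := index_box_exhaust s.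
apply: le_trans (box_weight_le m0); rewrite -sum_weight_index_box.
rewrite (sum_split_sub _ us (uniq_index_box m0) H) lerDl sumr_ge0// => i _.
exact: weight_ge0.
Qed.

Lemma sum_diff_tail (a : K -> R) (B : R) m s t : 0 <= B -> uniq s -> uniq t -> {subset s <= t} ->
  {subset index_box m <= s} -> (forall i, `|a i| <= B * weight i) ->
  `|\sum_(i <- t) a i - \sum_(i <- s) a i| <= B * tail_weight m.
Proof.
move=> B0 us ut st ms Ha; apply: le_trans (sum_diff_le us ut st Ha) _; apply: ler_wpM2l => //.
apply: lerB; first exact: sum_weight_le.
rewrite -sum_weight_index_box (sum_split_sub _ (uniq_index_box m) us ms) lerDl sumr_ge0// => i _.
exact: weight_ge0.
Qed.

Lemma multi_series_real (a : K -> R) (B : R) : 0 <= B -> (forall i, `|a i| <= B * weight i) ->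
  exists l, forall m s, uniq s -> {subset index_box m <= s} ->
    `|\sum_(i <- s) a i - l| <= B * tail_weight m.
Proof.
move=> B0 Ha; pose u m := \sum_(i <- index_box m) a i.
have uu m M : (m <= M)%N -> `|u M - u m| <= B * tail_weight m.
  by move=> mM; apply: sum_diff_tail => //; try exact: uniq_index_box; exact: sub_index_box.
have cu : cvg (u @ \oo).
  apply: cauchy_cvg; apply/cauchy_ballP => e e0.
  have e20 : 0 < e / 2 / (B + 1) by rewrite divr_gt0 ?divr_gt0// ltr_wpDl.
  have [m0 Hm0] := tail_weight_small e20.
  have close m : (m0 <= m)%N -> `|u m - u m0| < e / 2.
    move=> mm; apply: le_lt_trans (uu _ _ mm) _.
    apply: (@le_lt_trans _ _ (B * (e / 2 / (B + 1)))); first by rewrite ler_wpM2l// Hm0.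
    by rewrite mulrCA -[ltRHS]mulr1 ltr_pM2l ?divr_gt0// ltr_pdivrMr ?ltr_wpDl// mul1r ltrDl.
  near=> x y => /=; rewrite -ball_normE /=.
  rewrite (le_lt_trans (ler_distD (u m0) _ _))// [ltRHS]splitr.
  by apply: ltrD; [near: x|rewrite distrC; near: y]; exists m0 => // m; exact: close.
exists (lim (u @ \oo)) => m s us ms; apply/ler_addgt0Pr => e e0.
have /cvgrPdist_le/(_ _ e0)[m1 _ Hm1] := cu.
have [m2 Hm2] := index_box_exhaust s.
pose M := maxn m1 m2.
apply: le_trans (ler_distD (u M) _ _) _; apply: lerD; last first.
  by rewrite distrC; apply: Hm1; rewrite /= leq_maxl.
rewrite distrC; apply: sum_diff_tail => //; first exact: uniq_index_box.
by apply: Hm2; rewrite leq_maxr.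
Unshelve. all: by end_near. Qed.

(** The partial sums over index boxes form a Cauchy sequence. The remainder depends on the bound B
  only, so that families of functions converge uniformly. *)
Lemma multi_series (a : K -> C) (B : R) : 0 <= B -> (forall i, normc (a i) <= B * weight i) ->
  exists l, forall m s, uniq s -> {subset index_box m <= s} ->
    normc (\sum_(i <- s) a i - l) <= 2 * B * tail_weight m.
Proof.
move=> B0 Ha.
have [|l1 H1] := @multi_series_real (Re \o a) B B0.
  by move=> i; apply: le_trans (Ha i); have [] := normc_ge_abs (a i).
have [|l2 H2] := @multi_series_real (Im \o a) B B0.
  by move=> i; apply: le_trans (Ha i); have [] := normc_ge_abs (a i).
exists (l1 +i* l2)%C => m s us ms; apply: le_trans (normc_le_abs _) _.
rewrite -mulrA mulrDl mul1r; apply: lerD.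
  rewrite Re_D Re_N (big_morph Re Re_D (erefl : Re 0 = 0)); exact: H1.
rewrite Im_D Im_N (big_morph Im Im_D (erefl : Im 0 = 0)); exact: H2.
Qed.

Lemma multi_series_cvg (a : K -> C) (B : R) (l : C) : 0 <= B ->
  (forall m s, uniq s -> {subset index_box m <= s} -> normc (\sum_(i <- s) a i - l) <= 2 * B * tail_weight m) ->
  summability.partial_sum a @ summability.totally --> l.
Proof.
move=> B0 H A /nbhs_complexP[e e0 eA].
have e20 : 0 < e / 2 / (2 * B + 1) by rewrite divr_gt0 ?divr_gt0// ltr_wpDl// mulr_ge0.
have [m0 /(_ m0 (leqnn _)) Hm0] := tail_weight_small e20.
exists [fset i in index_box m0]%fset => // J /= /fsubsetP HJ.
have sub : {subset index_box m0 <= J} by move=> i Hi; apply: HJ; rewrite inE.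
have := H m0 J (fset_uniq J) sub.
have -> : summability.partial_sum a J = \sum_(i <- J) a i by rewrite /summability.partial_sum big_seq_fsetE.
move=> HJ2.
have lt : 2 * B * tail_weight m0 < e.
  apply: (@le_lt_trans _ _ (2 * B * (e / 2 / (2 * B + 1)))); first by rewrite ler_wpM2l// mulr_ge0.
  apply: (@le_lt_trans _ _ (e / 2)); last lra.
  rewrite mulrCA -[leRHS]mulr1 ler_pM2l ?divr_gt0// ler_pdivrMr ?ltr_wpDl ?mulr_ge0// mul1r lerDl//.
have [h1 h2] := normc_ge_abs (\sum_(i <- J) a i - l).
apply: eA; apply: le_lt_trans lt; apply: le_trans HJ2; rewrite -?Re_N -?Im_N -?Re_D -?Im_D //.
Qed.

End multi_series.

(** * Radial profiles and their primitives *)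

Section radial_profiles.
Context {R : realType}.
Context (r : R) (r0 : 0 < r).

(** Profiles in s = |w|^2: X0 cuts off on the disc of radius r, X on a larger disc, and D = - X'
  lives on the annulus between the radii 4 r and 6 r. *)
Definition cutoff_profiles (X0 X D : R -> R) : Prop :=
  [/\ [/\ smooth1 X0, (forall s, s <= r ^+ 2 / 2 -> X0 s = 1),
          (forall s, r ^+ 2 <= s -> X0 s = 0) & (forall s, 0 <= X0 s <= 1)],
      [/\ smooth1 X, (forall s, s <= 16 * r ^+ 2 -> X s = 1) & (forall s, 32 * r ^+ 2 <= s -> X s = 0)] &
      [/\ smooth1 D, (forall s, is_derive (s : R) (1 : R) X (- D s)), (forall s, 0 <= D s) &
          [/\ (forall s, s <= 16 * r ^+ 2 -> D s = 0), (forall s, 32 * r ^+ 2 <= s -> D s = 0) &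
              (forall s, 16 * r ^+ 2 < s -> s < 32 * r ^+ 2 -> 0 < D s)]]].

Lemma smooth1_scale (c : R) h : smooth1 h -> smooth1 (fun s => h (c * s)).
Proof.
move=> sh; apply: (smooth1_comp sh); apply: smooth1M; [exact: smooth1_cst|exact: smooth1_id].
Qed.

Lemma is_derive_scale (c : R) h (s dh : R) : is_derive (c * s) (1 : R) h dh ->
  is_derive s (1 : R) (fun s => h (c * s)) (dh * c).
Proof.
move=> dhs; apply: (@is_derive1_comp R h (fun s => c * s) s dh c dhs).
have H := is_deriveM (is_derive_cst c s (1 : R)) (is_derive_id s (1 : R)).
by apply: (is_derive_eq H); rewrite /GRing.scale /= mulr1 mulr0 addr0.
Qed.

Lemma exists_cutoff_profiles : exists X0 X D, cutoff_profiles X0 X D.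
Proof.
have [st [d [[sst st1 st2 st01] sd dst [d0 d1 d2 dpos]]]] := @exists_cutoff R.
have r20 : 0 < r ^+ 2 by rewrite exprn_gt0.
pose c0 := 2 / r ^+ 2; pose c := (16 * r ^+ 2)^-1.
have c_gt0 : 0 < c by rewrite invr_gt0 mulr_gt0.
have cE s : c * s = s / (16 * r ^+ 2) by rewrite mulrC.
have c0E s : c0 * s = s / (r ^+ 2 / 2) by rewrite /c0 invf_div mulrC.
have c1 s : s <= 16 * r ^+ 2 -> c * s <= 1 by rewrite cE ler_pdivrMr ?mulr_gt0// mul1r.
have c2 s : 32 * r ^+ 2 <= s -> 2 <= c * s.
  by rewrite cE ler_pdivlMr ?mulr_gt0//; move=> H; apply: le_trans H; lra.
exists (fun s => st (c0 * s)), (fun s => st (c * s)), (fun s => d (c * s) * c); split.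
- split => [|s Hs|s Hs|s]; [exact: smooth1_scale| | |exact: st01].
    by apply: st1; rewrite c0E ler_pdivrMr ?divr_gt0// mul1r.
  by apply: st2; rewrite c0E ler_pdivlMr ?divr_gt0//; apply: le_trans Hs; lra.
- by split => [|s Hs|s Hs]; [exact: smooth1_scale|apply: st1; exact: c1|apply: st2; exact: c2].
- split.
  + by apply: smooth1M; [exact: smooth1_scale|exact: smooth1_cst].
  + by move=> s; rewrite -mulNr; exact: is_derive_scale.
  + by move=> s; rewrite mulr_ge0// ltW.
  + split=> [s Hs|s Hs|s H1 H2]; [by rewrite d1 ?mul0r//; exact: c1|by rewrite d2 ?mul0r//; exact: c2|].
    apply: mulr_gt0 => //; apply: dpos; rewrite cE; first by rewrite ltr_pdivlMr ?mulr_gt0// mul1r.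
    by rewrite ltr_pdivrMr ?mulr_gt0//; apply: lt_le_trans H2 _; lra.
Qed.

Section reductions.
Context (X0 X D : R -> R) (profiles : cutoff_profiles X0 X D).

Lemma radial_primitive (b : nat) : exists G, [/\ smooth1 G, (forall s, r ^+ 2 <= s -> G s = 0) &
  forall s : R, is_derive s (1 : R) G (s ^+ b * X0 s)].
Proof.
have [[sX0 _ X0r _] _ _] := profiles.
have sg : smooth1 (fun s => s ^+ b * X0 s).
  by apply: smooth1M => //; apply: smooth1X; exact: smooth1_id.
have [|G [dG G0]] := antiderivative_right (smooth1_continuous sg) (c := r ^+ 2).
  by move=> s /X0r ->; rewrite mulr0.
by exists G; split => //; exact: smooth1_antiderivative dG.
Qed.

Lemma smooth1_D_div m : smooth1 (fun s => D s / s ^+ m).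
Proof.
have [_ _ [sD _ _ [D0 _ _]]] := profiles.
by apply: (@smooth1_divX _ _ (16 * r ^+ 2)) => //; rewrite mulr_gt0// exprn_gt0.
Qed.

Lemma annular_primitive (m : nat) : exists G, [/\ smooth1 G, (forall s, 32 * r ^+ 2 <= s -> G s = 0) &
  forall s : R, is_derive s (1 : R) G (D s / s ^+ m)].
Proof.
have [_ _ [_ _ _ [_ D32 _]]] := profiles.
have sg := smooth1_D_div m.
have [|G [dG G0]] := antiderivative_right (smooth1_continuous sg) (c := 32 * r ^+ 2).
  by move=> s /D32 ->; rewrite mul0r.
by exists G; split => //; exact: smooth1_antiderivative dG.
Qed.

(** The equation says (s^(k+1) H)' = s^(k+a) X0 - C D; it has a solution of bounded support exactly
  when the right-hand side has integral 0, which determines C. *)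
Lemma moment_primitive (a k : nat) : exists (C : R) (H : R -> R), [/\ smooth1 H,
  (forall s, 32 * r ^+ 2 <= s -> H s = 0) &
  forall s, k.+1%:R * H s + s * derive1 H s = s ^+ a * X0 s - C * (D s / s ^+ k)].
Proof.
have [[sX0 X01 X0r _] [sX X1 X32] [sD dX _ [D16 D32 _]]] := profiles.
have r20 : 0 < r ^+ 2 by rewrite exprn_gt0.
have dX0 (s : R) : s < r ^+ 2 / 2 -> derive1 X0 s = 0.
  move=> Hs; apply: is_derive_derive1; apply: (near_is_derive (g := fun=> 1)).
  near=> y; apply: X01; apply: ltW; near: y; exact: lt_nbhsl.
have sX0' := smooth1_derive1 sX0.
pose g s := s ^+ (k + a).+1 * derive1 X0 s.
have sg : smooth1 g by apply: smooth1M => //; apply: smooth1X; exact: smooth1_id.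
have g0 s : s <= r ^+ 2 / 4 -> g s = 0.
  by move=> Hs; rewrite /g dX0 ?mulr0//; apply: le_lt_trans Hs _; lra.
have [P [dP P0]] := antiderivative_left (smooth1_continuous sg) g0.
have sP : smooth1 P := smooth1_antiderivative sg dP.
pose N : R := (k + a).+1%:R.
have N0 : N != 0 by rewrite pnatr_eq0.
have Pconst s : r ^+ 2 <= s -> P s = P (r ^+ 2).
  move=> Hs; apply/esym; apply: (zero_derivative_cst_itv Hs) => y; first by exists (g y).
  move=> y1 _; have -> : 0 = g y; last exact: dP.
  rewrite /g (_ : derive1 X0 y = 0) ?mulr0//; apply: is_derive_derive1.
  apply: (near_is_derive (g := fun=> 0)).
  near=> u; apply: X0r; apply: ltW; near: u; exact: lt_nbhsr.
(* P is constant beyond r^2; this C makes the constant cancel against C (X - 1) for large s. *)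
pose C := - P (r ^+ 2) / N.
(* By parts, H = s^a X0 / N + F / s^(k+1), where F vanishes near 0 and for large s. *)
pose F s := C * (X s - 1) + (- N^-1) * P s.
have sF : smooth1 F.
  apply: smooth1D; apply: smooth1M => //; try exact: smooth1_cst.
  by apply: smooth1D => //; exact: smooth1_cst.
have dF (s : R) : is_derive s (1 : R) F (- C * D s - N^-1 * g s).
  have H1 := is_deriveM (is_derive_cst C s (1 : R)) (is_deriveB (dX s) (is_derive_cst (1 : R) s (1 : R))).
  have H2 := is_deriveM (is_derive_cst (- N^-1) s (1 : R)) (dP s).
  apply: (is_derive_eq (is_deriveD H1 H2)); rewrite /GRing.scale /= !mulr0 !addr0 subr0.
  by rewrite mulrN !mulNr.
have F0 s : s <= r ^+ 2 / 4 -> F s = 0.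
  move=> Hs; rewrite /F P0// X1 ?subrr ?mulr0 ?addr0//; apply: le_trans Hs _; lra.
have F32 s : 32 * r ^+ 2 <= s -> F s = 0.
  move=> Hs; rewrite /F X32// Pconst; last by apply: le_trans Hs; lra.
  by rewrite /C sub0r mulrN1 mulNr opprK mulNr mulrC subrr.
pose Q s := F s / s ^+ k.+1.
have sQ : smooth1 Q by apply: (@smooth1_divX R F (r ^+ 2 / 4) k.+1 _ sF F0); rewrite divr_gt0.
have QE : F = fun s => s ^+ k.+1 * Q s.
  apply/funext => s; rewrite /Q; have [->|s0] := eqVneq s 0.
    by rewrite F0 ?mul0r ?mulr0// divr_ge0// ltW.
  by rewrite mulrC divfK// expf_neq0.
have dQ s : k.+1%:R * Q s + s * derive1 Q s = (- C * D s - N^-1 * g s) / s ^+ k.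
  have [->|s0] := eqVneq s 0.
    rewrite mul0r addr0 /Q F0 ?mul0r ?mulr0; last by rewrite divr_ge0// ltW.
    rewrite D16; last by rewrite mulr_ge0// ltW.
    by rewrite g0 ?mulr0 ?subr0 ?mul0r// divr_ge0// ltW.
  have dXk := is_deriveX k.+1 (is_derive_id s (1 : R)).
  have H := is_deriveM dXk (smooth1_is_derive s sQ).
  have E : - C * D s - N^-1 * g s = s ^+ k.+1 * derive1 Q s + Q s * (k.+1%:R * s ^+ k).
    rewrite -(is_derive_derive1 (dF s)) QE; apply: is_derive_derive1.
    rewrite (_ : (fun y => _) = id ^+ k.+1 * Q); last by apply/funext => y; rewrite !fctE.
    apply: (is_derive_eq H); rewrite /GRing.scale /= mulr1 fctE /=; ring.
  have sk0 : s ^+ k != 0 by exact: expf_neq0.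
  rewrite E exprS; apply: (canRL (mulfK sk0)); clear; move: (s ^+ k) (k.+1%:R : R) (Q s) (derive1 Q s) => u v w x; ring.
pose H s := N^-1 * (s ^+ a * X0 s) + Q s.
have sXa : smooth1 (fun s : R => s ^+ a * X0 s).
  by apply: smooth1M => //; apply: smooth1X; exact: smooth1_id.
exists C, H; split.
- by apply: smooth1D => //; apply: smooth1M => //; exact: smooth1_cst.
- move=> s Hs; rewrite /H /Q F32// X0r; last by apply: le_trans Hs; lra.
  by rewrite !mulr0 add0r mul0r.
- move=> s.
  have dXa := is_deriveX a (is_derive_id s (1 : R)).
  have dM := is_deriveM (is_derive_cst N^-1 s (1 : R)) (is_deriveM dXa (smooth1_is_derive s sX0)).
  have -> : derive1 H s = N^-1 * (s ^+ a * derive1 X0 s + a%:R * s ^+ a.-1 * X0 s) + derive1 Q s.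
    apply: is_derive_derive1.
    rewrite (_ : H = cst N^-1 * (id ^+ a * X0) + Q); last by apply/funext => y; rewrite !fctE.
    apply: (is_derive_eq (is_deriveD dM (smooth1_is_derive s sQ))).
    by rewrite /GRing.scale /= mulr1 mulr0 addr0 !fctE; congr (_ * (_ + _) + _); rewrite mulrC.
  have -> : k.+1%:R * H s + s * (N^-1 * (s ^+ a * derive1 X0 s + a%:R * s ^+ a.-1 * X0 s) + derive1 Q s) =
      N^-1 * ((k.+1%:R * s ^+ a + a%:R * (s * s ^+ a.-1)) * X0 s + s ^+ a.+1 * derive1 X0 s) +
      (k.+1%:R * Q s + s * derive1 Q s).
    by rewrite /H exprS; ring.
  have -> : a%:R * (s * s ^+ a.-1) = a%:R * s ^+ a.
    by case: (a) => [|a']; rewrite ?mul0r// -exprS.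
  rewrite dQ mulrDl -addrA.
  have gE : g s / s ^+ k = s ^+ a.+1 * derive1 X0 s.
    have [->|s0] := eqVneq s 0; first by rewrite g0 ?divr_ge0 ?(ltW r20)// mul0r exprS mul0r mul0r.
    have sk0 : s ^+ k != 0 by exact: expf_neq0.
    by rewrite /g -addnS exprD -(mulrA (s ^+ k)) [s ^+ k * _]mulrC mulfK.
  have -> : (- C * D s - N^-1 * g s) / s ^+ k = - C * (D s / s ^+ k) - N^-1 * (s ^+ a.+1 * derive1 X0 s).
    by rewrite -gE; clear; move: (s ^+ k)^-1 (D s) (g s) N^-1 => u v w x; ring.
  set Y := s ^+ a.+1 * derive1 X0 s; set U := s ^+ a; set V := X0 s.
  have -> : k.+1%:R * U * V + (a%:R * U * V + Y) = N * (U * V) + Y.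
    by rewrite /N -addSn natrD; move: (k.+1%:R : R) (a%:R : R) => u v; ring.
  rewrite mulrDr (mulrA N^-1 N) (mulVf N0) mul1r mulNr; move: (N^-1 * Y) (C * _) => u v; clear; ring.
Unshelve. all: by end_near. Qed.

End reductions.
End radial_profiles.

(** * Solving the dbar equation one variable at a time *)

Section reduction.
Context {R : realType} {n : nat}.
Local Notation C := R[i].
Local Notation Cn := 'rV[R[i]]_n.
Local Open Scope complex_scope.
Implicit Types (phi psi : Cn -> C) (z : Cn) (i j : 'I_n) (u v : 'I_n -> Cn -> C).

#[local] Opaque partial rpartial.

Context (p : Cn) (r : R) (r0 : 0 < r) (X0 X D : R -> R) (profiles : cutoff_profiles r X0 X D).

Lemma real_complexD (x y : R) : (x + y)%:C = x%:C + y%:C.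
Proof. exact: rmorphD. Qed.

Lemma real_complexM (x y : R) : (x * y)%:C = x%:C * y%:C.
Proof. exact: rmorphM. Qed.

Lemma real_complexB (x y : R) : (x - y)%:C = x%:C - y%:C.
Proof. exact: rmorphB. Qed.

(** Smooth functions of the single complex variable z_j *)
Definition factor j phi := csmooth phi /\ forall e i z, i != j -> wirtinger e i phi z = 0.

Definition cfactor j phi := factor j phi /\ forall z, 32 * r ^+ 2 <= sqdist p j z -> phi z = 0.

Lemma factor_partial j phi : csmooth phi ->
  (forall i z, i != j -> partial (inl i) phi z = 0 /\ partial (inr i) phi z = 0) -> factor j phi.
Proof.
by move=> sp H; split=> // e i z ij; have [h1 h2] := H i z ij; rewrite /wirtinger h1 h2 mulr0 addr0 mul0r.
Qed.

Lemma factor_wcoord j : factor j (wcoord p j).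
Proof.
apply: factor_partial (csmooth_wcoord p j) _ => i z /negbTE ij.
by rewrite !partial_wcoord !inl_eqE !inr_eqE ij.
Qed.

Lemma factor_wconj j : factor j (wconj p j).
Proof.
apply: factor_partial (csmooth_wconj p j) _ => i z /negbTE ij.
by rewrite !partial_wconj !inl_eqE !inr_eqE ij oppr0.
Qed.

Lemma factor_radial j h : smooth1 h -> factor j (radial p h j).
Proof.
move=> sh; apply: factor_partial (csmooth_radial p j sh) _ => i z /negbTE ij.
by rewrite !partial_radial// !inl_eqE !inr_eqE ij !mul0r addr0 mulr0 mulr0.
Qed.

Lemma factorM j phi psi : factor j phi -> factor j psi -> factor j (fun z => phi z * psi z).
Proof.
move=> [sp Hp] [sq Hq]; split=> [|e i z ij]; first exact: csmoothM.
by rewrite (wirtingerM e i z sp sq) (Hp e i z ij) (Hq e i z ij) !mulr0 addr0.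
Qed.

Lemma factorX j phi m : factor j phi -> factor j (fun z => phi z ^+ m).
Proof.
move=> fp; elim: m => [|m IH].
  by split=> [|e i z _]; [exact: csmooth_cst|exact: wirtinger_cst].
by rewrite (_ : (fun z => _) = fun z => phi z * phi z ^+ m);
  [exact: factorM|apply/funext => z; rewrite exprS].
Qed.

Lemma cfactorM j phi psi : factor j phi -> cfactor j psi -> cfactor j (fun z => phi z * psi z).
Proof.
by move=> fp [fq Hq]; split=> [|z /Hq ->]; [exact: factorM|rewrite mulr0].
Qed.

Lemma cfactor_radial j h : smooth1 h -> (forall s, 32 * r ^+ 2 <= s -> h s = 0) ->
  cfactor j (radial p h j).
Proof. by move=> sh h0; split=> [|z /h0]; [exact: factor_radial|rewrite /radial => ->]. Qed.

Definition prod_factors u z : C := \prod_i u i z.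

Lemma csmooth_prod_factors u : (forall i, cfactor i (u i)) -> csmooth (prod_factors u).
Proof. by move=> fu; apply: csmooth_prod => i; have [[]] := fu i. Qed.

Lemma sqdist_cbox z : ~ cbox p (6 * r) z -> exists j, 32 * r ^+ 2 <= sqdist p j z.
Proof.
move/existsNP => [k /negP]; rewrite -ltNge => Hk.
have sq : 32 * r ^+ 2 <= (xcoord k z - xcoord k p) ^+ 2.
  rewrite -[leRHS]real_normK ?num_real//.
  apply: (@le_trans _ _ ((6 * r) ^+ 2)).
    by rewrite exprMn -natrX ler_wpM2r ?sqr_ge0// ler_nat.
  by rewrite ler_sqr ?nnegrE ?(ltW Hk)// mulr_ge0// ltW.
case: k sq {Hk} => j sq; exists j; apply: (le_trans sq); rewrite /sqdist.
  by rewrite lerDl sqr_ge0.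
by rewrite lerDr sqr_ge0.
Qed.

Lemma prod_factors_vanish u : (forall i, cfactor i (u i)) ->
  forall z, ~ cbox p (6 * r) z -> prod_factors u z = 0.
Proof.
move=> fu z /sqdist_cbox[j Hj]; rewrite /prod_factors (bigD1 j)//=.
by have [_ ->] := fu j; rewrite // mul0r.
Qed.

Definition set_factor j psi u : 'I_n -> Cn -> C := fun i => if i == j then psi else u i.

Lemma set_factorE j psi u z :
  prod_factors (set_factor j psi u) z = psi z * \prod_(i | i != j) u i z.
Proof.
rewrite /prod_factors (bigD1 j)//= /set_factor eqxx; congr (_ * _).
by apply: eq_bigr => i /negbTE ->.
Qed.

Lemma cfactor_set j psi u : (forall i, cfactor i (u i)) -> cfactor j psi ->
  forall i, cfactor i (set_factor j psi u i).
Proof. by move=> fu fp i; rewrite /set_factor; case: eqP => [->|_]. Qed.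

Lemma wirtinger_set_factor e j psi u z : (forall i, cfactor i (u i)) -> cfactor j psi ->
  wirtinger e j (prod_factors (set_factor j psi u)) z = prod_factors (set_factor j (wirtinger e j psi) u) z.
Proof.
move=> fu [[sp _] _].
have su i : csmooth (u i) by have [[]] := fu i.
have sm i : csmooth (if i == j then fun=> 1 else u i).
  by case: ifP => _; [exact: csmooth_cst|exact: su].
have E : prod_factors (set_factor j psi u) =
    fun y => psi y * \prod_i (if i == j then fun=> 1 else u i) y.
  apply/funext => y; rewrite set_factorE [in RHS](bigD1 j)//= eqxx mul1r; congr (_ * _).
  by apply: eq_bigr => i /negbTE ->.
rewrite E wirtingerM//; last exact: csmooth_prod.
rewrite (wirtinger_prod (j := j) (e := e) _ sm); last first.
  move=> i; case: eqP => [_|/eqP ij]; first exact: wirtinger_cst.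
  by have [[_ H] _] := fu i; apply: H; rewrite eq_sym.
rewrite mulr0 add0r set_factorE mulrC (bigD1 j)//= eqxx mul1r; congr (_ * _).
by apply: eq_bigr => i /negbTE ->.
Qed.

Definition admissible phi := csmooth phi /\ forall z, ~ cbox p (6 * r) z -> phi z = 0.

Definition dbar_closed (L : (Cn -> C) -> C) :=
  (forall (a : C) phi psi, admissible phi -> admissible psi ->
     L (fun z => a * phi z + psi z) = a * L phi + L psi) /\
  forall j psi, admissible psi -> L (wirtinger 1 j psi) = 0.

Lemma admissible_prod u : (forall i, cfactor i (u i)) -> admissible (prod_factors u).
Proof. by move=> fu; split; [exact: csmooth_prod_factors|exact: prod_factors_vanish]. Qed.

Lemma admissible_wirtinger e j psi : admissible psi -> admissible (wirtinger e j psi).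
Proof.
move=> [sp p0]; split; first exact: csmooth_wirtinger.
move=> z Hz; rewrite /wirtinger.
have H k : partial k psi z = 0 by exact: (partials_vanish p0 [:: k]).
by rewrite !H mulr0 addr0 mul0r.
Qed.

(** Modulo the image of dbar, the factors of a product may be replaced one by one: dbar_j acts on
  the j-th factor alone. *)
Lemma dbar_closed_reduce L (v E psi : 'I_n -> Cn -> C) (c : 'I_n -> C) : dbar_closed L ->
  (forall i, cfactor i (v i)) -> (forall i, cfactor i (E i)) -> (forall i, cfactor i (psi i)) ->
  (forall i z, v i z = c i * E i z + wirtinger 1 i (psi i) z) ->
  L (prod_factors v) = (\prod_i c i) * L (prod_factors E).
Proof.
move=> [Llin Ldbar] fv fE fpsi H.
pose mix (s : seq 'I_n) i := if i \in s then E i else v i.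
have fmix s i : cfactor i (mix s i) by rewrite /mix; case: ifP.
suff claim s : uniq s -> L (prod_factors v) = (\prod_(i <- s) c i) * L (prod_factors (mix s)).
  rewrite (claim (index_enum 'I_n)) ?index_enum_uniq//; congr (_ * L _).
  by apply/funext => z; apply: eq_bigr => i _; rewrite /mix mem_index_enum.
elim: s => [_|j s IH /= /andP[js us]]; first by rewrite big_nil mul1r.
rewrite IH// big_cons [c j * _]mulrC -mulrA; congr (_ * _).
have E1 : prod_factors (mix s) = fun z => c j * prod_factors (mix (j :: s)) z +
    wirtinger 1 j (prod_factors (set_factor j (psi j) (mix s))) z.
  apply/funext => z; rewrite wirtinger_set_factor// set_factorE /prod_factors.
  rewrite (bigD1 j)//= [in RHS](bigD1 j)//= {1}/mix (negbTE js) H {2}/mix mem_head mulrDl mulrA.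
  congr (_ * _ + _); apply: eq_bigr => i /negbTE ij; by rewrite /mix inE ij.
have adm : admissible (prod_factors (set_factor j (psi j) (mix s))).
  by apply: admissible_prod; exact: cfactor_set.
rewrite E1 Llin; [|exact: admissible_prod|exact: admissible_wirtinger].
by rewrite Ldbar// addr0.
Qed.

(** * Smeared Cauchy kernels *)

(** Since s = w conj(w), this is D / w^k: a Cauchy kernel averaged over circles. *)
Definition normal_factor k j z : C := wconj p j z ^+ k * radial p (fun s => D s / s ^+ k) j z.

Lemma cfactor_normal k j : cfactor j (normal_factor k j).
Proof.
have [_ _ [_ _ _ [_ D32 _]]] := profiles.
apply: cfactorM; first by apply: factorX; exact: factor_wconj.
by apply: cfactor_radial => [|s /D32 ->]; [exact: (smooth1_D_div r0 profiles)|rewrite mul0r].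
Qed.

Lemma dbar_wcoord_radial m j G z : smooth1 G ->
  wirtinger 1 j (fun y => wcoord p j y ^+ m * radial p G j y) z =
  wcoord p j z ^+ m.+1 * radial p (derive1 G) j z.
Proof.
move=> sG.
rewrite (wirtingerM 1 j z (csmoothX m (csmooth_wcoord p j)) (csmooth_radial p j sG)).
rewrite (dbar_radial j p j z sG) eqxx mul1r.
have -> : wirtinger 1 j (fun y => wcoord p j y ^+ m) z = 0.
  case: m => [|m]; first exact: wirtinger_cst.
  by rewrite (wirtingerX 1 j m z (csmooth_wcoord p j)) dbar_wcoord mulr0.
by rewrite mulr0 addr0 mulrA -exprSr.
Qed.

Lemma d_wconj_radial m j G z : smooth1 G ->
  wirtinger (-1) j (fun y => wconj p j y ^+ m * radial p G j y) z =
  wconj p j z ^+ m.+1 * radial p (derive1 G) j z.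
Proof.
move=> sG.
rewrite (wirtingerM (-1) j z (csmoothX m (csmooth_wconj p j)) (csmooth_radial p j sG)).
rewrite (d_radial j p j z sG) eqxx mul1r.
have -> : wirtinger (-1) j (fun y => wconj p j y ^+ m) z = 0.
  case: m => [|m]; first exact: wirtinger_cst.
  by rewrite (wirtingerX (-1) j m z (csmooth_wconj p j)) d_wconj mulr0.
by rewrite mulr0 addr0 mulrA -exprSr.
Qed.

Lemma dbar_wconj_radial k j H z : smooth1 H ->
  wirtinger 1 j (fun y => wconj p j y ^+ k.+1 * radial p H j y) z =
  wconj p j z ^+ k * radial p (fun s => k.+1%:R * H s + s * derive1 H s) j z.
Proof.
move=> sH.
rewrite (wirtingerM 1 j z (csmoothX k.+1 (csmooth_wconj p j)) (csmooth_radial p j sH)).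
rewrite (dbar_radial j p j z sH) eqxx mul1r.
rewrite (wirtingerX 1 j k z (csmooth_wconj p j)) dbar_wconj eqxx mulr1 /radial.
rewrite real_complexD !real_complexM (rmorph_nat (real_complex R)) -(wcoord_wconj p j z).
move: (wcoord p j z) (wconj p j z) (H _)%:C (derive1 H _)%:C => w c a b.
by rewrite exprS; ring.
Qed.

Lemma wcoordX_wconjX m j z : wcoord p j z ^+ m * wconj p j z ^+ m = (sqdist p j z ^+ m)%:C.
Proof. by rewrite -exprMn wcoord_wconj rmorphXn. Qed.

Definition power_factor (a b : nat) j z : C :=
  wcoord p j z ^+ a * wconj p j z ^+ b * radial p X0 j z.

Lemma cfactor_power a b j : cfactor j (power_factor a b j).
Proof.
have [[sX0 _ X0r _] _ _] := profiles.
apply: cfactorM; first by apply: factorM; apply: factorX; [exact: factor_wcoord|exact: factor_wconj].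
apply: cfactor_radial => // s Hs; apply: X0r; apply: le_trans Hs.
by have := sqr_ge0 r; lra.
Qed.

(** If a > b, the factor w^a conj(w)^b X0 = w^(a-b) s^b X0 is the dbar derivative of w^(a-b-1) G(s)
  with G' = s^b X0. If a <= b, it is conj(w)^k s^a X0 with k = b - a, and dbar of conj(w)^(k+1) H(s)
  changes it into a multiple of the kernel. *)
Lemma power_factor_reduce a b j : exists (c : C) (k : nat) (psi : Cn -> C),
  cfactor j psi /\ forall z, power_factor a b j z = c * normal_factor k j z + wirtinger 1 j psi z.
Proof.
have [ba|ab] := ltnP b a.
  have [G [sG G0 dG]] := radial_primitive profiles b.
  exists 0, 0%N, (fun y => wcoord p j y ^+ (a - b).-1 * radial p G j y); split.
    apply: cfactorM; first by apply: factorX; exact: factor_wcoord.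
    by apply: cfactor_radial => // s Hs; apply: G0; apply: le_trans Hs; have := sqr_ge0 r; lra.
  move=> z; rewrite mul0r add0r dbar_wcoord_radial// prednK ?subn_gt0// /power_factor.
  rewrite (_ : derive1 G = fun s => s ^+ b * X0 s); last by apply/funext => s; exact: is_derive_derive1.
  by rewrite -{1}(subnK (ltnW ba)) exprD -[X in X * _]mulrA wcoordX_wconjX -mulrA /radial [in RHS]real_complexM.
have [c [H [sH H0 HE]]] := moment_primitive r0 profiles a (b - a).
exists c%:C, (b - a)%N, (fun y => wconj p j y ^+ (b - a).+1 * radial p H j y); split.
  by apply: cfactorM; [by apply: factorX; exact: factor_wconj|exact: cfactor_radial].
move=> z; rewrite dbar_wconj_radial// /power_factor /normal_factor.
rewrite -{1}(subnKC ab) exprD mulrA wcoordX_wconjX /radial HE real_complexB !real_complexM.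
move: (sqdist p j z ^+ a)%:C (wconj _ _ _ ^+ _) (X0 _)%:C c%:C (D _)%:C (sqdist _ _ _ ^- _)%:C => x y t w d u.
by ring.
Qed.

End reduction.

(** * Biorthogonality of monomials and kernels *)

Section orthogonality.
Context {R : realType} {n : nat}.
Local Notation C := R[i].
Local Notation Re := (@complex.Re R).
Local Notation Cn := 'rV[R[i]]_n.
Local Notation K := {ffun 'I_n -> nat}.
Local Open Scope complex_scope.
Implicit Types (phi psi : Cn -> C) (z : Cn) (i j : 'I_n) (alpha beta : K).

#[local] Opaque partial rpartial.

Context (p : Cn) (r : R) (r0 : 0 < r) (X0 X D : R -> R) (profiles : cutoff_profiles r X0 X D).

Lemma monomialE beta z : monomial beta (z - p) = \prod_j wcoord p j z ^+ beta j.
Proof. by apply: eq_bigr => j _; rewrite !mxE. Qed.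

Lemma csmooth_monomial beta : csmooth (fun z => monomial beta (z - p)).
Proof.
rewrite (_ : (fun z => _) = fun z => \prod_j wcoord p j z ^+ beta j).
  by apply: csmooth_prod => j; apply: csmoothX; exact: csmooth_wcoord.
by apply/funext => z; rewrite monomialE.
Qed.

Lemma dbar_monomial i beta z : wirtinger 1 i (fun z => monomial beta (z - p)) z = 0.
Proof.
rewrite (_ : (fun z => _) = fun z => \prod_j wcoord p j z ^+ beta j); last first.
  by apply/funext => y; rewrite monomialE.
apply: wirtinger_prod => j; first by apply: csmoothX; exact: csmooth_wcoord.
case: (beta j) => [|m]; first exact: wirtinger_cst.
by rewrite (wirtingerX 1 i m z (csmooth_wcoord p j)) dbar_wcoord mulr0.
Qed.

Let A0 : 0 < 6 * r. Proof. by rewrite mulr_gt0. Qed.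

Definition monomial_pairing beta phi : C := cint (fun z => monomial beta (z - p) * phi z).

Lemma admissible_ccsupp phi : admissible p r phi -> ccsupp p (6 * r) phi.
Proof. by move=> [sp p0]; exact: ccsupp_smooth. Qed.

Lemma admissibleM phi psi : csmooth psi -> admissible p r phi -> admissible p r (fun z => psi z * phi z).
Proof. by move=> sq [sp p0]; split=> [|z /p0 ->]; [exact: csmoothM|rewrite mulr0]. Qed.

Lemma monomial_pairing_closed beta : dbar_closed p r (monomial_pairing beta).
Proof.
split=> [a phi psi ap aq|j psi aq].
  rewrite /monomial_pairing -(cint_lin (p := p) (A := 6 * r) a A0); last 2 first.
  - by apply: admissible_ccsupp; apply: admissibleM => //; exact: csmooth_monomial.
  - by apply: admissible_ccsupp; apply: admissibleM => //; exact: csmooth_monomial.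
  congr cint; apply/funext => z; move: (monomial _ _) (phi z) (psi z) => u v w; ring.
have [sq q0] := admissibleM (csmooth_monomial beta) aq.
rewrite /monomial_pairing -(cint_wirtinger 1 j A0 sq q0); congr cint; apply/funext => z.
have [sp _] := aq.
by rewrite (wirtingerM 1 j z (csmooth_monomial beta) sp) dbar_monomial mulr0 addr0.
Qed.

Definition normal_product alpha : Cn -> C := prod_factors (fun j => normal_factor p D (alpha j) j).

Definition annular_mass : C := cint (prod_factors (radial p D)).

Lemma cfactor_annular j : cfactor p r j (radial p D j).
Proof.
have [_ _ [sD _ _ [_ D32 _]]] := profiles; exact: cfactor_radial.
Qed.

Lemma annular_mass_neq0 : annular_mass != 0.
Proof.
have [_ _ [sD _ D0 [_ _ Dpos]]] := profiles.
pose f z : R := \prod_j D (sqdist p j z).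
have E z : prod_factors (radial p D) z = (f z)%:C.
  by rewrite /prod_factors /f (rmorph_prod (real_complex R)).
have adm := admissible_prod r0 cfactor_annular.
have [cf _] := ccsuppP (admissible_ccsupp adm).
have Ef : Re \o prod_factors (radial p D) = f by apply/funext => z; rewrite /= E.
rewrite Ef in cf.
have H : 0 < rint f.
  (* 25 r^2 lies between 16 r^2 and 32 r^2. *)
  pose z0 : Cn := \row_j (p 0 j + (5 * r)%:C).
  apply: (rint_gt0 (z0 := z0) A0 cf) => [z|]; first exact: prodr_ge0.
  apply: prodr_gt0 => j _.
  have -> : sqdist p j z0 = 25 * r ^+ 2.
    by rewrite /sqdist /xcoord /z0 !mxE; case: (p 0 j) => a b /=; ring.
  by apply: Dpos; rewrite ltr_pM2r ?exprn_gt0// ltr_nat.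
apply/eqP => /(congr1 Re); rewrite /annular_mass /cint Ef /= => H0.
by move: H; rewrite H0 ltxx.
Qed.

Lemma set_factor_eq j (u v : 'I_n -> Cn -> C) : (forall i, i != j -> u i = v i) ->
  prod_factors u = prod_factors (set_factor j (u j) v).
Proof.
move=> H; apply/funext => z; rewrite set_factorE /prod_factors (bigD1 j)//=; congr (_ * _).
by apply: eq_bigr => i /H ->.
Qed.

Lemma annular_cancel b m s : s ^+ b * (D s / s ^+ (b + m)) = D s / s ^+ m.
Proof.
have [_ _ [_ _ _ [D16 _ _]]] := profiles.
have [Hs|Hs] := leP s (16 * r ^+ 2); first by rewrite D16// !mul0r mulr0.
have s0 : s != 0 by rewrite gt_eqF//; apply: lt_trans Hs; rewrite mulr_gt0// exprn_gt0.
by rewrite exprD invfM mulrCA [s ^+ b * _]mulrA divff ?expf_neq0// mul1r.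
Qed.

(** If the exponents differ at j, the j-th factor of the integrand is a positive power of w or
  conj(w) times a radial function on the annulus, hence the dbar or d derivative of a function of
  compact support, and its integral vanishes. If they agree, only the radial functions D remain. *)
Lemma monomial_pairing_normal beta alpha :
  monomial_pairing beta (normal_product alpha) = if beta == alpha then annular_mass else 0.
Proof.
have [_ _ [sD _ _ [D16 D32 _]]] := profiles.
pose u j z := wcoord p j z ^+ beta j * normal_factor p D (alpha j) j z.
have fu j : cfactor p r j (u j).
  apply: cfactorM; first by apply: factorX; exact: factor_wcoord.
  exact: (cfactor_normal p r0 profiles).
have E : (fun z => monomial beta (z - p) * normal_product alpha z) = prod_factors u.
  by apply/funext => z; rewrite monomialE /normal_product /prod_factors -big_split.
rewrite /monomial_pairing E; case: eqP => [ba|/eqP ba].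
  rewrite /annular_mass; congr cint; apply/funext => z; apply: eq_bigr => j _.
  rewrite /u ba /normal_factor mulrA wcoordX_wconjX /radial -real_complexM; congr (_%:C).
  by rewrite -[X in _ / _ ^+ X]addn0 annular_cancel expr0 divr1.
have /existsP[j jba] : [exists j, beta j != alpha j].
  rewrite -negb_forall; apply: contra ba => /forallP H; apply/eqP/ffunP => j; exact/eqP.
suff [e [psi [fpsi psiE]]] : exists e psi, cfactor p r j psi /\ u j = wirtinger e j psi.
  rewrite (set_factor_eq (v := u) (j := j))// psiE.
  have adm := admissible_prod r0 (cfactor_set fu fpsi).
  rewrite -[RHS](cint_wirtinger e j A0 adm.1 adm.2); congr cint; apply/funext => z.
  by rewrite (wirtinger_set_factor e z fu fpsi).
move: jba; rewrite neq_ltn => /orP[lt|lt].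
  have [G [sG G0 dG]] := annular_primitive r0 profiles (alpha j - beta j).
  exists (-1), (fun y => wconj p j y ^+ (alpha j - beta j).-1 * radial p G j y); split.
    apply: cfactorM; first by apply: factorX; exact: factor_wconj.
    exact: cfactor_radial.
  have GE : derive1 G = fun s => D s / s ^+ (alpha j - beta j).
    by apply/funext => s; exact: is_derive_derive1.
  apply/funext => z; rewrite d_wconj_radial// GE prednK ?subn_gt0// /u /normal_factor.
  rewrite -{1 2}(subnKC (ltnW lt)) exprD !mulrA wcoordX_wconjX mulrAC [RHS]mulrC; congr (_ * _).
  by rewrite /radial -real_complexM annular_cancel.
have [G [sG G0 dG]] := annular_primitive r0 profiles 0.
exists 1, (fun y => wcoord p j y ^+ (beta j - alpha j).-1 * radial p G j y); split.
  apply: cfactorM; first by apply: factorX; exact: factor_wcoord.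
  exact: cfactor_radial.
have GE : derive1 G = fun s => D s / s ^+ 0 by apply/funext => s; exact: is_derive_derive1.
apply/funext => z; rewrite dbar_wcoord_radial// GE prednK ?subn_gt0// /u /normal_factor.
rewrite -{1}(subnK (ltnW lt)) exprD mulrA -[X in X * _]mulrA wcoordX_wconjX -mulrA; congr (_ * _).
by rewrite /radial -real_complexM -[X in _ / _ ^+ X]addn0 annular_cancel.
Qed.

End orthogonality.

(** * Geometric growth of the coefficients *)

Section growth.
Context {R : realType} {n : nat}.
Local Notation C := R[i].
Local Notation normc := (@Normc.normc R).
Local Notation Cn := 'rV[R[i]]_n.
Local Notation K := {ffun 'I_n -> nat}.
Local Open Scope complex_scope.
Implicit Types (phi psi : Cn -> C) (z : Cn) (i j : 'I_n) (alpha beta : K).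

#[local] Opaque partial rpartial.

Context (p : Cn) (r : R) (r0 : 0 < r) (X0 X D : R -> R) (profiles : cutoff_profiles r X0 X D).

Lemma CN_norm_ge0 N phi : 0 <= CN_norm N phi.
Proof.
rewrite /CN_norm; set S := [set _ | _].
have [ub|nub] := pselect (has_ubound S); last first.
  by rewrite sup_out// => -[].
apply: le_trans (normc_ge0 (phi 0)) _.
by apply: ub_le_sup => //; exists [::], 0.
Qed.

Lemma normc_sqdist (x : C) : normc x ^+ 2 = complex.Re x ^+ 2 + complex.Im x ^+ 2.
Proof. by case: x => a b /=; rewrite sqr_sqrtr// addr_ge0 ?sqr_ge0. Qed.

Lemma normc_wcoord j z : normc (wcoord p j z) ^+ 2 = sqdist p j z.
Proof. by rewrite normc_sqdist wcoordE. Qed.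

Lemma normc_wconj j z : normc (wconj p j z) ^+ 2 = sqdist p j z.
Proof. by rewrite normc_sqdist wconjE /= sqrrN. Qed.

(** W agrees with 1 / w_j on the annulus carrying D. There |w_j| >= 4 r, and W can be cut off inside
  the disc of radius sqrt 8 r, which leaves |W| <= 1 / (sqrt 8 r) < 2 / (5 r). *)
Lemma inverse_factor : exists W : 'I_n -> Cn -> C, forall j, [/\ csmooth (W j),
  (forall z, normc (W j z) <= 2 / (5 * r)) &
  (forall k z, normal_factor p D k j z = W j z ^+ k * radial p D j z)].
Proof.
have [_ _ [sD _ _ [D16 _ _]]] := profiles.
have [st [d [[sst st1 st2 st01] _ _ _]]] := @exists_cutoff R.
have r20 : 0 < r ^+ 2 by rewrite exprn_gt0.
pose Y (s : R) : R := 1 - st ((8 * r ^+ 2)^-1 * s).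
have sY : smooth1 Y.
  rewrite (_ : Y = fun s => 1 + (-1) * st ((8 * r ^+ 2)^-1 * s)); last first.
    by apply/funext => s; rewrite mulN1r.
  apply: smooth1D; first exact: smooth1_cst.
  by apply: smooth1M; [exact: smooth1_cst|exact: smooth1_scale].
have Y0 s : s <= 8 * r ^+ 2 -> Y s = 0.
  by move=> Hs; rewrite /Y st1 ?subrr// mulrC ler_pdivrMr ?mulr_gt0// mul1r.
have Y1 s : 16 * r ^+ 2 < s -> Y s = 1.
  move=> Hs; rewrite /Y st2 ?subr0// mulrC ler_pdivlMr ?mulr_gt0//.
  by apply: le_trans (ltW Hs); rewrite mulrA -natrM.
have Y01 s : 0 <= Y s <= 1.
  by rewrite /Y subr_ge0 lerBlDr lerDl; have [/andP[-> ->]] := (st01 ((8 * r ^+ 2)^-1 * s), tt).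
have sYd : smooth1 (fun s => Y s / s ^+ 1).
  by apply: (@smooth1_divX _ _ (8 * r ^+ 2)) => //; rewrite mulr_gt0.
exists (fun j z => wconj p j z * radial p (fun s => Y s / s ^+ 1) j z) => j; split.
- by apply: csmoothM; [exact: csmooth_wconj|exact: csmooth_radial].
- move=> z; have b0 : 0 <= 2 / (5 * r) by rewrite divr_ge0// mulr_ge0// ltW.
  rewrite -(ler_pXn2r (n := 2))// ?nnegrE ?normc_ge0// Normc.normcM exprMn normc_wconj normc_real.
  rewrite real_normK ?num_real// expr1.
  have [Hs|Hs] := leP (sqdist p j z) (8 * r ^+ 2).
    by rewrite Y0// mul0r expr0n mulr0 exprn_ge0.
  have s0 : 0 < sqdist p j z by apply: lt_trans Hs; rewrite mulr_gt0.
  move: (sqdist p j z) Hs s0 => s Hs s0.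
  apply: (@le_trans _ _ s^-1).
    rewrite (_ : _ * _ = s^-1 * Y s ^+ 2); last by field; rewrite gt_eqF.
    rewrite -[leRHS]mulr1 ler_wpM2l ?invr_ge0 ?(ltW s0)//.
    by have /andP[h1 h2] := Y01 s; rewrite expr_le1.
  rewrite invf_ple ?posrE//; last by rewrite exprn_gt0// divr_gt0// mulr_gt0.
  apply: le_trans (ltW Hs); rewrite -exprVn invf_div expr_div_n exprMn ler_pdivrMr ?exprn_gt0//.
  by lra.
- move=> k z; rewrite /normal_factor exprMn -mulrA; congr (_ * _).
  rewrite /radial -(rmorphXn (real_complex R)) -real_complexM; congr (_%:C).
  have [Hs|Hs] := leP (sqdist p j z) (16 * r ^+ 2); first by rewrite D16// mul0r mulr0.
  by rewrite Y1// expr1 mul1r exprVn mulrC.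
Qed.

Definition dominated (T : (Cn -> C) -> C) N (M : R) := forall phi, admissible p r phi ->
  normc (T phi) <= M * CN_norm N phi.

(** In a C^N norm of small weight, W has norm at most 1 / (2 r), because its values stay strictly
  below that number; submultiplicativity then bounds the kernels. On the disc of radius r, the rate
  1 / (2 r) means convergence with ratio 1 / 2. *)
Lemma normal_product_bound T N M : dominated T N M ->
  exists2 B, 0 <= B & forall alpha, normc (T (normal_product p D alpha)) <=
    B * \prod_j (1 / (2 * r)) ^+ alpha j.
Proof.
move=> HT; have [W HW] := inverse_factor.
have sW j : csmooth (W j) by have [] := HW j.
have [_ _ [sD _ _ _]] := profiles.
have sDj j := csmooth_radial p j sD.
have q0 : 0 <= 2 / (5 * r) by rewrite divr_ge0// mulr_ge0// ltW.
have qq : 2 / (5 * r) < 1 / (2 * r).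
  rewrite (_ : 2 / (5 * r) = 2 / 5 * r^-1); last by field; rewrite gt_eqF.
  rewrite (_ : 1 / (2 * r) = 1 / 2 * r^-1); last by field; rewrite gt_eqF.
  by rewrite ltr_pM2r ?invr_gt0//; lra.
have /choice[l1 Hl1] : forall j, exists lam0, 0 < lam0 /\ forall lam, 0 < lam -> lam <= lam0 ->
    bounded_derivs lam (cbox p (6 * r)) N (W j) (1 / (2 * r)).
  move=> j; have [_ WB _] := HW j.
  by have [l l0 H] := bounded_derivs_small N (sW j) q0 qq (fun z (_ : cbox p (6 * r) z) => WB z); exists l.
pose lam := \big[Num.min/1]_j l1 j.
have lam0 : 0 < lam by apply/bigmin_gtP; split => // j _; have [] := Hl1 j.
have lam1 : lam <= 1 by exact: bigmin_le_id.
have laml1 j : lam <= l1 j by exact: bigmin_le.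
have /choice[b Hb] j := bounded_derivs_exists lam p (6 * r) N (sDj j).
exists (`|M| * ((\prod_j b j) / lam ^+ N)).
  apply: mulr_ge0 => //; apply: divr_ge0; last by rewrite exprn_ge0// ltW.
  by apply: prodr_ge0 => j _; exact: bounded_derivs_ge0 (ltW lam0) (Hb j).
move=> alpha.
have [sE E0] := admissible_prod r0 (fun i => cfactor_normal p r0 profiles (alpha i) i).
apply: le_trans (HT _ (conj sE E0)) _; apply: (@le_trans _ _ (`|M| * CN_norm N (normal_product p D alpha))).
  by rewrite ler_wpM2r ?CN_norm_ge0// ler_norm.
rewrite -mulrA ler_wpM2l//.
have H : bounded_derivs lam (cbox p (6 * r)) N (normal_product p D alpha)
    (\prod_j ((1 / (2 * r)) ^+ alpha j * b j)).
  rewrite (_ : normal_product p D alpha = fun z => \prod_j (W j z ^+ alpha j * radial p D j z)); last first.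
    by apply/funext => z; apply: eq_bigr => j _; have [_ _ ->] := HW j.
  apply: bounded_derivs_prod; first exact: ltW.
    by move=> j; apply: csmoothM => //; exact: csmoothX.
  move=> j; apply: bounded_derivsM; [exact: ltW|exact: csmoothX|exact: sDj| |].
    by apply: bounded_derivsX; [exact: ltW|exact: sW|have [_] := Hl1 j; apply].
  exact: Hb.
apply: le_trans (CN_norm_bounded_derivs lam0 lam1 E0 H) _.
rewrite big_split /=; set u := \prod_j _ ^+ _; set v := \prod_j b j; rewrite -subr_ge0.
by rewrite (_ : _ - _ = 0)//; ring.
Qed.

End growth.

(** * Uniform limits, sums and polynomials *)

Section local_representation.
Context {R : realType} {n : nat}.
Local Notation C := R[i].
Local Notation Re := (@complex.Re R).
Local Notation Im := (@complex.Im R).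
Local Notation normc := (@Normc.normc R).
Local Notation Cn := 'rV[R[i]]_n.
Local Notation dir := ('I_n + 'I_n)%type.
Local Notation K := {ffun 'I_n -> nat}.
Local Open Scope complex_scope.
Implicit Types (phi psi g Q : Cn -> C) (p z : Cn) (i j : 'I_n) (alpha beta a b : K).

#[local] Opaque partial rpartial.

Lemma continuous_uniform_limit g :
  (forall e : R, 0 < e -> exists2 f : Cn -> C, continuous f & forall z, normc (f z - g z) <= e) ->
  continuous g.
Proof.
move=> H z; apply/complex_continuousP; split; apply/cvgrPdist_lt => e e0;
  have [f cf Hf] := H (e / 4) (divr_gt0 e0 (ltr0n _ 4));
  have /complex_continuousP[/cvgrPdist_lt/(_ (e / 4) (divr_gt0 e0 (ltr0n _ 4))) cR
    /cvgrPdist_lt/(_ (e / 4) (divr_gt0 e0 (ltr0n _ 4))) cI] := cf z;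
  [move: cR|move: cI]; apply: filterS => y Hy;
  have [z1 z2] := normc_ge_abs (f z - g z); have [y1 y2] := normc_ge_abs (f y - g y);
  move: {Hf} (le_trans z1 (Hf z)) (le_trans z2 (Hf z)) (le_trans y1 (Hf y)) (le_trans y2 (Hf y)) => {z1 z2 y1 y2};
  rewrite !Re_D !Im_D !Re_N !Im_N.
  move: (Re (f z)) (Re (g z)) (Re (f y)) (Re (g y)) Hy => u v w x Hy z1 _ y1 _.
  by move: Hy z1 y1; rewrite !ltr_norml !ler_norml => /andP[? ?] /andP[? ?] /andP[? ?]; apply/andP; split; lra.
move: (Im (f z)) (Im (g z)) (Im (f y)) (Im (g y)) Hy => u v w x Hy _ z1 _ y1.
by move: Hy z1 y1; rewrite !ltr_norml !ler_norml => /andP[? ?] /andP[? ?] /andP[? ?]; apply/andP; split; lra.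
Qed.

Lemma ccsupp_bounded p A phi : ccsupp p A phi -> exists2 M, 0 <= M & forall z, normc (phi z) <= M.
Proof.
move=> /ccsuppP[[cR R0] [cI I0]].
have [M1 M10 H1] := continuous_bounded_cbox p A cR; have [M2 M20 H2] := continuous_bounded_cbox p A cI.
exists (M1 + M2); first exact: addr_ge0.
move=> z; apply: le_trans (normc_le_abs _) _.
have [Hz|Hz] := pselect (cbox p A z); first by apply: lerD; [exact: H1|exact: H2].
have := R0 z Hz; have := I0 z Hz; rewrite /= => -> ->; rewrite normr0 addr0; exact: addr_ge0.
Qed.

Lemma ccsupp_cst0 p A : ccsupp p A (fun=> 0).
Proof. by split => // z; exact: cvg_cst. Qed.

Lemma cint0 : cint (fun _ : Cn => 0) = 0.
Proof.
apply: etrans (mul0r (cint (fun _ : Cn => 0))); apply: etrans (cintZ 0 ltr01 (ccsupp_cst0 0 1)).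
by congr cint; apply/funext => z; rewrite mulr0.
Qed.

Lemma cint_sum p (A : R) (I : Type) (s : seq I) (c : I -> C) (F : I -> Cn -> C) : 0 < A ->
  (forall x : I, ccsupp p A (F x)) ->
  ccsupp p A (fun z => \sum_(i <- s) c i * F i z) /\
  cint (fun z => \sum_(i <- s) c i * F i z) = \sum_(i <- s) c i * cint (F i).
Proof.
move=> A0 cF; elim: s => [|i s [IH1 IH2]].
  rewrite (_ : (fun z => _) = fun=> 0); last by apply/funext => z; rewrite big_nil.
  rewrite big_nil; split; first exact: ccsupp_cst0.
  exact: cint0.
rewrite (_ : (fun z => _) = fun z => c i * F i z + \sum_(j <- s) c j * F j z); last first.
  by apply/funext => z; rewrite big_cons.
split; first by apply: ccsuppD => //; exact: ccsuppZ.
by rewrite (cint_lin (c i) A0 (cF i) IH1) IH2 big_cons.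
Qed.

Lemma eq_of_small (x y : C) (c : R) : (forall e, 0 < e -> normc (x - y) <= c * e) -> x = y.
Proof.
move=> H; apply/eqP; rewrite -subr_eq0; apply/eqP/Normc.eq0_normc/eqP.
rewrite eq_le normc_ge0 andbT; apply/ler_addgt0Pr => e e0; rewrite add0r.
have c1 : 0 < `|c| + 1 by rewrite ltr_wpDl.
apply: le_trans (H _ (divr_gt0 e0 c1)) _; apply: le_trans (ler_norm _) _.
rewrite normrM (ger0_norm (ltW (divr_gt0 e0 c1))) mulrCA -[leRHS]mulr1 ler_pM2l//.
by rewrite ler_pdivrMr// mul1r lerDl.
Qed.

(** The real coordinates are linear combinations of w_j and conj(w_j); so closure under
  multiplication by these reaches all polynomials. *)
Lemma sum_prod_poly_ind p (P : (Cn -> C) -> Prop) :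
  (forall (c : C) Q Q', P Q -> P Q' -> P (fun z => c * Q z + Q' z)) ->
  (forall j Q, P Q -> P (fun z => wcoord p j z * Q z)) ->
  (forall j Q, P Q -> P (fun z => wconj p j z * Q z)) ->
  P (fun=> 1) -> forall L, P (fun z => (sum_prod_poly p L z)%:C).
Proof.
move=> Plin Pw Pcw P1.
have P0 : P (fun=> 0).
  by rewrite (_ : (fun=> 0) = fun _ : Cn => -1 * 1 + 1); [exact: Plin|apply/funext => z; rewrite mulr1 addNr].
have PZ (c : C) Q : P Q -> P (fun z => c * Q z).
  by move=> PQ; rewrite (_ : (fun z => _) = fun z => c * Q z + 0); [exact: Plin|apply/funext => z; rewrite addr0].
have Px (k : dir) Q : P Q -> P (fun z => (xcoord k z - xcoord k p)%:C * Q z).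
  move=> PQ; case: k => j.
    rewrite (_ : (fun z => _) = fun z => 2^-1 * (wcoord p j z * Q z) + 2^-1 * (wconj p j z * Q z)).
      by apply: Plin; [exact: Pw|apply: PZ; exact: Pcw].
    apply/funext => z; rewrite -mulrDr -mulrDl mulrA; congr (_ * _).
    rewrite mulrC; apply/esym/divc2; rewrite wcoordE wconjE; move: (_ - _) (_ - _) => u v.
    by apply: complex_eqP; rewrite ?Re_D ?Im_D ?Re_M ?Im_M /=; ring.
  rewrite (_ : (fun z => _) = fun z => (- ('i / 2)) * (wcoord p j z * Q z) + ('i / 2) * (wconj p j z * Q z)).
    by apply: Plin; [exact: Pw|apply: PZ; exact: Pcw].
  apply/funext => z; rewrite mulNr -mulrN -mulrDr -mulNr -mulrDl mulrA; congr (_ * _).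
  rewrite mulrAC; apply/esym/divc2; rewrite wcoordE wconjE; move: (_ - _) (_ - _) => u v.
  by apply: complex_eqP; rewrite ?Re_D ?Im_D ?Re_M ?Im_M /=; ring.
have Ppoly (k : dir) (q : {poly R}) Q : P Q -> P (fun z => (q.[xcoord k z - xcoord k p])%:C * Q z).
  move=> PQ; elim/poly_ind: q => [|q c IH].
    by rewrite (_ : (fun z => _) = fun=> 0)//; apply/funext => z; rewrite horner0 mul0r.
  rewrite (_ : (fun z => _) = fun z => c%:C * Q z +
      (xcoord k z - xcoord k p)%:C * ((q.[xcoord k z - xcoord k p])%:C * Q z)).
    by apply: Plin => //; exact: Px.
  apply/funext => z; rewrite hornerMXaddC (real_complexD (_ * _)) real_complexM.
  by move: (q.[_])%:C (_ - _)%:C c%:C (Q z) => x y u v; ring.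
have Pprod (s : seq dir) (q : dir -> {poly R}) :
    P (fun z => (\prod_(k <- s) (q k).[xcoord k z - xcoord k p])%:C).
  elim: s => [|k s IH].
    by rewrite (_ : (fun z => _) = fun=> 1)//; apply/funext => z; rewrite big_nil.
  rewrite (_ : (fun z => _) = fun z => (q k).[xcoord k z - xcoord k p]%:C *
      (\prod_(k <- s) (q k).[xcoord k z - xcoord k p])%:C); first exact: Ppoly.
  by apply/funext => z; rewrite big_cons real_complexM.
elim=> [|cq L IH].
  by rewrite (_ : (fun z => _) = fun=> 0)//; apply/funext => z; rewrite /sum_prod_poly big_nil.
rewrite (_ : (fun z => _) = fun z => cq.1%:C * (prod_poly p cq.2 z)%:C + (sum_prod_poly p L z)%:C).
  by apply: Plin => //; exact: Pprod.
by apply/funext => z; rewrite /sum_prod_poly big_cons real_complexD real_complexM.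
Qed.

End local_representation.

(** * The Taylor series of a dbar-closed functional *)

Section power_series.
Context {R : realType} {n : nat}.
Local Notation C := R[i].
Local Notation normc := (@Normc.normc R).
Local Notation Cn := 'rV[R[i]]_n.
Local Notation K := {ffun 'I_n -> nat}.
Local Open Scope complex_scope.
Implicit Types (phi psi Q : Cn -> C) (z : Cn) (i j : 'I_n) (alpha beta a b : K).

#[local] Opaque partial rpartial.

Context (p : Cn) (r : R) (r0 : 0 < r) (X0 X D : R -> R) (profiles : cutoff_profiles r X0 X D).
Context (T : (Cn -> C) -> C) (N : nat) (M : R).
Context (T_closed : dbar_closed p r T) (T_dominated : dominated p r T N M).

Definition cutoff : Cn -> C := prod_factors (radial p X0).

Lemma cutoff_vanish z : ~ cbox p r z -> cutoff z = 0.
Proof.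
have [[_ _ X0r _] _ _] := profiles.
move/existsNP => [k /negP]; rewrite -ltNge => Hk.
have sq : r ^+ 2 <= (xcoord k z - xcoord k p) ^+ 2.
  rewrite -[leRHS]real_normK ?num_real//.
  by rewrite ler_sqr ?nnegrE ?(ltW Hk)// ltW.
suff [j Hj] : exists j, r ^+ 2 <= sqdist p j z.
  by rewrite /cutoff /prod_factors (bigD1 j)//= /radial X0r// mul0r.
case: k sq {Hk} => j sq; exists j; apply: (le_trans sq); rewrite /sqdist.
  by rewrite lerDl sqr_ge0.
by rewrite lerDr sqr_ge0.
Qed.

Lemma cutoff1 z : cbox p (r / 2) z -> cutoff z = 1.
Proof.
have [[_ X01 _ _] _ _] := profiles.
move=> Hz; rewrite /cutoff /prod_factors big1// => j _; rewrite /radial X01//.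
have sq k : (xcoord k z - xcoord k p) ^+ 2 <= (r / 2) ^+ 2.
  by rewrite -[leLHS]real_normK ?num_real// ler_sqr ?nnegrE ?divr_ge0 ?(ltW r0)//; exact: Hz.
have := lerD (sq (inl j)) (sq (inr j)); rewrite expr_div_n /sqdist => H.
by apply: (le_trans H); rewrite -natrX; lra.
Qed.

Lemma csmooth_cutoff : csmooth cutoff.
Proof.
by have [[sX0 _ _ _] _ _] := profiles; apply: csmooth_prod => j; exact: csmooth_radial.
Qed.

Lemma monomial_cutoff_bound alpha z : normc (monomial alpha (z - p) * cutoff z) <= \prod_j r ^+ alpha j.
Proof.
have [[_ _ X0r X001] _ _] := profiles.
rewrite monomialE /cutoff /prod_factors -big_split normc_prod /=.
apply: ler_prod => j _; rewrite normc_ge0 /= Normc.normcM normcX normc_real.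
have /andP[h0 h1] := X001 (sqdist p j z).
have [Hs|Hs] := leP (r ^+ 2) (sqdist p j z).
  by rewrite X0r// normr0 mulr0 exprn_ge0// ltW.
rewrite -[leRHS]mulr1; apply: ler_pM => //; first by rewrite exprn_ge0// normc_ge0.
  apply: lerXn2r; rewrite ?nnegrE ?normc_ge0 ?(ltW r0)//.
  by rewrite -(ler_pXn2r (n := 2))// ?nnegrE ?normc_ge0 ?(ltW r0)// normc_wcoord ltW.
by rewrite ger0_norm.
Qed.

Definition coefficient alpha : C := T (normal_product p D alpha) / annular_mass p D.

Definition series_term alpha z : C := coefficient alpha * (monomial alpha (z - p) * cutoff z).

(** The factor (1 / (2 r))^|alpha| of the coefficient meets the factor r^|alpha| of the monomial. *)
Lemma term_bound : exists2 B, 0 <= B & forall alpha z, normc (series_term alpha z) <= B * weight alpha.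
Proof.
have [B B0 HB] := normal_product_bound r0 profiles T_dominated.
have k0 : 0 < normc (annular_mass p D).
  rewrite lt_neqAle normc_ge0 andbT eq_sym; apply: contra (annular_mass_neq0 p r0 profiles).
  by move=> /eqP/Normc.eq0_normc ->.
have nV (x : C) : normc x != 0 -> normc x^-1 = (normc x)^-1.
  move=> x0; apply: (mulfI x0); rewrite -Normc.normcM [RHS]divff// mulfV ?Normc.normc1//.
  by apply: contra x0 => /eqP ->; rewrite Normc.normc0.
exists (B / normc (annular_mass p D)); first by rewrite divr_ge0// normc_ge0.
move=> alpha z; rewrite /series_term /coefficient Normc.normcM Normc.normcM nV ?gt_eqF//.
apply: (@le_trans _ _ (B * \prod_j (1 / (2 * r)) ^+ alpha j / normc (annular_mass p D) *
   \prod_j r ^+ alpha j)).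
  apply: ler_pM; rewrite ?normc_ge0//; first by rewrite mulr_ge0 ?invr_ge0 ?normc_ge0.
    by rewrite ler_pM2r ?invr_gt0.
  exact: monomial_cutoff_bound.
have -> : weight alpha = (\prod_j (1 / (2 * r)) ^+ alpha j) * \prod_j r ^+ alpha j.
  rewrite -big_split /=; apply: eq_bigr => j _; rewrite -exprMn; congr (_ ^+ _).
  by field; rewrite gt_eqF.
move: (\prod_j _) (\prod_j _) => u v.
by rewrite [leRHS]mulrA [X in _ <= X * _]mulrAC.
Qed.

Definition partial_series m z : C := \sum_(alpha <- index_box m) series_term alpha z.

Lemma csmooth_partial_series m : csmooth (partial_series m).
Proof.
apply: csmooth_sum => alpha; apply: csmoothZ; apply: csmoothM; last exact: csmooth_cutoff.
exact: csmooth_monomial.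
Qed.

Definition mixed_monomial a b z : C := \prod_j (wcoord p j z ^+ a j * wconj p j z ^+ b j).

Lemma csmooth_mixed a b : csmooth (mixed_monomial a b).
Proof.
by apply: csmooth_prod => j; apply: csmoothM; apply: csmoothX; [exact: csmooth_wcoord|exact: csmooth_wconj].
Qed.

Lemma cutoff_mixed a b : (fun z => cutoff z * mixed_monomial a b z) =
  prod_factors (fun j => power_factor p X0 (a j) (b j) j).
Proof.
apply/funext => z; rewrite mulrC /cutoff /mixed_monomial /prod_factors -big_split.
by apply: eq_bigr => j _.
Qed.

(** Both T and the pairings with monomials are dbar-closed, so the same reduction carries the mixed
  monomial to one kernel, with exponent k' say. By biorthogonality only the term of exponent k' of
  the partial sum contributes, and its coefficient is chosen to give T. *)
Lemma mixed_monomial_partial_series a b : exists m0, forall m, (m0 <= m)%N ->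
  cint (fun z => partial_series m z * mixed_monomial a b z) = T (fun z => cutoff z * mixed_monomial a b z).
Proof.
have /choice[c /choice[k /choice[psi Hpsi]]] j := power_factor_reduce p r0 profiles (a j) (b j) j.
pose v j := power_factor p X0 (a j) (b j) j.
pose k' : K := [ffun j => k j].
have fv j : cfactor p r j (v j) by exact: (cfactor_power p profiles).
have nE : normal_product p D k' = prod_factors (fun j => normal_factor p D (k j) j).
  by apply/funext => z; apply: eq_bigr => j _; rewrite ffunE.
have red L : dbar_closed p r L -> L (prod_factors v) = (\prod_j c j) * L (normal_product p D k').
  move=> LC; rewrite nE; apply: (dbar_closed_reduce r0 LC fv (psi := psi)).
  - by move=> j; exact: (cfactor_normal p r0 profiles).
  - by move=> j; have [] := Hpsi j.
  - by move=> j z; have [_] := Hpsi j; apply.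
have [m0 Hm0] := index_box_exhaust [:: k'].
exists m0 => m mm; have kin : k' \in index_box m by apply: (Hm0 m mm); rewrite mem_head.
have A0 : 0 < 6 * r by rewrite mulr_gt0.
have -> : (fun z => partial_series m z * mixed_monomial a b z) =
    fun z => \sum_(alpha <- index_box m) coefficient alpha * (monomial alpha (z - p) * prod_factors v z).
  apply/funext => z; rewrite /partial_series mulr_suml; apply: eq_bigr => alpha _.
  by rewrite /series_term -/(v) -cutoff_mixed !mulrA.
have adm := admissible_prod r0 fv.
have [_ ->] := cint_sum (index_box m) coefficient A0
  (fun alpha => admissible_ccsupp (admissibleM (csmooth_monomial p alpha) adm)).
rewrite (bigD1_seq k')//=; last exact: uniq_index_box.
rewrite cutoff_mixed -/v (red _ T_closed).
have pair alpha : cint (fun z => monomial alpha (z - p) * prod_factors v z) =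
    (\prod_j c j) * (if alpha == k' then annular_mass p D else 0).
  by have := red _ (monomial_pairing_closed p r0 alpha); rewrite (monomial_pairing_normal p r0 profiles).
rewrite big1; last by move=> alpha /negbTE ak; rewrite pair ak !mulr0.
rewrite addr0 pair eqxx /coefficient mulrCA [_ / _ * _]mulrC [annular_mass p D * _]mulrC divfK//.
exact: (annular_mass_neq0 p r0 profiles).
Qed.

End power_series.

(** * Local representation by a power series *)

Section local_theorem.
Context {R : realType} {n : nat}.
Local Notation C := R[i].
Local Notation Re := (@complex.Re R).
Local Notation Im := (@complex.Im R).
Local Notation normc := (@Normc.normc R).
Local Notation Cn := 'rV[R[i]]_n.
Local Notation dir := ('I_n + 'I_n)%type.
Local Notation K := {ffun 'I_n -> nat}.
Local Open Scope complex_scope.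
Implicit Types (phi psi Q : Cn -> C) (z : Cn) (i j : 'I_n) (alpha beta a b : K).

#[local] Opaque partial rpartial.

Section series_sum.
Context (p : Cn) (r : R) (r0 : 0 < r) (X0 X D : R -> R) (profiles : cutoff_profiles r X0 X D).
Context (T : (Cn -> C) -> C) (N : nat) (M : R).
Context (T_closed : dbar_closed p r T) (T_dominated : dominated p r T N M).

Local Notation term := (series_term p X0 D T).
Local Notation partial_series := (partial_series p X0 D T).
Local Notation chi := (cutoff p X0).

Lemma series_sum : exists g : Cn -> C, exists2 B : R, 0 <= B &
  forall z m s, uniq s -> {subset index_box m <= s} ->
    normc (\sum_(alpha <- s) term alpha z - g z) <= 2 * B * @tail_weight R n m.
Proof.
have [B B0 HB] := term_bound r0 profiles T_dominated.
have /choice[g Hg] z := multi_series B0 (HB^~ z).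
by exists g, B.
Qed.

Context (g : Cn -> C) (B : R) (B0 : 0 <= B) (Hg : forall z m s, uniq s -> {subset index_box m <= s} ->
    normc (\sum_(alpha <- s) term alpha z - g z) <= 2 * B * @tail_weight R n m).

Lemma series_tail m z : normc (partial_series m z - g z) <= 2 * B * @tail_weight R n m.
Proof. by apply: Hg => //; exact: uniq_index_box. Qed.

Lemma tail_small (e : R) : 0 < e -> exists m0, forall m, (m0 <= m)%N -> 2 * B * @tail_weight R n m <= e.
Proof.
move=> e0; have B1 : 0 < 2 * B + 1 by rewrite ltr_wpDl// mulr_ge0.
have [m0 Hm0] := @tail_weight_small R n _ (divr_gt0 e0 B1).
exists m0 => m /Hm0 H; have t0 := @tail_weight_ge0 R n m.
move: H; rewrite ler_pdivlMr// mulrDr mulr1 mulrC => H; apply: le_trans H.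
by rewrite lerDl.
Qed.

Lemma partial_series_vanish m z : ~ cbox p r z -> partial_series m z = 0.
Proof.
move=> Hz; rewrite /partial_series big1// => alpha _.
by rewrite /series_term (cutoff_vanish r0 profiles Hz) !mulr0.
Qed.

Lemma continuous_series : continuous g.
Proof.
apply: continuous_uniform_limit => e e0; have [m0 /(_ m0 (leqnn _)) H] := tail_small e0.
exists (partial_series m0); first exact: (csmooth_continuous (csmooth_partial_series p profiles T m0)).
by move=> z; apply: le_trans H; exact: series_tail.
Qed.

Lemma series_vanish z : ~ cbox p r z -> g z = 0.
Proof.
move=> Hz; apply/esym; apply: (eq_of_small (c := 1)) => e e0; rewrite mul1r.
have [m0 /(_ m0 (leqnn _)) H] := tail_small e0; apply: le_trans H.
by rewrite -(partial_series_vanish m0 Hz); exact: series_tail.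
Qed.

Lemma ccsupp_series : ccsupp p r g.
Proof. by split; [exact: continuous_series|exact: series_vanish]. Qed.

(** Uniform convergence of the partial sums allows passing to the limit under the integral. *)
Lemma mixed_monomial_series a b :
  T (fun z => chi z * mixed_monomial p a b z) = cint (fun z => g z * mixed_monomial p a b z).
Proof.
have sm := csmooth_mixed p a b; have cm := csmooth_continuous sm.
have [Mm Mm0 HMm] := csmooth_bounded p r sm.
have [m1 Hm1] := mixed_monomial_partial_series r0 profiles T_closed a b.
apply: (eq_of_small (c := 2 * (Mm * @box_volume R n r))) => e e0.
have [m2 Hm2] := tail_small e0.
pose m := maxn m1 m2.
rewrite -(Hm1 m (leq_maxl _ _)).
have cg := ccsuppM ccsupp_series cm.
have cf : ccsupp p r (fun z => partial_series m z * mixed_monomial p a b z).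
  split=> [|z Hz].
    exact: (continuous_cM (csmooth_continuous (csmooth_partial_series p profiles T m)) cm).
  by rewrite (partial_series_vanish m Hz) mul0r.
have E := cint_lin (-1) r0 cg cf; rewrite mulN1r addrC in E; rewrite -E.
apply: le_trans (cint_norm_le (M := Mm * e) r0 (ccsuppD (ccsuppZ (-1) cg) cf) _) _; last first.
  by rewrite [Mm * e * _]mulrAC !mulrA lexx.
move=> z.
have -> : -1 * (g z * mixed_monomial p a b z) + partial_series m z * mixed_monomial p a b z =
    (partial_series m z - g z) * mixed_monomial p a b z.
  by move: (g z) (partial_series m z) (mixed_monomial p a b z) => u v w; ring.
have [Hz|Hz] := pselect (cbox p r z).
  rewrite Normc.normcM mulrC; apply: ler_pM; rewrite ?normc_ge0//; first exact: HMm.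
  by apply: le_trans (series_tail m z) _; apply: Hm2; exact: leq_maxr.
by rewrite (series_vanish Hz) (partial_series_vanish m Hz) subrr mul0r Normc.normc0 mulr_ge0// ltW.
Qed.

Local Notation sum_poly L1 L2 := (fun z => 'i * (sum_prod_poly p L2 z)%:C + (sum_prod_poly p L1 z)%:C).

Lemma csmooth_sum_prod_poly L : csmooth (fun z => (sum_prod_poly p L z)%:C).
Proof.
by apply: csmooth_real; apply: rsmooth_sum => cq; apply: rsmoothM; [exact: rsmooth_cst|exact: rsmooth_prod_poly].
Qed.

Lemma closed_lin (c : C) phi psi : csmooth phi -> csmooth psi ->
  T (fun z => chi z * (c * phi z + psi z)) = c * T (fun z => chi z * phi z) + T (fun z => chi z * psi z).
Proof.
move=> sp sq; have [Tlin _] := T_closed.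
have adm Q : csmooth Q -> admissible p r (fun z => chi z * Q z).
  move=> sQ; split; first by apply: csmoothM => //; exact: (csmooth_cutoff p profiles).
  move=> z Hz; rewrite (cutoff_vanish r0 profiles) ?mul0r//.
  by apply: contra_not Hz; apply: cbox_le; rewrite ler_peMl ?(ltW r0)// ler1n.
rewrite -(Tlin c _ _ (adm _ sp) (adm _ sq)); congr T; apply/funext => z.
by move: (chi z) (phi z) (psi z) => u v w; ring.
Qed.

Lemma series_lin (c : C) phi psi : csmooth phi -> csmooth psi ->
  cint (fun z => g z * (c * phi z + psi z)) = c * cint (fun z => g z * phi z) + cint (fun z => g z * psi z).
Proof.
move=> /csmooth_continuous cp /csmooth_continuous cq.
apply: etrans (cint_lin c r0 (ccsuppM ccsupp_series cp) (ccsuppM ccsupp_series cq)).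
by congr cint; apply/funext => z; move: (g z) (phi z) (psi z) => u v w; ring.
Qed.

(** An exponent raised by one absorbs a multiplication by w_j or conj(w_j). *)
Lemma polynomial_series L1 L2 : T (fun z => chi z * sum_poly L1 L2 z) = cint (fun z => g z * sum_poly L1 L2 z).
Proof.
pose P Q := csmooth Q /\ forall a b, T (fun z => chi z * (mixed_monomial p a b z * Q z)) =
  cint (fun z => g z * (mixed_monomial p a b z * Q z)).
have incr (a : K) j (w : C) (wj : 'I_n -> C) : wj j = w ->
    (\prod_i wj i ^+ a i) * w = \prod_i wj i ^+ ([ffun i => (a i + (i == j))%N] : K) i.
  move=> wE; rewrite (bigD1 j)//= [in RHS](bigD1 j)//= ffunE eqxx addn1 exprS wE mulrC mulrA; congr (_ * _).
  by apply: eq_bigr => i /negbTE ij; rewrite ffunE ij addn0.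
have Pw j Q : P Q -> P (fun z => wcoord p j z * Q z).
  move=> [sQ HQ]; split; first by apply: csmoothM => //; exact: csmooth_wcoord.
  move=> a b; have := HQ [ffun i => (a i + (i == j))%N] b.
  rewrite (_ : mixed_monomial p _ b = fun z => mixed_monomial p a b z * wcoord p j z).
    rewrite (_ : (fun z => chi z * _) = fun z => chi z * (mixed_monomial p a b z * (wcoord p j z * Q z))).
      rewrite (_ : (fun z => g z * _) = fun z => g z * (mixed_monomial p a b z * (wcoord p j z * Q z)))//.
      by apply/funext => z; rewrite !mulrA.
    by apply/funext => z; rewrite !mulrA.
  apply/funext => z; rewrite /mixed_monomial !big_split /= mulrAC; congr (_ * _).
  by rewrite (incr a j _ (fun i => wcoord p i z)).
have Pcw j Q : P Q -> P (fun z => wconj p j z * Q z).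
  move=> [sQ HQ]; split; first by apply: csmoothM => //; exact: csmooth_wconj.
  move=> a b; have := HQ a [ffun i => (b i + (i == j))%N].
  rewrite (_ : mixed_monomial p a _ = fun z => mixed_monomial p a b z * wconj p j z).
    rewrite (_ : (fun z => chi z * _) = fun z => chi z * (mixed_monomial p a b z * (wconj p j z * Q z))).
      rewrite (_ : (fun z => g z * _) = fun z => g z * (mixed_monomial p a b z * (wconj p j z * Q z)))//.
      by apply/funext => z; rewrite !mulrA.
    by apply/funext => z; rewrite !mulrA.
  apply/funext => z; rewrite /mixed_monomial !big_split /= -mulrA; congr (_ * _).
  by rewrite (incr b j _ (fun i => wconj p i z)).
have Plin (c : C) Q Q' : P Q -> P Q' -> P (fun z => c * Q z + Q' z).
  move=> [sQ HQ] [sQ' HQ']; split; first by apply: csmoothD => //; exact: csmoothZ.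
  move=> a b; have sm := csmooth_mixed p a b.
  have E : (fun z => mixed_monomial p a b z * (c * Q z + Q' z)) =
      fun z => c * (mixed_monomial p a b z * Q z) + mixed_monomial p a b z * Q' z.
    by apply/funext => z; move: (mixed_monomial p a b z) (Q z) (Q' z) => u v w; ring.
  have H1 := closed_lin c (csmoothM sm sQ) (csmoothM sm sQ').
  have H2 := series_lin c (csmoothM sm sQ) (csmoothM sm sQ').
  have E1 (h : Cn -> C) : (fun z => h z * (mixed_monomial p a b z * (c * Q z + Q' z))) =
      fun z => h z * (c * (mixed_monomial p a b z * Q z) + mixed_monomial p a b z * Q' z).
    by apply/funext => z; rewrite (congr1 (fun f => f z) E).
  by rewrite !E1 H1 H2 HQ HQ'.
have P1 : P (fun=> 1).
  split=> [|a b]; first exact: csmooth_cst.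
  have E1 (h : Cn -> C) : (fun z => h z * (mixed_monomial p a b z * 1)) =
      fun z => h z * mixed_monomial p a b z by apply/funext => z; rewrite mulr1.
  by rewrite !E1 mixed_monomial_series.
have PL L := sum_prod_poly_ind Plin Pw Pcw P1 L.
have [_ H] := Plin 'i _ _ (PL L2) (PL L1).
have := H [ffun=> 0%N] [ffun=> 0%N].
have E1 (h : Cn -> C) : (fun z => h z * (mixed_monomial p [ffun=> 0%N] [ffun=> 0%N] z * sum_poly L1 L2 z)) =
      fun z => h z * sum_poly L1 L2 z.
  apply/funext => z; rewrite /mixed_monomial big1 ?mul1r// => j _.
  by rewrite !ffunE !expr0 mulr1.
by rewrite !E1.
Qed.

(** Both sides agree on polynomials times the cutoff and are continuous in the C^N norm; polynomials
  approximate phi in that norm. *)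
Lemma series_represents phi : csmooth phi -> (forall z, ~ cbox p (r / 2) z -> phi z = 0) ->
  T phi = cint (fun z => g z * phi z).
Proof.
move=> sp p0; have sc := csmooth_cutoff p profiles.
have [Mg Mg0 HMg] := ccsupp_bounded ccsupp_series.
have [Bc Hc] := bounded_derivs_exists 1 p r N sc.
have Bc0 := bounded_derivs_ge0 ler01 Hc.
pose k : R := (1 + #|{: dir}|%:R) ^+ N.
apply: (eq_of_small (c := `|M| * (Bc * (k * 2)) + 2 * (Mg * 2 * @box_volume R n r))) => e e0.
have [sR sI] := sp.
have rr : r / 2 < r by rewrite ltr_pdivrMr// ltr_pMr// ltr1n.
have [L1 HL1] := smooth_poly_approx N sR r0 rr (fun z Hz => congr1 Re (p0 z Hz)) e0.
have [L2 HL2] := smooth_poly_approx N sI r0 rr (fun z Hz => congr1 Im (p0 z Hz)) e0.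
have sQ : csmooth (sum_poly L1 L2).
  by apply: csmoothD; [apply: csmoothZ|]; exact: csmooth_sum_prod_poly.
pose psi z := -1 * sum_poly L1 L2 z + phi z.
have spsi : csmooth psi by apply: csmoothD => //; exact: csmoothZ.
have dpsi s : (size s <= N)%N -> forall z, cbox p r z -> normc (partials s psi z) <= 2 * e.
  move=> sN z Hz; apply: le_trans (normc_le_abs _) _; rewrite partialsE mulrDl mul1r.
  apply: lerD.
    have := HL1 s sN z Hz; congr (`|rpartials s _ z| <= _); apply/funext => y /=.
    by rewrite !Re_D !Re_M /=; move: (sum_prod_poly p L1 y) (sum_prod_poly p L2 y) (Re (phi y)) => u v w; ring.
  have := HL2 s sN z Hz; congr (`|rpartials s _ z| <= _); apply/funext => y /=.
  rewrite !Im_D !Im_M !Im_D !Im_M ?Re_D ?Re_M /=.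
  by move: (sum_prod_poly p L1 y) (sum_prod_poly p L2 y) (Im (phi y)) => u v w; ring.
have e20 : 0 <= 2 * e by rewrite mulr_ge0// ltW.
have E1 : T phi = T (fun z => chi z * phi z).
  congr T; apply/funext => z; have [Hz|Hz] := pselect (cbox p (r / 2) z).
    by rewrite (cutoff1 r0 profiles Hz) mul1r.
  by rewrite (p0 z Hz) mulr0.
have -> : T phi - cint (fun z => g z * phi z) = T (fun z => chi z * psi z) - cint (fun z => g z * psi z).
  rewrite E1 (closed_lin (-1) sQ sp) (series_lin (-1) sQ sp) polynomial_series.
  by move: (cint _) (T _) (cint _) => u v w; ring.
apply: le_trans (le_normcD _ _) _; rewrite mulrDl; apply: lerD.
  have cv0 z : ~ cbox p r z -> chi z * psi z = 0.
    by move=> Hz; rewrite (cutoff_vanish r0 profiles Hz) mul0r.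
  have adm : admissible p r (fun z => chi z * psi z).
    split=> [|z Hz]; first exact: csmoothM.
    by apply: cv0; apply: contra_not Hz; apply: cbox_le; rewrite ler_peMl ?(ltW r0)// ler1n.
  apply: le_trans (T_dominated adm) _.
  apply: (@le_trans _ _ (`|M| * CN_norm N (fun z => chi z * psi z))).
    by rewrite ler_wpM2r ?CN_norm_ge0// ler_norm.
  rewrite -mulrA ler_wpM2l//.
  have H := bounded_derivsM ler01 sc spsi Hc (bounded_derivs_of_partials dpsi e20).
  apply: le_trans (CN_norm_bounded_derivs ltr01 (lexx 1) cv0 H) _.
  by rewrite expr1n divr1 -/k !mulrA lexx.
rewrite normcN; apply: le_trans (cint_norm_le (M := Mg * (2 * e)) r0 (ccsuppM ccsupp_series (csmooth_continuous spsi)) _) _.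
  move=> z; have [Hz|Hz] := pselect (cbox p r z); last first.
    by rewrite (series_vanish Hz) mul0r Normc.normc0 mulr_ge0.
  rewrite Normc.normcM; apply: ler_pM; rewrite ?normc_ge0//.
  exact: (dpsi [::] (leq0n N) z Hz).
by rewrite -subr_ge0 (_ : _ - _ = 0)//; move: (box_volume r) => v; ring.
Qed.

End series_sum.
Lemma local_representation (Omega : set Cn) (T : (Cn -> C) -> C) (p : Cn) : open Omega ->
  holomorphic_distribution Omega T -> Omega p ->
  exists (rho : R) (g : Cn -> C) (c : K -> C), [/\ 0 < rho, cbox p rho `<=` Omega, continuous g,
    (forall phi, csmooth phi -> (forall z, ~ cbox p rho z -> phi z = 0) ->
      T phi = cint (fun z => g z * phi z)) &
    forall z, cbox p rho z ->
      summability.partial_sum (fun alpha => c alpha * monomial alpha (z - p)) @ summability.totally --> g z].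
Proof.
move=> oO [[Tlin Tbound] Tdbar] Op.
have [e e0 eO] : exists2 e : R, 0 < e & forall z, (forall k, `|xcoord k z - xcoord k p| < e) -> Omega z.
  by apply/nbhs_xcoordP; exact: open_nbhs_nbhs.
(* The construction uses the box of size 6 r around p. *)
pose r := e / 7.
have r0 : 0 < r by rewrite divr_gt0.
have r6 : 6 * r < e by rewrite mulrA ltr_pdivrMr// mulrC ltr_pM2l// ltr_nat.
have bO : cbox p (6 * r) `<=` Omega.
  by move=> z Hz; apply: eO => k; apply: le_lt_trans (Hz k) r6.
have tf phi : admissible p r phi -> test_function Omega phi /\ tsupport phi `<=` cbox p (6 * r).
  by move=> [sp p0]; exact: test_function_cbox.
have T_closed : dbar_closed p r T.
  split=> [a phi psi ap aq|j psi aq]; first by apply: Tlin; [have [] := tf _ ap|have [] := tf _ aq].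
  have [tq _] := tf _ aq; have := Tdbar j psi tq.
  by rewrite /dbar_distribution dbarE => /eqP; rewrite oppr_eq0 => /eqP.
have [N [M HM]] := Tbound _ (@compact_cbox R n p (6 * r)) bO.
have T_dominated : dominated p r T N M by move=> phi /tf[tp sub]; exact: HM.
have [X0 [X [D profiles]]] := exists_cutoff_profiles r0.
have [g [B B0 Hg]] := series_sum r0 profiles T_dominated.
exists (r / 2), g, (coefficient p D T); split.
- by rewrite divr_gt0.
- apply: subset_trans bO; apply: cbox_le.
  by rewrite ler_pdivrMr// -mulrA mulrC -mulrA ler_peMr ?(ltW r0)// -natrM ler1n.
- by move=> z; exact: (continuous_series profiles B0 Hg).
- by move=> phi sp p0; exact: (series_represents r0 profiles T_closed T_dominated B0 Hg sp p0).
- move=> z Hz; apply: (multi_series_cvg B0) => m s us ms.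
  have -> : \sum_(i <- s) coefficient p D T i * monomial i (z - p) =
      \sum_(alpha <- s) series_term p X0 D T alpha z.
    by apply: eq_bigr => alpha _; rewrite /series_term (cutoff1 r0 profiles Hz) mulr1.
  exact: Hg.
Qed.

End local_theorem.

(** * Gluing *)

Section gluing.
Context {R : realType} {n : nat}.
Local Notation C := R[i].
Local Notation Re := (@complex.Re R).
Local Notation Im := (@complex.Im R).
Local Notation normc := (@Normc.normc R).
Local Notation Cn := 'rV[R[i]]_n.
Local Notation vec := (@vec_of_pairs R n).
Local Notation vol := (@volume R n).
Local Open Scope complex_scope.
Implicit Types (phi psi f g h : Cn -> C) (p q z : Cn) (Omega : set Cn).

#[local] Opaque partial rpartial.

Lemma exists_bump p (d : R) : 0 < d -> exists b : Cn -> R, [/\ rsmooth b, (forall z, 0 <= b z),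
  (forall z, cbox p (d / 2) z -> b z = 1) & (forall z, ~ cbox p d z -> b z = 0)].
Proof.
move=> d0; have [st [_ [[sst st1 st2 st01] _ _ _]]] := @exists_cutoff R.
pose x k z := (xcoord k z - xcoord k p) * (xcoord k z - xcoord k p) * (2 / (d * d)).
have dd0 : 0 < d * d by rewrite mulr_gt0.
have x0 k z : x k z = `|xcoord k z - xcoord k p| ^+ 2 * 2 / (d * d).
  by rewrite /x real_normK ?num_real// expr2 mulrA.
exists (fun z => \prod_k st (x k z)); split.
- apply: rsmooth_prod => k; apply: rsmooth_comp => //.
  have s1 : rsmooth (fun z : Cn => xcoord k z - xcoord k p).
    by apply: rsmoothB; [exact: rsmooth_xcoord|exact: rsmooth_cst].
  by apply: rsmoothM (rsmooth_cst _); exact: rsmoothM.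
- by move=> z; apply: prodr_ge0 => k _; have /andP[] := st01 (x k z).
- move=> z Hz; rewrite big1// => k _; apply: st1.
  rewrite x0 ler_pdivrMr// mul1r.
  have H : `|xcoord k z - xcoord k p| ^+ 2 <= (d / 2) ^+ 2.
    by apply: lerXn2r (Hz k); rewrite nnegrE// divr_ge0// ltW.
  rewrite -expr2; move: (ltW dd0); rewrite -expr2 => d2; rewrite expr_div_n in H.
  by move: H; rewrite ler_pdivlMr ?exprn_gt0// -natrX; move: (`|_| ^+ 2) (d ^+ 2) d2 => u v v0; lra.
- move=> z /existsNP[k /negP]; rewrite -ltNge => Hk.
  rewrite (bigD1 k)//= st2 ?mul0r// x0 ler_pdivlMr// mulrC ler_pM2r// -expr2.
  by apply: lerXn2r; rewrite ?nnegrE// ltW.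
Qed.

(** If h z <> 0, the real part of conj(h z) h is positive near z, and so is its integral against a
  small bump. *)
Lemma continuous_eq0 h z (d : R) : 0 < d -> continuous h ->
  (forall phi, csmooth phi -> (forall y, ~ cbox z d y -> phi y = 0) -> cint (fun y => h y * phi y) = 0) ->
  h z = 0.
Proof.
move=> d0 ch H; apply/eqP/negP => /negP hz.
pose a := (h z)^*%C; pose u y := Re (a * h y).
have cu : continuous u.
  move=> y; have [] := (complex_continuousP (fun y => a * h y) y).1 _ => //.
  apply: continuous_cM_at; [exact: cvg_cst|exact: ch].
have uz : 0 < u z.
  rewrite /u /a Re_M /=; case: (h z) hz => x y /=; rewrite eq_complex negb_and /= mulNr opprK => xy.
  rewrite lt_neqAle addr_ge0 -?expr2 ?sqr_ge0// andbT eq_sym paddr_eq0 ?sqr_ge0// !sqrf_eq0 negb_and.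
  exact: xy.
have [e e0 He] : exists2 e : R, 0 < e & forall y, (forall k, `|xcoord k y - xcoord k z| < e) -> 0 < u y.
  by apply/nbhs_xcoordP; apply: (cu z [set x | 0 < x]); exact: lt_nbhsr.
pose e' := Num.min d (e / 2).
have e'0 : 0 < e' by rewrite lt_min d0 divr_gt0.
have [b [sb b0 b1 bo]] := exists_bump z e'0.
have cbu : csupp z e' (fun y => u y * b y).
  split=> [y|y /bo ->]; last by rewrite mulr0.
  by apply: cvgM; [exact: cu|exact: rsmooth_continuous].
have : 0 < rint (fun y => u y * b y).
  apply: (rint_gt0 (z0 := z) e'0 cbu) => [y|].
    have [Hy|/bo ->] := pselect (cbox z e' y); last by rewrite mulr0.
    rewrite mulr_ge0// ltW//; apply: He => k; apply: le_lt_trans (Hy k) _.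
    by apply: (@le_lt_trans _ _ (e / 2)); [rewrite ge_min lexx orbT|rewrite ltr_pdivrMr// ltr_pMr// ltr1n].
  rewrite b1 ?mulr1// => k; rewrite subrr normr0 divr_ge0// ltW//.
have sab : csmooth (fun y => a * (b y)%:C) by apply: csmoothZ; exact: csmooth_real.
have ab0 y : ~ cbox z d y -> a * (b y)%:C = 0.
  by move=> Hy; rewrite bo ?mulr0//; apply: contra_not Hy; apply: cbox_le; rewrite ge_min lexx.
have := congr1 Re (H _ sab ab0); rewrite /cint /= => E.
rewrite (_ : (fun y => u y * b y) = Re \o (fun y => h y * (a * (b y)%:C))); first by rewrite E ltxx.
by apply/funext => y; rewrite /u /= !Re_M /= !Im_M /=; ring.
Qed.

Lemma hausdorff_Cn : hausdorff_space Cn.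
Proof.
move=> p q H; apply: xcoord_inj => k; apply: (@Rhausdorff R) => A B pA qB.
have [z [Az Bz]] := H (xcoord k @^-1` A) (xcoord k @^-1` B) (xcoord_continuous pA) (xcoord_continuous qB).
by exists (xcoord k z).
Qed.

Lemma continuous_normc_at f z : {for z, continuous f} -> {for z, continuous (fun y => normc (f y))}.
Proof.
move=> /complex_continuousP[cR cI].
rewrite (_ : (fun y => _) = fun y => Num.sqrt (Re (f y) * Re (f y) + Im (f y) * Im (f y))); last first.
  by apply/funext => y; rewrite -!expr2; case: (f y).
apply: continuous_comp; last exact: sqrt_continuous.
by apply: cvgD; apply: cvgM.
Qed.

Lemma continuous_loc_integrable Omega f : open Omega -> (forall z, Omega z -> {for z, continuous f}) ->
  loc_integrable Omega f.
Proof.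
move=> oO cf; split.
- by apply: (measurable_vec_continuous (g := Re \o f) oO) => z /cf /complex_continuousP[].
- by apply: (measurable_vec_continuous (g := Im \o f) oO) => z /cf /complex_continuousP[].
move=> L cL LO.
have cn z : Omega z -> {for z, continuous (fun y => normc (f y))}.
  by move=> /cf; exact: continuous_normc_at.
have mL : measurable (vec @^-1` L).
  rewrite -[L]setCK -preimage_setC; apply: measurableC; apply: measurable_vec_open.
  by apply: closed_openC; apply: compact_closed => //; exact: hausdorff_Cn.
have [M HM] : exists M : R, forall z, L z -> normc (f z) <= M.
  have [->|/set0P L0] := eqVneq L set0; first by exists 0.
  have [|c _ Hc] := @compact_EVT_max _ R (fun z => normc (f z)) L L0 cL.
    by apply: continuous_in_subspaceT => z; rewrite inE => /LO/cn.
  by exists (normc (f c)) => z Lz; apply: Hc; rewrite inE.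
have [A A0 LA] := compact_subset_cbox 0 cL.
have M0 : (0 <= `|M|%:E)%E by rewrite lee_fin.
apply: (@le_lt_trans _ _ (\int[vol]_(t in vec @^-1` L) (cst `|M|%:E) t)%E).
  apply: ge0_le_integral => //.
  - by move=> t _; rewrite lee_fin normc_ge0.
  - apply/measurable_realfun.measurable_EFinP.
    apply: (@measurable_funS _ _ _ _ (vec @^-1` Omega)); [exact: measurable_vec_open|exact: preimage_subset|].
    exact: (measurable_vec_continuous oO cn).
  - by move=> t Lt; rewrite lee_fin; apply: le_trans (HM _ Lt) (ler_norm _).
rewrite integral_cst// lte_mul_pinfty//; apply: le_lt_trans (vol_tbox_fin (pairs_of 0) A0).
apply: le_measure; rewrite ?inE//; last by rewrite -vec_cbox; exact: preimage_subset.
exact: measurable_tbox.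
Qed.

Lemma tsupport_zero phi z : ~ tsupport phi z -> phi z = 0.
Proof. by move=> Hz; apply/eqP/negP => /negP nz; apply: Hz; exact: subset_closure. Qed.

(** Near a point outside Omega the product is 0, since the support of phi is closed and contained in
  Omega. *)
Lemma continuous_test_product Omega f phi : (forall z, Omega z -> {for z, continuous f}) ->
  test_function Omega phi -> continuous (fun z => f z * phi z).
Proof.
move=> cf [/csmoothP sp _ pO] z; have [Oz|Oz] := pselect (Omega z).
  by apply: continuous_cM_at; [exact: cf|exact: (csmooth_continuous sp)].
have Hz : ~ tsupport phi z by move=> /pO.
have zero y : ~ tsupport phi y -> f y * phi y = 0 by move=> /tsupport_zero ->; rewrite mulr0.
move=> A; rewrite /= zero// => /nbhs_singleton A0.
have : nbhs z (~` tsupport phi).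
  by apply: open_nbhs_nbhs; split => //; apply: closed_openC; exact: closed_closure.
by apply: filterS => y Hy; rewrite /= zero.
Qed.

Lemma ccsupp_test_product Omega f phi q (A : R) : (forall z, Omega z -> {for z, continuous f}) ->
  test_function Omega phi -> (forall z, ~ cbox q A z -> phi z = 0) -> ccsupp q A (fun z => f z * phi z).
Proof.
by move=> cf tp p0; split=> [|z /p0 ->]; [exact: continuous_test_product cf tp|rewrite mulr0].
Qed.

Lemma compact_box_cover Omega (L : set Cn) (rho : Cn -> R) : compact L -> L `<=` Omega ->
  (forall p, Omega p -> 0 < rho p) ->
  exists s : seq Cn, (forall p, p \in s -> Omega p) /\
    forall z, L z -> exists2 p, p \in s & cbox p (rho p) z.
Proof.
move=> cL LO rho0.
have cov := cL; rewrite compact_cover in cov.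
have [|z Lz|D' D'O LD'] := cov Cn Omega (fun p => interior (cbox p (rho p))).
- by move=> p _; exact: open_interior.
- exists z; first exact: LO.
  apply/nbhs_xcoordP; exists (rho z); first exact/rho0/LO.
  by move=> y Hy k; exact: ltW.
exists D'; split=> [p /D'O|z /LD'[p /= pD' Hp]]; first by rewrite inE.
by exists p => //; exact: interior_subset Hp.
Qed.

Lemma cbox_trans p z (a b : R) : cbox p a z -> cbox z b `<=` cbox p (a + b).
Proof.
move=> Hz y Hy k; rewrite [leRHS]addrC; apply: le_trans (lerD (Hy k) (Hz k)).
by rewrite -[X in `|X|](subrKA (xcoord k z)) ler_normD.
Qed.

Lemma nbhs_cbox p (a : R) : 0 < a -> nbhs p (cbox p a).
Proof. by move=> a0; apply/nbhs_xcoordP; exists a => // y Hy k; exact: ltW. Qed.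

Lemma represented_eq (T : (Cn -> C) -> C) g h z (d : R) : 0 < d -> continuous g -> continuous h ->
  (forall phi, csmooth phi -> (forall y, ~ cbox z d y -> phi y = 0) ->
    T phi = cint (fun y => g y * phi y) /\ T phi = cint (fun y => h y * phi y)) ->
  g z = h z.
Proof.
move=> d0 cg ch H; apply/eqP; rewrite -subr_eq0 -mulN1r addrC; apply/eqP.
apply: (continuous_eq0 (h := fun y => -1 * h y + g y) d0) => [|phi sp p0].
  apply: continuous_cD cg; apply: continuous_cM ch => y; exact: cvg_cst.
have [Tg Th] := H phi sp p0; have cp := ccsupp_smooth sp p0.
have cs f : continuous f -> ccsupp z d (fun y => f y * phi y).
  move=> cf; split=> [|y /p0 ->]; last by rewrite mulr0.
  exact: continuous_cM (csmooth_continuous sp).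
have := cint_lin (-1) d0 (cs h ch) (cs g cg); rewrite -Tg -Th mulN1r addNr => E.
by rewrite -[RHS]E; congr cint; apply/funext => y; rewrite mulrDl mulrA.
Qed.

(** Split off phi b for a bump b on the first box: the remainder phi (1 - b) vanishes on the smaller
  box where b = 1, and lives in the other ones. *)
Lemma represents_of_local Omega (T : (Cn -> C) -> C) f (rho : Cn -> R) :
  (forall (a : C) phi psi, test_function Omega phi -> test_function Omega psi ->
     T (fun z => a * phi z + psi z) = a * T phi + T psi) ->
  (forall z, Omega z -> {for z, continuous f}) -> (forall p, Omega p -> 0 < rho p) ->
  (forall p phi, Omega p -> test_function Omega phi -> (forall z, ~ cbox p (rho p) z -> phi z = 0) ->
     T phi = cint (fun z => f z * phi z)) ->
  forall phi, test_function Omega phi -> T phi = cint (fun z => f z * phi z).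
Proof.
move=> Tlin cf rho0 Hloc.
have T0 : T (fun=> 0) = 0.
  have := Tlin 1 _ _ (test_function0 Omega) (test_function0 Omega).
  rewrite (_ : (fun z => 1 * 0 + 0) = fun=> 0); last by apply/funext => z; rewrite mulr0 addr0.
  by rewrite mul1r -[LHS]addr0 => /addrI <-.
have main (s : seq Cn) phi : (forall p, p \in s -> Omega p) -> test_function Omega phi ->
    (forall z, phi z != 0 -> exists2 p, p \in s & cbox p (rho p / 2) z) ->
    T phi = cint (fun z => f z * phi z).
  elim: s phi => [|p s IH] phi sO tp cov.
    have -> : phi = fun=> 0 by apply/funext => z; apply/eqP/negP => /negP /cov[].
    rewrite T0 (_ : (fun z => _) = fun=> 0); last by apply/funext => z; rewrite mulr0.
    by rewrite cint0.
  have Op : Omega p by apply: sO; rewrite mem_head.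
  have [b [sb _ b1 bo]] := exists_bump p (rho0 p Op).
  have scb : csmooth (fun z => (b z)%:C) by exact: csmooth_real.
  have scb' : csmooth (fun z => 1 - (b z)%:C) by apply: csmoothB => //; exact: csmooth_cst.
  have tp1 := test_functionM tp scb; have tp2 := test_functionM tp scb'.
  have [_ cp _] := tp; have [A A0 pA] := compact_subset_cbox 0 cp.
  have pA0 z : ~ cbox 0 A z -> phi z = 0 by move=> Hz; apply: tsupport_zero => /pA.
  have E : phi = fun z => 1 * (phi z * (b z)%:C) + phi z * (1 - (b z)%:C).
    by apply/funext => z; rewrite mul1r -mulrDr addrC subrK mulr1.
  have TE : T phi = T (fun z => phi z * (b z)%:C) + T (fun z => phi z * (1 - (b z)%:C)).
    by rewrite {1}E Tlin// mul1r.
  have c1 : ccsupp 0 A (fun z => f z * (phi z * (b z)%:C)).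
    by apply: (ccsupp_test_product cf tp1) => z /pA0 ->; rewrite mul0r.
  have c2 : ccsupp 0 A (fun z => f z * (phi z * (1 - (b z)%:C))).
    by apply: (ccsupp_test_product cf tp2) => z /pA0 ->; rewrite mul0r.
  have IE : cint (fun z => f z * phi z) =
      cint (fun z => f z * (phi z * (b z)%:C)) + cint (fun z => f z * (phi z * (1 - (b z)%:C))).
    rewrite -(cintD A0 c1 c2); congr cint; apply/funext => z.
    by rewrite -mulrDr -mulrDr addrC subrK mulr1.
  rewrite TE IE (IH _ _ tp2); last 2 first.
  - by move=> q qs; apply: sO; rewrite inE qs orbT.
  - move=> z; rewrite mulf_eq0 negb_or => /andP[pz bz]; have [q] := cov z pz.
    rewrite inE => /orP[/eqP -> Hz|qs Hq]; last by exists q.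
    by move: bz; rewrite b1// subrr eqxx.
  by rewrite (Hloc p _ Op tp1)// => z Hz; rewrite bo ?mulr0.
move=> phi tp; have [_ cp pO] := tp.
have [s [sO Hs]] := compact_box_cover cp pO (fun p Op => divr_gt0 (rho0 p Op) (ltr0n _ 2)).
by apply: (main s) => // z pz; apply: Hs; exact: subset_closure.
Qed.

End gluing.

Local Open Scope complex_scope.

Theorem corollary3p1 (R : realType) (n : nat) (Omega : set 'rV[R[i]]_n)
    (T : ('rV[R[i]]_n -> R[i]) -> R[i]) :
  open Omega -> holomorphic_distribution Omega T ->
  exists f : 'rV[R[i]]_n -> R[i],
    generated_by Omega T f /\ complex_analytic_on Omega f.
Proof.
move=> oO hT.
have /choice[rho /choice[g /choice[c Hloc]]] : forall p, exists (rho : R) (g : 'rV[R[i]]_n -> R[i])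
    (c : {ffun 'I_n -> nat} -> R[i]), Omega p -> [/\ 0 < rho, cbox p rho `<=` Omega, continuous g,
    (forall phi, csmooth phi -> (forall z, ~ cbox p rho z -> phi z = 0) ->
      T phi = cint (fun z => g z * phi z)) &
    forall z, cbox p rho z ->
      summability.partial_sum (fun alpha => c alpha * monomial alpha (z - p)) @ summability.totally --> g z].
  move=> p; have [Op|nOp] := pselect (Omega p); last by exists 0, (fun=> 0), (fun=> 0).
  by have [rho [g [c H]]] := local_representation oO hT Op; exists rho, g, c.
have rho0 p : Omega p -> 0 < rho p by move=> /Hloc[].
have half0 p : Omega p -> 0 < rho p / 2 by move=> /rho0 H; rewrite divr_gt0.
have half p : Omega p -> cbox p (rho p / 2) `<=` cbox p (rho p).
  by move=> /rho0 H; apply: cbox_le; rewrite ler_pdivrMr// ler_pMr// ler1n.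
have boxO p : Omega p -> cbox p (rho p) `<=` Omega by move=> /Hloc[].
have cg p : Omega p -> continuous (g p) by move=> /Hloc[].
pose f z := g z z.
(* Both sums represent T on a box around z that lies in the boxes around z and around p. *)
have fE p z : Omega p -> cbox p (rho p / 2) z -> f z = g p z.
  move=> Op Hz; have Oz : Omega z by apply: (boxO p Op); exact: half.
  have d0 : 0 < Num.min (rho z) (rho p / 2) by rewrite lt_min rho0// half0.
  apply: (represented_eq (T := T) d0 (cg z Oz) (cg p Op)) => phi sp p0.
  have [_ _ _ Tz _] := Hloc z Oz; have [_ _ _ Tp _] := Hloc p Op.
  split; [apply: Tz => //|apply: Tp => //] => y Hy; apply: p0; apply: contra_not Hy.
    by apply: cbox_le; rewrite ge_min lexx.
  move=> Hy; rewrite [rho p]splitr; apply: (cbox_trans Hz).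
  by apply: cbox_le Hy; rewrite ge_min lexx orbT.
have cf z : Omega z -> {for z, continuous f}.
  move=> Oz A; rewrite /= (fE z z Oz (nbhs_singleton (nbhs_cbox z (half0 z Oz)))) => HA.
  have H : nbhs z (f @^-1` A).
    have : nbhs z (cbox z (rho z / 2) `&` g z @^-1` A).
      by apply: filterI; [exact: nbhs_cbox (half0 z Oz)|exact: (cg z Oz z A HA)].
    by apply: filterS => y [Hy]; rewrite /= (fE z y Oz Hy).
  exact: H.
exists f; split; last first.
  move=> p Op; exists (cbox p (rho p / 2)), (c p); split.
  - exact: nbhs_cbox (half0 p Op).
  - exact: subset_trans (half p Op) (boxO p Op).
  - move=> z Hz; rewrite (fE p z Op Hz); have [_ _ _ _] := Hloc p Op; apply; exact: half.
split; first exact: continuous_loc_integrable.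
move=> phi tp; have [_ _ pO] := tp.
rewrite volume_integralE; last by move=> z Oz; rewrite (tsupport_zero (phi := phi)) ?mulr0// => /pO.
apply: (represents_of_local hT.1.1 cf half0) tp => p psi Op [/csmoothP sp _ _] p0.
have [_ _ _ Tp _] := Hloc p Op.
rewrite Tp//; last by move=> z Hz; apply: p0; apply: contra_not Hz; exact: half.
congr cint; apply/funext => z; have [Hz|Hz] := pselect (cbox p (rho p / 2) z).
  by rewrite (fE p z Op Hz).
by rewrite p0// !mulr0.
Qed.
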